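(* Consider the family of It\^o stochastic linear systems with additive Brownian noise, indexed by $\beta\in K$, $$\mathrm{d}X(t,\beta)=A(t,\beta)X(t,\beta)\,\mathrm{d}t+B(t,\beta)u(t)\,\mathrm{d}t+G(t,\beta)\,\mathrm{d}W(t),$$ with $A\in L_\infty^{n\times n}(D)$, $B\in L_2^{n\times m}(D)$, $G\in L_2^{n\times k}(D)$, $D=[0,T]\times K$, and suppose that this family is ensemble controllable on $\mathcal{H}_K$. Let $X_0,X_F\in\mathcal{H}_K$. Then the control $u\in\mathcal{H}_T$ that minimizes $$\mathcal{J}_1=\|\mathcal{E}X_T-X_F\|_K,$$ the norm of the error in the mean of the terminal state, while steering the system from the initial state $X(0,\beta)=X_0(\beta)$ to the target state $X(T,\beta)=X_F(\beta)$, must satisfy $$\int_0^{T}\Phi(0,\sigma,\beta)B(\sigma,\beta)u(\sigma)\,\mathrm{d}\sigma=\Phi(0,T,\beta)X_F(\beta)-X_0(\beta)$$ (as an equation between functions of $\beta\in K$).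
   Context: Setting: $T>0$; $K\subset\mathbb{R}^d$ is compact; $D=[0,T]\times K$; the state $X$ takes values in $M\subset\mathbb{R}^n$, and the control $u:[0,T]\to U\subset\mathbb{R}^m$ is open-loop, i.e. a function of $t$ only, the same for all $\beta$ and all realizations of the noise. $A\in L_\infty^{n\times n}(D)$, $B\in L_2^{n\times m}(D)$, $G\in L_2^{n\times k}(D)$ mean that $A(t,\beta)\in\mathbb{R}^{n\times n}$, $B(t,\beta)\in\mathbb{R}^{n\times m}$, $G(t,\beta)\in\mathbb{R}^{n\times k}$ have entries that are real $L_\infty(D)$, $L_2(D)$, $L_2(D)$ functions, respectively. $W:[0,T]\times\Omega\to\mathbb{R}^k$ is a standard $k$-dimensional Brownian motion (independent identically distributed components) on a probability space $(\Omega,\mathcal{F},\mathbb{P})$ with its natural filtration, so $\mathcal{E}W(t)=0$ and $\mathcal{E}[W(t)W'(s)]=I\min(t,s)$. $\mathcal{E}$ denotes expectation with respect to $\mathbb{P}$, and $'$ denotes transpose. The argument $\omega\in\Omega$ of $X$ and $W$ is suppressed. Function spaces: $\mathcal{H}_T=L_2^m[0,T]$ is the Hilbert space of square-integrable $\mathbb{R}^m$-valued functions on $[0,T]$ with inner product $\langle g,h\rangle_T=\int_0^T g'(t)h(t)\,\mathrm{d}t$. $\mathcal{H}_K=L_2^n(K)$ is the Hilbert space of square-integrable $\mathbb{R}^n$-valued functions on $K$ with inner product $\langle p,q\rangle_K=\int_K p'(\beta)q(\beta)\,\mathrm{d}\mu(\beta)$, $\mu$ being Lebesgue measure, and induced norm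 $\|\cdot\|_K$. $X_T(\beta)=X(T,\beta)$ is the terminal state. The initial and target states $X_0,X_F$ are (non-random) elements of $\mathcal{H}_K$. $\mathcal{J}_1=\left(\int_K\|\mathcal{E}X_T(\beta)-X_F(\beta)\|_2^2\,\mathrm{d}\mu(\beta)\right)^{1/2}$, where $\|\cdot\|_2$ is the Euclidean norm. Steering the stochastic ensemble between states in $\mathcal{H}_K$ by an open-loop control refers to steering its instantaneous expected state $\mathcal{E}X$. $\Phi(t,s,\beta)$ denotes the transition matrix (from time $s$ to time $t$) of the homogeneous system $\dot X(t,\beta)=A(t,\beta)X(t,\beta)$. Ensemble controllable: the family is ensemble controllable on $\mathcal{H}_K$ if for all $\epsilon>0$ and all $X_0,X_F\in\mathcal{H}_K$ there exist $T>0$ and an open-loop piecewise-continuous control $u\in\mathcal{H}_T$ such that, starting from $X(0,\beta)=X_0(\beta)$, the final state $X(T,\beta)=X_T(\beta)$ satisfies $\|\mathcal{E}X_T-X_F\|_K<\epsilon$. *)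

(* Defs.v *)
From HB Require Import structures.
From mathcomp Require Import all_boot all_order all_algebra.
From mathcomp Require Import all_classical all_reals all_analysis.

Set Implicit Arguments.
Unset Strict Implicit.
Unset Printing Implicit Defensive.

Import Order.TTheory GRing.Theory Num.Theory.
Import numFieldNormedType.Exports.

Local Open Scope classical_set_scope.
Local Open Scope ring_scope.

(* A point of R^d is a d-tuple; the library's sigma-algebra on tuples is the
   one generated by the coordinates, i.e. the Borel one.  Lebesgue measure on
   R^(d+1) is the product of the one on R and the one on R^d, transported along
   (x, y) |-> x :: y; on R^0 it is the unit mass at the empty tuple. *)
Section lebesgue_tuple.
Context {R : realType}.
Local Notation RT := (measurableTypeR R).

Definition tcons d (x : RT * d.-tuple RT) : d.+1.-tuple RT := [tuple of x.1 :: x.2].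

Definition tuncons d (x : d.+1.-tuple RT) : RT * d.-tuple RT :=
  (thead x, [tuple of behead x]).

Lemma measurable_tcons d : measurable_fun setT (@tcons d).
Proof. exact: measurable_cons. Qed.

Lemma measurable_tuncons d : measurable_fun setT (@tuncons d).
Proof.
apply/measurable_fun_pairP; split => /=.
  exact: measurable_tnth.
exact: measurable_behead.
Qed.

Lemma tconsK d : cancel (@tcons d) (@tuncons d).
Proof. by case=> x y; congr pair; apply/val_inj. Qed.

Section successor.
Context d (mu : {sigma_finite_measure set (d.-tuple RT) -> \bar R}).

Definition lebesgue_succ : set (d.+1.-tuple RT) -> \bar R :=
  pushforward (lebesgue_measure \x mu)%E (@tcons d).

Let lebesgue_succ0 : lebesgue_succ set0 = 0%E.
Proof. by rewrite /lebesgue_succ /pushforward preimage_set0 measure0. Qed.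

Let lebesgue_succ_ge0 A : (0 <= lebesgue_succ A)%E.
Proof. by rewrite /lebesgue_succ /pushforward; exact: measure_ge0. Qed.

Let lebesgue_succ_sigma_additive : semi_sigma_additive lebesgue_succ.
Proof.
move=> F mF tF mUF; rewrite /lebesgue_succ /pushforward preimage_bigcup.
apply: measure_semi_sigma_additive.
- by move=> i; rewrite -[X in measurable X]setTI; exact: measurable_tcons.
- apply/trivIsetP => i j _ _ ij; rewrite -preimage_setI.
  by move/trivIsetP : tF => ->//; rewrite preimage_set0.
- rewrite -preimage_bigcup -[X in measurable X]setTI.
  exact: measurable_tcons.
Qed.

HB.instance Definition _ := isMeasure.Build _ _ _ lebesgue_succ
  lebesgue_succ0 lebesgue_succ_ge0 lebesgue_succ_sigma_additive.

Let lebesgue_succ_sigma_finite : sigma_finite setT lebesgue_succ.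
Proof.
pose nu : {sigma_finite_measure set RT -> \bar R} := lebesgue_measure.
have /sigma_finiteP[F [FT ndF Foo]] := sigma_finiteT nu.
have /sigma_finiteP[G [GT ndG Goo]] := sigma_finiteT mu.
exists (fun i => @tuncons d @^-1` (F i `*` G i)).
  rewrite -preimage_bigcup (_ : \bigcup_i _ = setT) ?preimage_setT//.
  rewrite -setXTT FT GT predeqE => -[x y]; split.
    by move=> [n _ []/= ? ?]; split; exists n.
  move=> [/= [n _ Fnx] [k _ Gky]]; exists (maxn n k) => //; split.
  - by move: x Fnx; exact/subsetPset/ndF/leq_maxl.
  - by move: y Gky; exact/subsetPset/ndG/leq_maxr.
move=> i; have [mF Fi] := Foo i; have [mG Gi] := Goo i; split.
  by rewrite -[X in measurable X]setTI; apply: measurable_tuncons => //;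
    exact: measurableX.
rewrite /lebesgue_succ /pushforward -comp_preimage.
rewrite (_ : @tuncons d \o @tcons d = id); last first.
  by apply/funext => x /=; rewrite tconsK.
by rewrite preimage_id product_measure1E// lte_mul_pinfty// ge0_fin_numE.
Qed.

HB.instance Definition _ := Measure_isSigmaFinite.Build _ _ _ lebesgue_succ
  lebesgue_succ_sigma_finite.

End successor.

Fixpoint lebesgue_tuple d : {sigma_finite_measure set (d.-tuple RT) -> \bar R} :=
  match d with
  | 0 => dirac [tuple]
  | d'.+1 => lebesgue_succ (lebesgue_tuple d')
  end.

End lebesgue_tuple.

Section function_spaces.
Context {R : realType}.

(* Elements of L_p are handled through everywhere-defined representatives;
   f \_ D is f extended by 0 outside D. *)
Definition Lp_on disp (T : measurableType disp) (mu : {measure set T -> \bar R})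
    (p : \bar R) (D : set T) (f : T -> R) : Prop :=
  measurable_fun D f /\ ('N[mu]_p [EFin \o (f \_ D)] < +oo)%E.

Definition Lp_mx disp (T : measurableType disp) (mu : {measure set T -> \bar R})
    (p : \bar R) (D : set T) n m (F : T -> 'M[R]_(n, m)) : Prop :=
  forall i j, Lp_on mu p D (fun x => F x i j).

(* For a column this is the squared Euclidean norm. *)
Definition sqnorm n m (M : 'M[R]_(n, m)) : R := \sum_i \sum_j M i j ^+ 2.

Definition mx_integral n m (D : set R) (F : R -> 'M[R]_(n, m)) : 'M[R]_(n, m) :=
  \matrix_(i, j) (\int[lebesgue_measure]_(s in D) F s i j).

(* Compactness is that of the row vectors, for the usual topology of R^d. *)
Definition compact_tuple d (K : set (d.-tuple (measurableTypeR R))) : Prop :=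
  compact ((fun b => \row_i (tnth b i : R)) @` K : set 'rV[R]_d).

Definition HK d (K : set (d.-tuple (measurableTypeR R))) n
    (p : d.-tuple (measurableTypeR R) -> 'cV[R]_n) : Prop :=
  Lp_mx (lebesgue_tuple d) 2%:E K p.

Definition normK d (K : set (d.-tuple (measurableTypeR R))) n
    (p : d.-tuple (measurableTypeR R) -> 'cV[R]_n) : \bar R :=
  ((\int[lebesgue_tuple d]_(b in K) (sqnorm (p b))%:E) `^ 2^-1)%E.

Definition HT m (S : R) (u : R -> 'cV[R]_m) : Prop :=
  Lp_mx lebesgue_measure 2%:E `[0, S] u.

Definition piecewise_continuous m (S : R) (u : R -> 'cV[R]_m) : Prop :=
  forall j,
  [/\ exists pts : seq R, forall t, 0 < t < S -> t \notin pts ->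
        {for t, continuous (fun s => u s j 0)},
      forall t, 0 <= t < S -> cvg (u s j 0 @[s --> t^'+]) &
      forall t, 0 < t <= S -> cvg (u s j 0 @[s --> t^'-])].

(* Carathéodory form of dPhi(t, s)/dt = a(t) Phi(t, s), Phi(s, s) = 1, for s and
   t in any order. *)
Definition transition_matrix n (T : R) (a : R -> 'M[R]_n) (phi : R -> R -> 'M[R]_n)
    : Prop :=
  forall s, 0 <= s <= T ->
  (forall i j, {within `[0, T], continuous (fun t => phi t s i j)}) /\
  forall t, 0 <= t <= T ->
    phi t s = 1%:M + (if s <= t then mx_integral `[s, t] (fun r => a r *m phi r s)
                      else - mx_integral `[t, s] (fun r => a r *m phi r s)).

End function_spaces.

Section stochastic.
Context {R : realType} {dO : measure_display} {Omega : measurableType dO}.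
Variable P : probability Omega R.

Definition brownian_motion k (T : R) (W : R -> Omega -> 'cV[R]_k) : Prop :=
  [/\ forall t i, 0 <= t <= T -> measurable_fun setT (fun w => W t w i 0),
      {ae P, forall w, W 0 w = 0},
      {ae P, forall w, forall i, {within `[0, T], continuous (fun t => W t w i 0)}},
      forall i s t, 0 <= s -> s < t -> t <= T ->
        forall V : set R, measurable V ->
        P [set w | V (W t w i 0 - W s w i 0)] =
        normal_prob 0 (Num.sqrt (t - s)) V &
      (* mutual independence of all components of all successive increments *)
      forall (N : nat) (tau : nat -> R) (V : nat -> 'I_k -> set R),
        0 <= tau 0%N -> (forall j, (j < N)%N -> tau j <= tau j.+1) ->
        tau N <= T -> (forall j i, measurable (V j i)) ->
        P [set w | forall j i, (j < N)%N ->
                     V j i (W (tau j.+1) w i 0 - W (tau j) w i 0)] =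
        (\big[*%E/1]_(j < N) \big[*%E/1]_(i < k)
          P [set w | V j i (W (tau j.+1) w i 0 - W (tau j) w i 0)%R])%E].

Definition natural_filtration k (W : R -> Omega -> 'cV[R]_k) (t : R)
    : set (set Omega) :=
  <<s [set E | exists s i (V : set R), [/\ 0 <= s <= t, measurable V &
                 E = [set w | V (W s w i 0)]] ] >>.

(* [:: (a_1, b_1, c_1); ...] stands for the deterministic step function
   sum_q c_q 1_[a_q, b_q[. *)
Definition step_fun n k (h : seq (R * R * 'M[R]_(n, k))) (s : R) : 'M[R]_(n, k) :=
  \sum_(c <- h) (\1_(`[c.1.1, c.1.2[%classic) s : R) *: c.2.

Definition step_integral n k (W : R -> Omega -> 'cV[R]_k)
    (h : seq (R * R * 'M[R]_(n, k))) (w : Omega) : 'cV[R]_n :=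
  \sum_(c <- h) c.2 *m (W c.1.2 w - W c.1.1 w).

(* N is (a version of) the Itô integral of the deterministic integrand g over
   [0, t]: the limit in L_2(Omega) of the integrals of step functions converging
   to g in L_2[0, t].  By Itô's isometry the limit does not depend on the
   sequence. *)
Definition ito_integral n k (W : R -> Omega -> 'cV[R]_k) (t : R)
    (g : R -> 'M[R]_(n, k)) (N : Omega -> 'cV[R]_n) : Prop :=
  (forall i, measurable_fun setT (fun w => N w i 0)) /\
  exists h : nat -> seq (R * R * 'M[R]_(n, k)),
  [/\ forall q, all (fun c => [&& 0 <= c.1.1, c.1.1 <= c.1.2 & c.1.2 <= t]) (h q),
      (\int[lebesgue_measure]_(s in `[0%R, t])
         (sqnorm (g s - step_fun (h q) s))%:E)%E @[q --> \oo] --> (0 : \bar R) &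
      (\int[P]_w (sqnorm (N w - step_integral W (h q) w))%:E)%E
         @[q --> \oo] --> (0 : \bar R)].

(* Z is a (strong, square-integrable) solution on [0, S] of
   dZ = a Z dt + b u dt + g dW, Z(0) = x0. *)
Definition sde_solution n m k (W : R -> Omega -> 'cV[R]_k) (S : R)
    (a : R -> 'M[R]_n) (b : R -> 'M[R]_(n, m)) (g : R -> 'M[R]_(n, k))
    (u : R -> 'cV[R]_m) (x0 : 'cV[R]_n) (Z : R -> Omega -> 'cV[R]_n) : Prop :=
  [/\ forall t i (V : set R), 0 <= t <= S -> measurable V ->
        natural_filtration W t [set w | V (Z t w i 0)],
      forall i, Lp_on (lebesgue_measure \x P)%E 2%:E (`[0, S] `*` setT)
        (fun p : measurableTypeR R * Omega => Z p.1 p.2 i 0),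
      {ae P, forall w, forall i, {within `[0, S], continuous (fun t => Z t w i 0)}} &
      forall t, 0 <= t <= S -> exists N : Omega -> 'cV[R]_n,
        ito_integral W t g N /\
        {ae P, forall w, Z t w =
          x0 + mx_integral `[0, t] (fun s => a s *m Z s w + b s *m u s) + N w}].

Section ensemble.
Context {d n m k : nat}.
Local Notation Rd := (d.-tuple (measurableTypeR R)).
Variable W : R -> Omega -> 'cV[R]_k.
Variable K : set Rd.
Variables (A : R -> Rd -> 'M[R]_n) (B : R -> Rd -> 'M[R]_(n, m))
  (G : R -> Rd -> 'M[R]_(n, k)).

Definition mean (X : R -> Rd -> Omega -> 'cV[R]_n) (t : R) (b : Rd) : 'cV[R]_n :=
  \col_i fine 'E_P[fun w => X t b w i 0].

(* The family is an element of an L_2 space in beta, so the equation is required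
   for almost every beta; the state of the ensemble at time t is its mean, as an
   element of H_K. *)
Definition ensemble_solution (S : R) (u : R -> 'cV[R]_m) (X0 : Rd -> 'cV[R]_n)
    (X : R -> Rd -> Omega -> 'cV[R]_n) : Prop :=
  {ae lebesgue_tuple d, forall b, K b ->
     sde_solution W S (A ^~ b) (B ^~ b) (G ^~ b) u (X0 b) (fun t => X t b)} /\
  forall t, 0 <= t <= S -> HK K (mean X t).

Definition mean_error (XF : Rd -> 'cV[R]_n) (S : R)
    (X : R -> Rd -> Omega -> 'cV[R]_n) : \bar R :=
  normK K (fun b => mean X S b - XF b).

Definition control (U : set 'cV[R]_m) (S : R) (u : R -> 'cV[R]_m) : Prop :=
  HT S u /\ forall t, 0 <= t <= S -> U (u t).

(* The system is only given up to time T, hence so is the terminal time S. *)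
Definition ensemble_controllable (T : R) (U : set 'cV[R]_m) : Prop :=
  forall (eps : R) (X0 XF : Rd -> 'cV[R]_n), 0 < eps -> HK K X0 -> HK K XF ->
  exists (S : R) (u : R -> 'cV[R]_m) (X : R -> Rd -> Omega -> 'cV[R]_n),
  [/\ 0 < S <= T, control U S u, piecewise_continuous S u,
      ensemble_solution S u X0 X & (mean_error XF S X < eps%:E)%E].

(* All solutions of the equation driven by a given control have the same mean,
   so that the error is a function of the control alone. *)
Definition minimizes_mean_error (T : R) (U : set 'cV[R]_m)
    (X0 XF : Rd -> 'cV[R]_n) (u : R -> 'cV[R]_m) : Prop :=
  control U T u /\
  exists X, ensemble_solution T u X0 X /\
  forall v Y, control U T v -> ensemble_solution T v X0 Y ->
    (mean_error XF T X <= mean_error XF T Y)%E.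

End ensemble.
End stochastic.

(* Main.v *)
(* The Ito integrals have mean zero, so psi(t) m(t) = X0 + int_0^t psi B u for the
   mean m of the state, where psi(t) = Phi(0, t); the claim is that the error
   e = m(T) - XF of a minimizer u vanishes.  For an admissible w, replacing u by w
   on ]s, t] only changes m(T) by Phi(T, 0) r with r = int_]s,t] psi B (w - u),
   and the L_2(K)-norm squared of r is at most a constant times
   (int_]s,t] |B|^2) (int_]s,t] |w - u|^2).  Minimality gives
   0 <= 2 <e', r> + O(|r|^2) with e' = Phi(T, 0)^T e; summing over a fine partition
   of [0, T] removes the second-order term, so that 0 <= <e', int_0^T psi B (w - u)>
   for every admissible w.  Controllability, applied to the initial state N e' and
   the target 0, yields a w for which the integral is - N e' up to a bounded term;
   letting N grow, e' = 0. *)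

Require Import Defs.
From HB Require Import structures.
From mathcomp Require Import all_boot all_order all_algebra.
From mathcomp Require Import all_classical all_reals all_analysis.
From mathcomp Require Import measurable_realfun ess_sup_inf ring lra.
Set Implicit Arguments.
Unset Strict Implicit.
Unset Printing Implicit Defensive.
Import Order.TTheory GRing.Theory Num.Theory.
Import numFieldNormedType.Exports.
Local Open Scope classical_set_scope.
Local Open Scope ring_scope.

(** * Matrix-valued primitives and the product rule *)

(** Three obstacles shape the details. [A] is bounded only almost everywhere and [Phi] carries no
    measurability in the parameter; hence [A] is replaced by a bounded, jointly measurable [A'],
    whose fundamental matrix [Psi] and inverse [psi] are built by Picard iteration for every
    parameter value, measurably and with uniform bounds, and [Phi 0 s b] is identified with
    [psi s b] only at the end, for almost every [b]. Minimality compares [u] only with controls that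
    come with a solution of the whole ensemble; as the noise is additive, such a solution is
    obtained for any square-integrable control by adding a deterministic response to the solution
    given for [u]. Controllability reaches its target at some [S <= T] that cannot be chosen;
    pulling all responses back to time 0 by [psi] removes the terminal time from them, so a control
    that returns to [u] after [S] has on [[0, T]] the same response relative to [u] as on
    [[0, S]]. *)

Lemma in_setb {T : Type} (P : T -> bool) x : (x \in [set y | P y]) = P x.
Proof. by apply/idP/idP => /[!inE]. Qed.

Section triangle.
Context {R : realType}.
Local Notation mu := (@lebesgue_measure R).
Implicit Types (f g : R -> R).

(** By Tonelli the integral of |f(x) g(y)| is a product of two finite integrals, and the indicator
    can only decrease it. *)
Lemma integrable_prod f g (D : set (R * R)) :
  measurable D ->
  mu.-integrable setT (EFin \o f) -> mu.-integrable setT (EFin \o g) ->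
  (mu \x mu)%E.-integrable setT
    (fun z : R * R => (f z.1 * g z.2 * \1_D z)%:E).
Proof.
move=> mD /integrableP[/measurable_EFinP mf fi] /integrableP[/measurable_EFinP mg gi].
have mfg : measurable_fun setT (fun z : R * R => f z.1 * g z.2).
  apply: measurable_funM.
    exact: (measurableT_comp mf measurable_fst).
  exact: (measurableT_comp mg measurable_snd).
have fgi : (mu \x mu)%E.-integrable setT (fun z : R * R => (f z.1 * g z.2)%:E).
  apply/integrable12ltyP; first exact/measurable_EFinP.
  have -> : (\int[mu]_x \int[mu]_y `|(f (x, y).1 * g (x, y).2)%:E| =
      (\int[mu]_x `|(f x)%:E|) * (\int[mu]_y `|(g y)%:E|))%E.
    rewrite -ge0_integralZr//=; last 2 first.
    - exact/measurable_EFinP/measurableT_comp.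
    - exact: integral_ge0.
    apply: eq_integral => x _.
    rewrite -ge0_integralZl//=; last by exact/measurable_EFinP/measurableT_comp.
    by apply: eq_integral => y _; rewrite normrM EFinM.
  by rewrite lte_mul_pinfty// ?ge0_fin_numE//; apply: integral_ge0.
apply: le_integrable fgi => //.
  apply/measurable_EFinP; apply: measurable_funM => //.
move=> z _ /=; rewrite lee_fin normrM ler_piMr// indicE.
by case: (_ \in _); rewrite ?normr1 ?normr0.
Qed.

Lemma measurable_set_ler : measurable [set z : measurableTypeR R * measurableTypeR R | z.1 <= z.2].
Proof.
rewrite -[X in measurable X]setTI.
have := measurable_fun_ler (@measurable_fst _ _ (measurableTypeR R) (measurableTypeR R))
  (@measurable_snd _ _ (measurableTypeR R) (measurableTypeR R)).
by move=> /(_ measurableT [set true]); apply.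
Qed.

Lemma measurable_set_ger : measurable [set z : measurableTypeR R * measurableTypeR R | z.2 <= z.1].
Proof.
rewrite -[X in measurable X]setTI.
have := measurable_fun_ler (@measurable_snd _ _ (measurableTypeR R) (measurableTypeR R))
  (@measurable_fst _ _ (measurableTypeR R) (measurableTypeR R)).
by move=> /(_ measurableT [set true]); apply.
Qed.

(** Both sides are iterated integrals of [f r * g s] over the half-plane r <= s. Unbounded intervals
    keep a final time out of the statement; it enters later through functions extended by zero. *)
Lemma Fubini_triangle f g :
  mu.-integrable setT (EFin \o f) -> mu.-integrable setT (EFin \o g) ->
  [/\ mu.-integrable setT (fun s => (g s * \int[mu]_(r in `]-oo, s]) f r)%:E),
      mu.-integrable setT (fun r => (f r * \int[mu]_(s in `[r, +oo[) g s)%:E) &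
  \int[mu]_s (g s * \int[mu]_(r in `]-oo, s]) f r) =
  \int[mu]_r (f r * \int[mu]_(s in `[r, +oo[) g s)].
Proof.
move=> fi gi.
have hi' := integrable_prod measurable_set_ger gi fi.
have hi := integrable_prod measurable_set_ler fi gi.
set h := fun z : R * R => _ in hi.
have Ef s : (\int[mu]_r h (r, s) = (g s * \int[mu]_(r in `]-oo, s]) f r)%:E)%E.
  have fis : mu.-integrable `]-oo, s] (EFin \o f) by exact: integrableS fi.
  rewrite EFinM /Rintegral fineK; last exact: integrable_fin_num.
  rewrite -integralZl//= [RHS]integral_mkcond; apply: eq_integral => r _ /=.
  rewrite /h /patch indicE !in_setb/= in_itv/= -EFinM.
  by case: ifPn => _; rewrite ?mulr1 ?mulr0// mulrC.
have Eg r : (\int[mu]_s h (r, s) = (f r * \int[mu]_(s in `[r, +oo[) g s)%:E)%E.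
  have gis : mu.-integrable `[r, +oo[ (EFin \o g) by exact: integrableS gi.
  rewrite EFinM /Rintegral fineK; last exact: integrable_fin_num.
  rewrite -integralZl//= [RHS]integral_mkcond; apply: eq_integral => s _ /=.
  rewrite /h /patch indicE !in_setb/= in_itv/= andbT -EFinM.
  by case: ifPn => _; rewrite ?mulr1 ?mulr0.
split.
- have := integrable_fubini_F hi'.
  apply: eq_integrable => // s _; rewrite -Ef; apply: eq_integral => r _.
  by rewrite /h/= !indicE !in_setb/= [g s * _]mulrC.
- have := integrable_fubini_F hi.
  by apply: eq_integrable => // r _; rewrite -Eg.
- congr fine; transitivity (\int[mu]_s \int[mu]_r h (r, s))%E.
    by apply: eq_integral => s _; rewrite -Ef.
  rewrite -(Fubini hi); apply: eq_integral => r _; exact: Eg.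
Qed.

Lemma Rintegral_itvS (f : R -> R) (s t : R) : 0 <= s <= t ->
  mu.-integrable `[0, t] (EFin \o f) ->
  \int[mu]_(r in `[0, t]) f r =
  \int[mu]_(r in `[0, s]) f r + \int[mu]_(r in `]s, t]) f r.
Proof.
move=> /andP[s0 st] fi.
by rewrite -(Rintegral_itvB fi)// ?bnd_simp// addrC subrK.
Qed.

(** Integration by parts for primitives of merely integrable functions: the square [[0, t]] x
    [[0, t]] is split along its diagonal. The two integrability claims come out of Fubini at the
    same time. *)
Lemma Rintegral_mul (p q : R -> R) (t : R) :
  mu.-integrable `[0, t] (EFin \o p) -> mu.-integrable `[0, t] (EFin \o q) ->
  let P s := \int[mu]_(r in `[0, s]) p r in
  let Q s := \int[mu]_(r in `[0, s]) q r in
  [/\ mu.-integrable `[0, t] (fun s => (p s * Q s)%:E),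
      mu.-integrable `[0, t] (fun s => (P s * q s)%:E) &
  P t * Q t = \int[mu]_(s in `[0, t]) (p s * Q s + P s * q s)].
Proof.
move=> pi qi P Q.
pose f := p \_ `[0, t]; pose g := q \_ `[0, t].
have mf : measurable (`[0, t]%classic : set (measurableTypeR R)) by [].
have fi : mu.-integrable setT (EFin \o f).
  by rewrite /f -restrict_EFin; apply/(integrable_mkcond _ mf).
have gi : mu.-integrable setT (EFin \o g).
  by rewrite /g -restrict_EFin; apply/(integrable_mkcond _ mf).
have [i1 _ _] := Fubini_triangle fi gi.
have [j1 _ _] := Fubini_triangle gi fi.
have Pf s : s \in `[0, t] -> P s = \int[mu]_(r in `]-oo, s]) f r.
  move=> /itvP st; rewrite /P [RHS]Rintegral_mkcond [LHS]Rintegral_mkcond.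
  apply: eq_Rintegral => r _; rewrite /f /patch !in_setb/= !in_itv/=.
  have [rs|] := leP r s; rewrite ?andbF//.
  by rewrite (le_trans rs) ?st// andbT.
have Qg s : s \in `[0, t] -> Q s = \int[mu]_(r in `]-oo, s]) g r.
  move=> /itvP st; rewrite /Q [RHS]Rintegral_mkcond [LHS]Rintegral_mkcond.
  apply: eq_Rintegral => r _; rewrite /g /patch !in_setb/= !in_itv/=.
  have [rs|] := leP r s; rewrite ?andbF//.
  by rewrite (le_trans rs) ?st// andbT.
have ip : mu.-integrable `[0, t] (fun s => (p s * Q s)%:E).
  have : mu.-integrable `[0, t] (fun s => (f s * \int[mu]_(r in `]-oo, s]) g r)%:E).
    exact: integrableS j1.
  apply: eq_integrable => // s; rewrite inE/= => st.
  by rewrite Qg// /f /patch in_setb st.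
have iq : mu.-integrable `[0, t] (fun s => (P s * q s)%:E).
  have : mu.-integrable `[0, t] (fun s => (g s * \int[mu]_(r in `]-oo, s]) f r)%:E).
    exact: integrableS i1.
  apply: eq_integrable => // s; rewrite inE/= => st.
  by rewrite Pf// /g /patch in_setb st mulrC.
split => //.
have [t0|t0] := ltP t 0.
  by rewrite /P /Q set_itv_ge ?Rintegral_set0 ?mul0r// -leNgt bnd_simp.
have tt : t \in `[0, t] by rewrite in_itv/= t0 lexx.
rewrite RintegralD//.
have -> : \int[mu]_(s in `[0, t]) (P s * q s) =
    \int[mu]_s (g s * \int[mu]_(r in `]-oo, s]) f r).
  rewrite Rintegral_mkcond; apply: eq_Rintegral => s _.
  rewrite /g /patch !in_setb; case: ifPn => st; last by rewrite mul0r.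
  by rewrite Pf// mulrC.
have -> : \int[mu]_(s in `[0, t]) (p s * Q s) =
    \int[mu]_s (f s * \int[mu]_(r in `]-oo, s]) g r).
  rewrite Rintegral_mkcond; apply: eq_Rintegral => s _.
  rewrite /f /patch !in_setb; case: ifPn => st; last by rewrite mul0r.
  by rewrite Qg.
have [_ i2 ->] := Fubini_triangle fi gi; rewrite -RintegralD//.
have gT : Q t = \int[mu]_r g r by rewrite /g -Rintegral_mkcond.
have fT : P t = \int[mu]_r f r by rewrite /f -Rintegral_mkcond.
rewrite fT -RintegralZr//; apply: eq_Rintegral => s _.
rewrite -mulrDr; congr (_ * _); rewrite gT.
(* The two half-lines overlap in the point [s], which is null: the complement of the left one is
   open and is closed up. *)
rewrite -(setUv `]-oo, s]%classic) Rintegral_setU//=.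
- congr (_ + _); rewrite setCitvl.
  rewrite Rintegral_itv_obnd_cbnd//.
  exact: integrableS gi.
- exact: measurableC.
- by rewrite setUv.
- exact/disj_setPCl.
Qed.

End triangle.

Section Rintegral_sum.
Context d (X : measurableType d) (R : realType) (nu : {measure set X -> \bar R}).

Lemma integrableDR (D : set X) (f g : X -> R) : measurable D ->
  nu.-integrable D (fun x => (f x)%:E) -> nu.-integrable D (fun x => (g x)%:E) ->
  nu.-integrable D (fun x => (f x + g x)%:E).
Proof. by move=> mD fi gi; exact: (integrableD mD fi gi). Qed.

Lemma integrableBR (D : set X) (f g : X -> R) : measurable D ->
  nu.-integrable D (fun x => (f x)%:E) -> nu.-integrable D (fun x => (g x)%:E) ->
  nu.-integrable D (fun x => (f x - g x)%:E).
Proof. by move=> mD fi gi; exact: (integrableB mD fi gi). Qed.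

Lemma integrableZR (D : set X) (c : R) (f : X -> R) : measurable D ->
  nu.-integrable D (fun x => (f x)%:E) -> nu.-integrable D (fun x => (c * f x)%:E).
Proof. by move=> mD fi; exact: (integrableZl mD c fi). Qed.

Lemma integrable_sumR (I : Type) (s : seq I) (D : set X) (F : I -> X -> R) :
  measurable D -> (forall i, nu.-integrable D (EFin \o F i)) ->
  nu.-integrable D (fun x => (\sum_(i <- s) F i x)%:E).
Proof.
move=> mD iF; under eq_fun do rewrite -sumEFin.
apply: integrable_sum => // i _; exact: iF.
Qed.

Lemma Rintegral_sum (I : Type) (s : seq I) (D : set X) (F : I -> X -> R) :
  measurable D -> (forall i, nu.-integrable D (EFin \o F i)) ->
  \int[nu]_(x in D) (\sum_(i <- s) F i x) = \sum_(i <- s) \int[nu]_(x in D) F i x.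
Proof.
move=> mD iF; elim: s => [|i s IH].
  by rewrite big_nil; under eq_Rintegral do rewrite big_nil; rewrite Rintegral_cst// mul0r.
rewrite big_cons -IH -RintegralD//; last exact: integrable_sumR.
by apply: eq_Rintegral => x _; rewrite big_cons.
Qed.

End Rintegral_sum.

Definition mx_integrable {R : realType} n m (D : set R) (F : R -> 'M[R]_(n, m)) : Prop :=
  forall i j, (@lebesgue_measure R).-integrable D (fun s => (F s i j)%:E).

Section product_rule.
Context {R : realType}.
Local Notation mu := (@lebesgue_measure R).
Local Notation itv t := (`[0, t]%classic : set (measurableTypeR R)).

Lemma integrable_itvS (f : R -> R) (s t : R) : s <= t ->
  mu.-integrable (itv t) (EFin \o f) -> mu.-integrable (itv s) (EFin \o f).
Proof.
move=> st; apply: integrableS => //.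
by apply: subset_itvl; rewrite bnd_simp.
Qed.

Lemma mx_integrableS n m (F : R -> 'M[R]_(n, m)) (s t : R) : s <= t ->
  mx_integrable `[0, t] F -> mx_integrable `[0, s] F.
Proof. by move=> st iF i j; apply: integrable_itvS st (iF i j). Qed.

Lemma eq_mx_integrable n m (D : set R) (F G : R -> 'M[R]_(n, m)) :
  measurable (D : set (measurableTypeR R)) ->
  {in D, F =1 G} -> mx_integrable D F -> mx_integrable D G.
Proof.
move=> mD FG iF i j; apply: eq_integrable (iF i j) => // s sD.
by rewrite FG.
Qed.

Lemma eq_mx_integral n m (D : set R) (F G : R -> 'M[R]_(n, m)) :
  {in D, F =1 G} -> mx_integral D F = mx_integral D G.
Proof.
move=> FG; apply/matrixP => i j; rewrite !mxE.
by apply: eq_Rintegral => s sD; rewrite FG.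
Qed.

Lemma mx_integrableD n m (D : set R) (F G : R -> 'M[R]_(n, m)) :
  measurable (D : set (measurableTypeR R)) ->
  mx_integrable D F -> mx_integrable D G -> mx_integrable D (fun s => F s + G s).
Proof.
move=> mD iF iG i j.
apply: eq_integrable (integrableD mD (iF i j) (iG i j)) => // s _.
by rewrite mxE EFinD.
Qed.

Lemma mx_integralD n m (D : set R) (F G : R -> 'M[R]_(n, m)) :
  measurable (D : set (measurableTypeR R)) ->
  mx_integrable D F -> mx_integrable D G ->
  mx_integral D (fun s => F s + G s) = mx_integral D F + mx_integral D G.
Proof.
move=> mD iF iG; apply/matrixP => i j; rewrite !mxE -RintegralD//; [|exact: iF|exact: iG].
by apply: eq_Rintegral => s _; rewrite mxE.
Qed.

Lemma mx_integrableMl n m p (D : set R) (M : 'M[R]_(p, n)) (F : R -> 'M[R]_(n, m)) :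
  measurable (D : set (measurableTypeR R)) ->
  mx_integrable D F -> mx_integrable D (fun s => M *m F s).
Proof.
move=> mD iF i j; under eq_fun do rewrite mxE.
apply: integrable_sumR => // k.
exact: (integrableZl mD (M i k) (iF k j)).
Qed.

Lemma mx_integralMl n m p (D : set R) (M : 'M[R]_(p, n)) (F : R -> 'M[R]_(n, m)) :
  measurable (D : set (measurableTypeR R)) ->
  mx_integrable D F -> mx_integral D (fun s => M *m F s) = M *m mx_integral D F.
Proof.
move=> mD iF; apply/matrixP => i j; rewrite !mxE.
under eq_Rintegral do rewrite mxE.
rewrite Rintegral_sum//; last first.
  by move=> k; exact: (integrableZl mD (M i k) (iF k j)).
by apply: eq_bigr => k _; rewrite mxE RintegralZl//; exact: iF.
Qed.

Lemma mx_integrableN n m (D : set R) (F : R -> 'M[R]_(n, m)) :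
  measurable (D : set (measurableTypeR R)) ->
  mx_integrable D F -> mx_integrable D (fun s => - F s).
Proof.
move=> mD iF i j; apply: eq_integrable (integrableN (iF i j)) => // s _.
by rewrite mxE.
Qed.

Lemma mx_integralN n m (D : set R) (F : R -> 'M[R]_(n, m)) :
  measurable (D : set (measurableTypeR R)) ->
  mx_integrable D F -> mx_integral D (fun s => - F s) = - mx_integral D F.
Proof.
move=> mD iF; apply/matrixP => i j; rewrite !mxE.
under eq_Rintegral do rewrite mxE -mulN1r.
by rewrite RintegralZl ?mulN1r//; exact: iF.
Qed.

Lemma mx_integral_itvS n m (F : R -> 'M[R]_(n, m)) (s t : R) : 0 <= s <= t ->
  mx_integrable `[0, t] F ->
  mx_integral `[0, t] F = mx_integral `[0, s] F + mx_integral `]s, t] F.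
Proof.
move=> st iF; apply/matrixP => i j; rewrite !mxE.
exact: (Rintegral_itvS st (iF i j)).
Qed.

Lemma mx_integral0 n m (F : R -> 'M[R]_(n, m)) : mx_integral `[0, 0] F = 0.
Proof. by apply/matrixP => i j; rewrite !mxE set_itv1 Rintegral_set1. Qed.

(** Absolute continuity of [p] with derivative [p'], in integrated form: with measurable
    coefficients, this is the sense in which differential equations hold here. *)
Definition primitive_of n m (T : R) (p p' : R -> 'M[R]_(n, m)) : Prop :=
  mx_integrable `[0, T] p' /\
  forall t, 0 <= t <= T -> p t = p 0 + mx_integral `[0, t] p'.

(** Integration by parts treats primitives that vanish at 0, entry by entry; the initial values are
    put back by expanding [(p 0 + P s) *m (q 0 + Q s)]. *)
Lemma primitive_of_mul n m l (T : R) (p p' : R -> 'M[R]_(n, m))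
    (q q' : R -> 'M[R]_(m, l)) :
  primitive_of T p p' -> primitive_of T q q' ->
  primitive_of T (fun s => p s *m q s) (fun s => p' s *m q s + p s *m q' s).
Proof.
move=> [ip pE] [iq qE].
pose P s := mx_integral `[0, s] p'; pose Q s := mx_integral `[0, s] q'.
have mT : measurable (itv T) by [].
have key t : t <= T -> mx_integrable `[0, t] (fun s => p' s *m Q s) /\
   mx_integrable `[0, t] (fun s => P s *m q' s) /\
   P t *m Q t = mx_integral `[0, t] (fun s => p' s *m Q s) +
                mx_integral `[0, t] (fun s => P s *m q' s).
  move=> tT.
  have H i j k := Rintegral_mul (integrable_itvS tT (ip i j)) (integrable_itvS tT (iq j k)).
  have i1 : mx_integrable `[0, t] (fun s => p' s *m Q s).
    move=> i k; rewrite (_ : (fun s => _) = (fun s => (\sum_j (p' s i j * Q s j k))%:E)); last by apply/funext => s; rewrite mxE.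
    apply: integrable_sumR => // j; have [+ _ _] := H i j k.
    by apply: eq_integrable => // s _; rewrite /= /Q mxE.
  have i2 : mx_integrable `[0, t] (fun s => P s *m q' s).
    move=> i k; rewrite (_ : (fun s => _) = (fun s => (\sum_j (P s i j * q' s j k))%:E)); last by apply/funext => s; rewrite mxE.
    apply: integrable_sumR => // j; have [_ + _] := H i j k.
    by apply: eq_integrable => // s _; rewrite /= /P mxE.
  split => //; split => //.
  rewrite -mx_integralD//; apply/matrixP => i k; rewrite !mxE.
  under eq_Rintegral do rewrite !mxE -big_split/=.
  rewrite Rintegral_sum//; last first.
    move=> j; have [h1 h2 _] := H i j k.
    apply: eq_integrable (integrableD _ h1 h2) => // s _.
    by rewrite /P /Q /= !mxE EFinD.
  apply: eq_bigr => j _; have [_ _] := H i j k.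
  rewrite /P /Q !mxE => ->; apply: eq_Rintegral => s _.
  by rewrite !mxE.
have [j1 [j2 _]] := key T (lexx _).
have i3 : mx_integrable `[0, T] (fun s => p' s *m q 0).
  move=> i k.
  rewrite (_ : (fun s => _) = (fun s => (\sum_j (p' s i j * q 0 j k))%:E)); last by apply/funext => s; rewrite mxE.
  apply: integrable_sumR => // j.
  apply: eq_integrable (integrableZl mT (q 0 j k) (ip i j)) => // s _.
  by rewrite /= mulrC EFinM.
have i4 := mx_integrableMl (p 0) mT iq.
have E s : s \in `[0, T]%classic ->
    (p' s *m Q s + P s *m q' s) + (p' s *m q 0 + p 0 *m q' s) =
    p' s *m q s + p s *m q' s.
  rewrite inE/= in_itv/= => sT; rewrite (qE s sT) (pE s sT) -/(P s) -/(Q s) mulmxDr mulmxDl.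
  by rewrite addrACA [_ *m Q s + _]addrC [P s *m _ + _]addrC.
have iE : mx_integrable `[0, T] (fun s => p' s *m q s + p s *m q' s).
  by apply: eq_mx_integrable E _ => //; apply: mx_integrableD => //; apply: mx_integrableD.
split => // t /andP[t0 tT].
have tT' : 0 <= t <= T by rewrite t0.
have mt : measurable (itv t) by [].
rewrite (pE t tT') (qE t tT') -/(P t) -/(Q t) mulmxDl !mulmxDr.
have [_ [_ ->]] := key t tT.
rewrite -(@eq_mx_integral _ _ _ (fun s => (p' s *m Q s + P s *m q' s) + (p' s *m q 0 + p 0 *m q' s)) (fun s => p' s *m q s + p s *m q' s)); last first.
  move=> s; rewrite inE/= in_itv/= => /andP[s0 st]; apply: E.
  by rewrite inE/= in_itv/= s0 (le_trans st).
have jS n1 n2 (F : R -> 'M[R]_(n1, n2)) := mx_integrableS (F := F) tT.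
rewrite (mx_integralD mt (jS _ _ _ (mx_integrableD mT j1 j2)) (jS _ _ _ (mx_integrableD mT i3 i4))).
rewrite (mx_integralD mt (jS _ _ _ j1) (jS _ _ _ j2)) (mx_integralD mt (jS _ _ _ i3) (jS _ _ _ i4)).
rewrite (mx_integralMl _ mt (jS _ _ _ iq)).
have -> : mx_integral `[0, t] (fun s => p' s *m q 0) = P t *m q 0.
  apply/matrixP => i k; rewrite !mxE.
  under eq_Rintegral do rewrite mxE.
  rewrite Rintegral_sum//; last first.
    move=> j; apply: eq_integrable (integrableZl mt (q 0 j k) (integrable_itvS tT (ip i j))) => // s _.
    by rewrite /= mulrC EFinM.
  apply: eq_bigr => j _; rewrite mxE RintegralZr//.
  exact: integrable_itvS tT (ip i j).
rewrite -/(Q t) -!addrA; congr (_ + _).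
by rewrite [LHS]addrCA [LHS]addrA [RHS]addrA [RHS]addrC.
Qed.

End product_rule.

(** * Linear differential equations with a measurable parameter *)

(** Tonelli's measurability, applied to the positive and the negative part. Parameters with a
    non-integrable section are covered as well, because [fine] is measurable on all extended
    reals. *)
Lemma measurable_Rintegral_param {d : measure_display} {Y : measurableType d}
    {d' : measure_display} {X : measurableType d'} {R : realType}
    (nu : {sigma_finite_measure set X -> \bar R}) (G : Y * X -> R) :
  measurable_fun setT G ->
  measurable_fun setT (fun y => \int[nu]_x G (y, x)).
Proof.
move=> mG; apply: measurableT_comp; first exact: fine_measurable.
have mG' : measurable_fun setT (EFin \o G) by exact/measurable_EFinP.
have mp := measurable_fun_fubini_tonelli_F (m2 := nu) (EFin \o G)^\+%E (measurable_funepos mG') (funepos_ge0 _).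
have mn := measurable_fun_fubini_tonelli_F (m2 := nu) (EFin \o G)^\-%E (measurable_funeneg mG') (funeneg_ge0 _).
rewrite (_ : (fun y => _) = (fubini_F nu (EFin \o G)^\+%E \- fubini_F nu (EFin \o G)^\-%E)%E).
  exact: emeasurable_funB.
apply/funext => y; rewrite integralE /fubini_F.
have -> : (fun x => (G (y, x))%:E) = (EFin \o G) \o pair y by [].
by rewrite funepos_comp funeneg_comp.
Qed.

Section parametric_measurability.
Context {d : measure_display} {Y : measurableType d} {R : realType}.
Local Notation mu := (@lebesgue_measure R).
Local Notation RT := (measurableTypeR R).

(** The variable end point becomes part of the parameter: [F] is multiplied by the indicator of a
    measurable set and integrated over the whole line. *)
Lemma measurable_Rintegral_itv (F : RT * Y -> R) :
  measurable_fun setT F ->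
  measurable_fun setT (fun z : RT * Y => \int[mu]_(s in `[0, z.1]) F (s, z.2)).
Proof.
move=> mF.
pose D : set ((RT * Y) * RT) := [set z | (0 <= z.2) && (z.2 <= z.1.1)].
have mD : measurable D.
  rewrite -[X in measurable X]setTI.
  have m1 : measurable_fun setT (fun z : (RT * Y) * RT => 0 <= z.2).
    by apply: measurable_fun_ler => //; exact: measurable_snd.
  have m2 : measurable_fun setT (fun z : (RT * Y) * RT => z.2 <= z.1.1).
    apply: measurable_fun_ler; first exact: measurable_snd.
    exact: (measurableT_comp measurable_fst measurable_fst).
  by apply: (measurable_and m1 m2 measurableT (Y := [set true])).
pose G (z : (RT * Y) * RT) := F (z.2, z.1.2) * \1_D z.
rewrite [X in measurable_fun _ X](_ : _ = (fun y => \int[mu]_s G (y, s))).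
  apply: measurable_Rintegral_param; apply: measurable_funM; last exact: measurable_indic.
  have mg : measurable_fun setT (fun z : (RT * Y) * RT => (z.2, z.1.2)).
    apply: measurable_fun_pair; first exact: measurable_snd.
    exact: (measurableT_comp measurable_snd measurable_fst).
  exact: (measurableT_comp mF mg).
apply/funext => z; rewrite [LHS]Rintegral_mkcond; apply: eq_Rintegral => s _ /=.
rewrite /patch /G indicE !in_setb/= in_itv/=.
by case: ifPn => _; rewrite ?mulr1 ?mulr0.
Qed.

End parametric_measurability.

Section exp_integral.
Context {R : realType}.
Local Notation mu := (@lebesgue_measure R).

Lemma continuous_expRM (c : R) : continuous (fun z : R => expR (c * z)).
Proof.
move=> z; apply: continuous_comp; last exact: continuous_expR.
by apply: continuousM => //; exact: cst_continuous.
Qed.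

Lemma continuous_cexpRM (c : R) : continuous (fun z : R => c * expR (c * z)).
Proof.
by move=> z; apply: cvgM; [exact: cvg_cst|exact: continuous_expRM].
Qed.

Lemma integrable_expRM (c t : R) :
  mu.-integrable `[0, t] (fun s => (c * expR (c * s))%:E).
Proof.
apply: continuous_compact_integrable; first exact: segment_compact.
by apply: continuous_subspaceT; exact: continuous_cexpRM.
Qed.

Lemma Rintegral_expRM (c t : R) : 0 <= t ->
  \int[mu]_(s in `[0, t]) (c * expR (c * s)) = expR (c * t) - 1.
Proof.
rewrite le_eqVlt => /predU1P[<-|t0].
  by rewrite set_itv1 Rintegral_set1 mulr0 expR0 subrr.
rewrite /Rintegral (@continuous_FTC2 _ _ (fun s => expR (c * s))) ?mulr0 ?expR0//.
- by apply: continuous_subspaceT; exact: continuous_cexpRM.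
- split.
  + by move=> z _; exact: ex_derive.
  + by apply/cvg_at_right_filter; exact: continuous_expRM.
  + by apply/cvg_at_left_filter; exact: continuous_expRM.
- move=> z _; rewrite derive1_comp// derive1E.
  have /funeqP -> := @derive_expR R.
  by rewrite derive1Ml// derive1_id mulr1 mulrC.
Qed.

End exp_integral.

Lemma cvg_sumr {R : realType} (I : Type) (s : seq I) (T : Type) (F : set_system T)
    (f : I -> T -> R) (l : I -> R) : Filter F ->
  (forall i, f i t @[t --> F] --> l i) ->
  (\sum_(i <- s) f i t) @[t --> F] --> \sum_(i <- s) l i.
Proof.
move=> FF fl; elim: s => [|i s IH].
  by under eq_fun do rewrite big_nil; rewrite big_nil; exact: cvg_cst.
by under eq_fun do rewrite big_cons; rewrite big_cons; exact: cvgD.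
Qed.

(** * Picard iteration for linear systems with measurable coefficients *)

Section picard.
Context {d : measure_display} {X : measurableType d} {R : realType}.
Local Notation mu := (@lebesgue_measure R).
Local Notation RT := (measurableTypeR R).

Definition jmeasurable n m (F : R -> X -> 'M[R]_(n, m)) : Prop :=
  forall i j, measurable_fun setT (fun z : RT * X => F z.1 z.2 i j).

Lemma jmeasurable_mulmx n m p (F : R -> X -> 'M[R]_(n, m)) (G : R -> X -> 'M[R]_(m, p)) :
  jmeasurable F -> jmeasurable G -> jmeasurable (fun s x => F s x *m G s x).
Proof.
move=> mF mG i k.
rewrite (_ : (fun z => _) = (fun z : RT * X => \sum_j F z.1 z.2 i j * G z.1 z.2 j k)).
  apply: measurable_sum => j.
  by apply: measurable_funM; [exact: mF|exact: mG].
by apply/funext => z; rewrite mxE.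
Qed.

Lemma jmeasurable_slice n m (F : R -> X -> 'M[R]_(n, m)) x i j (D : set RT) :
  jmeasurable F -> measurable_fun D (fun s => F s x i j).
Proof.
move=> mF; apply: measurable_funTS.
exact: (measurableT_comp (mF i j) (pair2_measurable x)).
Qed.
Arguments jmeasurable_slice {n m F} x i j D _.

Context {n : nat} (a : R -> X -> 'M[R]_n) (M : R).
Hypothesis ma : jmeasurable a.
Hypothesis aM : forall s x i j, `|a s x i j| <= M.

(** [n%:R * M] bounds the action of [a] for the largest-entry norm; the added 1 keeps [L] positive
    when this product is zero, as [2 * L] occurs as a divisor. *)
Let L : R := n%:R * M + 1.

Let M_ge0 (i j : 'I_n) : 0 <= M.
Proof. by apply: le_trans (aM 0 point i j). Qed.

Let n_ge0 : 0 <= n%:R * M.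
Proof.
case: (posnP n) => [n0|n0]; first by rewrite {1}n0 mul0r.
by rewrite mulr_ge0// (M_ge0 (Ordinal n0) (Ordinal n0)).
Qed.

Let L_gt0 : 0 < L.
Proof. by rewrite /L ltr_wpDl. Qed.

Fixpoint picard_term (j : nat) : R -> X -> 'M[R]_n :=
  if j is j'.+1 then
    fun t x => mx_integral `[0, t] (fun s => a s x *m picard_term j' s x)
  else fun _ _ => 1%:M.

Lemma jmeasurable_picard_term j : jmeasurable (picard_term j).
Proof.
elim: j => [|j IH] i k; first exact: measurable_cst.
rewrite /=; under eq_fun do rewrite mxE.
exact: (measurable_Rintegral_itv (jmeasurable_mulmx ma IH i k)).
Qed.

Let bnd (t : R) : R := expR (2 * L * `|t|).

Let integrable_bnd (c t : R) : mu.-integrable `[0, t] (fun s => (c * bnd s)%:E).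
Proof.
have mD : measurable (`[0, t]%classic : set RT) by [].
have := integrableZl mD (c / (2 * L)) (integrable_expRM (2 * L) t).
apply: eq_integrable => // s.
rewrite inE/= in_itv/= => /andP[s0 _].
rewrite /bnd ger0_norm// -EFinM; congr (_%:E).
by rewrite mulrA divfK// mulf_neq0// gt_eqF.
Qed.

Let integral_bnd (c t : R) : 0 <= t -> 0 <= c ->
  \int[mu]_(s in `[0, t]) (L * c * bnd s) <= c / 2 * bnd t.
Proof.
move=> t0 c0.
have -> : \int[mu]_(s in `[0, t]) (L * c * bnd s) =
    \int[mu]_(s in `[0, t]) (c / 2 * (2 * L * expR (2 * L * s))).
  apply: eq_Rintegral => s; rewrite inE/= in_itv/= => /andP[s0 _].
  by rewrite /bnd ger0_norm//; field.
rewrite RintegralZl//; last exact: integrable_expRM.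
rewrite Rintegral_expRM// /bnd ger0_norm// ler_wpM2l ?divr_ge0//.
by rewrite gerBl.
Qed.

Let mulmx_bound (P : 'M[R]_n) s x (c : R) i k : (forall i k, `|P i k| <= c) -> 0 <= c ->
  `|(a s x *m P) i k| <= L * c.
Proof.
move=> Pc c0; rewrite mxE (le_trans (ler_norm_sum _ _ _))//.
apply: (@le_trans _ _ (\sum_(j < n) M * c)).
  by apply: ler_sum => j _; rewrite normrM ler_pM.
by rewrite sumr_const card_ord -mulr_natl mulrA ler_wpM2r// /L lerDl.
Qed.

Let integrable_bounded (P : R -> X -> 'M[R]_n) (c t : R) x : jmeasurable P -> 0 <= c ->
  (forall s i k, `|P s x i k| <= c * bnd s) ->
  mx_integrable `[0, t] (fun s => a s x *m P s x).
Proof.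
move=> mP c0 Pc i k.
apply: le_integrable (integrable_bnd (L * c) t) => //.
  apply/measurable_EFinP. exact: (jmeasurable_slice x i k _ (jmeasurable_mulmx ma mP)).
move=> s _; rewrite /= lee_fin (le_trans (mulmx_bound _ _ _ _ (Pc s) _))//.
  by rewrite mulr_ge0// expR_ge0.
by rewrite mulrA ler_norm.
Qed.

(* The weight e^(2L|t|) makes the Picard map a contraction of ratio 1/2 on the
   whole line, hence bounds that are uniform in the parameter x. *)
Lemma picard_term_bound j t x i k : `|picard_term j t x i k| <= 2^-1 ^+ j * bnd t.
Proof.
elim: j t i k => [|j IH] t i k /=.
  rewrite mul1r mxE; apply: (@le_trans _ _ 1).
    by case: eqVneq => _; rewrite ?normr1 ?normr0.
  by rewrite /bnd -[leLHS]expR0 ler_expR mulr_ge0// mulr_ge0// ltW.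
rewrite mxE; have [t0|t0] := ltP t 0.
  rewrite set_itv_ge ?Rintegral_set0 ?normr0 ?mulr_ge0 ?exprn_ge0 ?expR_ge0//.
  by rewrite -leNgt bnd_simp.
have iP := integrable_bounded t (jmeasurable_picard_term j) (exprn_ge0 j _) IH.
apply: le_trans (le_normr_Rintegral _ (iP _ i k)) _ => //.
apply: (@le_trans _ _ (\int[mu]_(s in `[0, t]) (L * 2^-1 ^+ j * bnd s))).
  apply: le_Rintegral => //.
  - by apply: (integrable_norm (iP _ i k)); rewrite invr_ge0.
  - exact: integrable_bnd.
  - move=> s _; rewrite -mulrA; apply: mulmx_bound; first exact: IH.
    by rewrite mulr_ge0// ?exprn_ge0 ?invr_ge0// expR_ge0.
apply: le_trans (integral_bnd t0 _) _; first by rewrite exprn_ge0// invr_ge0.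
by rewrite exprSr.
Qed.

Let partial J t x : 'M[R]_n := \sum_(0 <= j < J) picard_term j t x.

Let partialE J t x i k : partial J t x i k = series (fun j => picard_term j t x i k) J.
Proof. by rewrite /partial summxE. Qed.

(** The majorants [2^-1 ^+ j * bnd t] form a geometric series of sum [2 * bnd t]. The same bound on
    every partial sum is what dominates when the limit is taken under the integral. *)
Let series_cvg t x i k :
  cvgn (series (fun j => picard_term j t x i k)) /\
  forall J, `|partial J t x i k| <= 2 * bnd t.
Proof.
have gE : (fun j => 2^-1 ^+ j * bnd t) = geometric (bnd t) 2^-1.
  by apply/funext => j; rewrite /geometric/= mulrC.
have h1 : `|2^-1| < 1 :> R by rewrite ger0_norm// invf_lt1// ltr1n.
split.
  apply: (@normed_cvg _ R^o); apply: series_le_cvg (fun j => normr_ge0 _) _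
     (fun j => picard_term_bound j t x i k) _.
  - by move=> j; rewrite mulr_ge0 ?exprn_ge0 ?invr_ge0// expR_ge0.
  - by rewrite gE; exact: is_cvg_geometric_series.
move=> J; rewrite partialE (le_trans (ler_norm_sum _ _ _))//.
apply: (@le_trans _ _ (series (geometric (bnd t) 2^-1) J)).
  by apply: ler_sum => j _; rewrite -gE; exact: picard_term_bound.
rewrite geometric_seriesE ?lt_eqF 1?ltr_normlW// [leRHS]mulrC.
have -> : 1 - 2^-1 = 2^-1 :> R by field.
rewrite invrK ler_wpM2r// ler_piMr ?expR_ge0// gerBl exprn_ge0// invr_ge0//.
Qed.

(** The solution is the sum of the Picard terms: each term is the integral of [a] times the previous
    one, so a shift of the index turns the partial sums into the integral equation, and dominated
    convergence passes to the limit. For [t < 0] the interval is empty and [Psi] is the identity,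
    which is why every real [t] is allowed. *)
Lemma linear_ode_solution : exists Psi : R -> X -> 'M[R]_n,
  [/\ jmeasurable Psi,
      forall t x i k, `|Psi t x i k| <= 2 * expR (2 * L * `|t|),
      forall t x, mx_integrable `[0, t] (fun s => a s x *m Psi s x) &
      forall t x, Psi t x = 1%:M + mx_integral `[0, t] (fun s => a s x *m Psi s x)].
Proof.
pose Psi t x : 'M[R]_n := \matrix_(i, k) limn (series (fun j => picard_term j t x i k)).
have PsiC t x i k : partial J t x i k @[J --> \oo] --> Psi t x i k.
  rewrite mxE; under eq_fun do rewrite partialE.
  by have [] := series_cvg t x i k.
have mpart J : jmeasurable (partial J).
  move=> i k; under eq_fun do rewrite partialE.
  by apply: measurable_sum => j; exact: jmeasurable_picard_term.
have mPsi : jmeasurable Psi.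
  move=> i k; apply: (measurable_fun_cvg (h := fun J z => partial J z.1 z.2 i k)).
    by move=> J; exact: mpart.
  by move=> z _; exact: PsiC.
have PsiB t x i k : `|Psi t x i k| <= 2 * bnd t.
  rewrite -(cvg_lim _ (cvg_norm (PsiC t x i k)))//.
  apply: limr_le; first by apply/cvg_ex; eexists; exact: (cvg_norm (PsiC t x i k)).
  by apply: nearW => J; have [_] := series_cvg t x i k.
have iPsi t x : mx_integrable `[0, t] (fun s => a s x *m Psi s x).
  by apply: (integrable_bounded _ mPsi _ (fun s => PsiB s x)).
exists Psi; split => // t x; apply/matrixP => i k.
apply: (cvg_unique _ (F := (fun J => partial J.+1 t x i k) @ \oo)) => //.
  by have := PsiC t x i k; rewrite -(cvg_shiftS (fun J => partial J t x i k)).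
have -> : (fun J => partial J.+1 t x i k) =
    (fun J => (1%:M : 'M[R]_n) i k + \int[mu]_(s in `[0, t]) (a s x *m partial J s x) i k).
  apply/funext => J; rewrite /partial big_nat_recl// mxE; congr (_ + _).
  rewrite summxE; under eq_bigr do rewrite mxE.
  rewrite -Rintegral_sum//; last first.
    move=> j; apply: (integrable_bounded _ (jmeasurable_picard_term j) _ (fun s => picard_term_bound j s x)).
    by rewrite exprn_ge0 ?invr_ge0.
  by apply: eq_Rintegral => s _; rewrite mulmx_sumr summxE.
have -> : (1%:M + mx_integral `[0, t] (fun s => a s x *m Psi s x)) i k = (1%:M : 'M[R]_n) i k + \int[mu]_(s in `[0, t]) (a s x *m Psi s x) i k by rewrite !mxE.
apply: cvgD; first exact: cvg_cst.
apply: fine_cvg; rewrite /Rintegral fineK; last first.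
  by apply: integrable_fin_num => //; exact: iPsi.
apply: (@dominated_cvg _ _ _ mu _ _ (fun J s => ((a s x *m partial J s x) i k)%:E) _ (fun s => (L * 2 * bnd s)%:E)) => //.
- move=> J; apply/measurable_EFinP.
  exact: (jmeasurable_slice x i k _ (jmeasurable_mulmx ma (mpart J))).
- move=> s _; apply: cvg_EFin; first exact: nearW.
  rewrite mxE; under eq_fun do rewrite mxE.
  apply: cvg_sumr => j; apply: cvgM; first exact: cvg_cst.
  exact: PsiC.
- move=> J s _; rewrite lee_fin -mulrA; apply: mulmx_bound.
  by move=> i' k'; have [_] := series_cvg s x i' k'.
  by rewrite mulr_ge0// expR_ge0.
Qed.

End picard.
Arguments jmeasurable_slice {d X R n m F} x i j D _.

(** * The mean of the Ito integral and of a solution *)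

Section density.
Local Open Scope ereal_scope.
Context d (T : measurableType d) (R : realType).
Variables (nu mu : {measure set T -> \bar R}) (p : T -> R).
Hypotheses (mp : measurable_fun setT p) (p0 : forall x, (0 <= p x)%R).
Hypothesis nuE : forall A, measurable A -> nu A = \int[mu]_(x in A) (p x)%:E.

Import HBNNSimple.

Let mEp : measurable_fun setT (EFin \o p).
Proof. exact/measurable_EFinP. Qed.

Let integral_density_nnsfun (f : {nnsfun T >-> R}) :
  \int[nu]_x (f x)%:E = \int[mu]_x ((f x)%:E * (p x)%:E).
Proof.
under [LHS]eq_integral do rewrite fimfunE -fsumEFin//.
rewrite [LHS]ge0_integral_fsum//; last 2 first.
  - by move=> r; exact/measurable_EFinP/measurableT_comp.
  - by move=> n x _; rewrite EFinM nnfun_muleindic_ge0.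
under [RHS]eq_integral.
  move=> x xD; rewrite fimfunE -fsumEFin// ge0_mule_fsuml; last first.
    by move=> r; rewrite EFinM nnfun_muleindic_ge0.
  over.
rewrite [RHS]ge0_integral_fsum//; last 2 first.
  - move=> r; apply: emeasurable_funM => //.
    exact/measurable_EFinP/measurableT_comp.
  - move=> n x _; apply: mule_ge0; last by rewrite lee_fin.
    by rewrite EFinM nnfun_muleindic_ge0.
apply: eq_fsbigr => r _.
rewrite integralZl_indic_nnsfun// integral_indic// setIT nuE//.
have [r0|r0] := ltP r 0%R.
  rewrite preimage_nnfun0// integral_set0 mule0 integral0_eq// => x _.
  by rewrite indic0 mulr0 mul0e.
under [RHS]eq_integral do rewrite EFinM -muleA.
rewrite ge0_integralZl//; last 2 first.
- by apply: emeasurable_funM => //; apply/measurable_EFinP.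
- by move=> x _; rewrite mule_ge0// lee_fin.
congr (_ * _); rewrite [LHS]integral_mkcond; apply: eq_integral => x _.
by rewrite patchE indicE; case: ifPn => _; rewrite ?mul1e ?mul0e.
Qed.

(** [nuE] is the case of indicators; linearity gives simple functions, and monotone convergence
    under both measures gives [f]. *)
Lemma ge0_integral_density (f : T -> \bar R) :
  measurable_fun setT f -> (forall x, 0 <= f x) ->
  \int[nu]_x f x = \int[mu]_x (f x * (p x)%:E).
Proof.
move=> mf f0; pose f_ := nnsfun_approx measurableT mf.
transitivity (limn (fun n => \int[nu]_x (f_ n x)%:E)).
  rewrite -monotone_convergence//=.
  - apply: eq_integral => x _; apply/esym/cvg_lim => //=.
    exact: cvg_nnsfun_approx.
  - by move=> n; exact/measurable_EFinP/measurable_funTS.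
  - by move=> n x _; rewrite lee_fin.
  - by move=> x _ m n mn; rewrite lee_fin; exact/lefP/nd_nnsfun_approx.
under eq_fun do rewrite integral_density_nnsfun.
rewrite -monotone_convergence//=.
- apply: eq_integral => x _; apply/cvg_lim => //=.
  by apply: cvgeZr => //; exact: cvg_nnsfun_approx.
- by move=> n; apply: emeasurable_funM => //; exact/measurable_EFinP/measurable_funTS.
- by move=> n x _; rewrite mule_ge0// lee_fin.
- move=> x _ m n mn; apply: lee_wpmul2r; first by rewrite lee_fin.
  by rewrite lee_fin; exact/lefP/nd_nnsfun_approx.
Qed.

End density.

Section normal.
Context {R : realType}.
Local Notation mu := (@lebesgue_measure R).
Variable s : R.
Hypothesis s0 : 0 < s.

Let normal_pdf_sym x : normal_pdf 0 s (- x) = normal_pdf 0 s x.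
Proof. by rewrite !normal_pdfE ?gt_eqF// /normal_fun !subr0 sqrrN. Qed.

(** A comparison with the normal density of twice the deviation, which will make the identity
    integrable. With u = x^2 / (8 s^2) the exponents are -4u and -u, and |x| exp(-3u) <= s follows
    from exp(3u) >= 1 + 3u and 8 s |x| <= 8 s^2 + 3 x^2. *)
Let normal_pdf_tail x :
  `|x| * normal_pdf 0 s x <=
  s * (normal_peak s / normal_peak (s * 2)) * normal_pdf 0 (s * 2) x.
Proof.
have s2 : s * 2 != 0 by rewrite mulf_neq0// gt_eqF.
have s0' : s != 0 by rewrite gt_eqF.
have pk := normal_peak_gt0 s2.
rewrite !normal_pdfE//= /normal_fun !subr0.
set u := x ^+ 2 / (8 * s ^+ 2).
have -> : - x ^+ 2 / (s ^+ 2 *+ 2) = - (4 * u) by rewrite /u; field.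
have -> : - x ^+ 2 / ((s * 2) ^+ 2 *+ 2) = - u by rewrite /u; field.
rewrite [leRHS](_ : _ = normal_peak s * (s * expR (- u))); last first.
  by field; rewrite gt_eqF.
rewrite mulrCA ler_wpM2l ?normal_peak_ge0//.
have -> : - (4 * u) = - u - 3 * u by ring.
rewrite expRD mulrCA mulrC ler_wpM2r ?expR_ge0//.
rewrite expRN ler_pdivrMr ?expR_gt0//.
apply: (@le_trans _ _ (s * (1 + 3 * u))); last first.
  by apply: ler_wpM2l; [exact: ltW|exact: expR_ge1Dx].
rewrite -(@ler_pM2r _ (8 * s)) ?mulr_gt0//.
have -> : s * (1 + 3 * u) * (8 * s) = 8 * s ^+ 2 + 3 * `|x| ^+ 2.
  by rewrite /u real_normK ?num_real//; field.
have := sqr_ge0 (2 * s - `|x|); have := sqr_ge0 `|x|.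
rewrite sqrrB exprMn; set y := `|x|; nra.
Qed.

Let ge0_integral_normal (f : R -> \bar R) :
  measurable_fun setT f -> (forall x, 0 <= f x)%E ->
  (\int[normal_prob 0%R s]_x f x = \int[mu]_x (f x * (normal_pdf 0%R s x)%:E))%E.
Proof.
apply: (@ge0_integral_density _ _ R (normal_prob 0 s) mu (normal_pdf 0 s)) => //.
  exact: measurable_normal_pdf.
exact: normal_pdf_ge0.
Qed.

Let integrable_normal_id : (normal_prob 0 s).-integrable setT (EFin : R -> \bar R).
Proof.
apply/integrableP; split => //.
rewrite ge0_integral_normal//; last exact: measurableT_comp.
have s2 : s * 2 != 0 by rewrite mulf_neq0// gt_eqF.
apply: (@le_lt_trans _ _ (\int[mu]_x ((s * (normal_peak s / normal_peak (s * 2)))%:E * (normal_pdf 0 (s * 2) x)%:E))%E).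
  apply: ge0_le_integral => //.
  - by move=> x _; rewrite mule_ge0// lee_fin normal_pdf_ge0.
  - apply: emeasurable_funM; first exact: measurableT_comp.
    by apply/measurable_EFinP; exact: measurable_normal_pdf.
  - apply: emeasurable_funM => //.
    by apply/measurable_EFinP; exact: measurable_normal_pdf.
  - by move=> x _; rewrite -!EFinM lee_fin normal_pdf_tail.
rewrite integralZl//; last exact: integrable_normal_pdf.
by rewrite integral_normal_pdf mule1 ltry.
Qed.

(** The density is even and Lebesgue measure is invariant under x |-> -x, so the positive and
    negative parts of the identity have the same integral, which is finite by
    [integrable_normal_id]. *)
Let integral_normal_id : (\int[normal_prob 0 s]_x (x%:E) = 0)%E.
Proof.
have Hopp : (\int[normal_prob 0 s]_x ((EFin : R -> \bar R)^\- x) = \int[normal_prob 0 s]_x ((EFin : R -> \bar R)^\+ x))%E.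
  rewrite !ge0_integral_normal//; [|exact: measurable_funepos|exact: measurable_funeneg].
  rewrite [LHS](_ : _ = \int[pushforward mu (-%R : _ -> measurableTypeR R)]_x
     ((EFin : R -> \bar R)^\- x * (normal_pdf 0 s x)%:E))%E; last first.
    by apply: eq_measure_integral => //= A mA _; rewrite lebesgue_measureN.
  have mf : measurable_fun setT (fun x : measurableTypeR R => ((EFin : R -> \bar R)^\- x * (normal_pdf 0 s x)%:E)%E).
    apply: emeasurable_funM; first exact: measurable_funeneg.
    by apply/measurable_EFinP; exact: measurable_normal_pdf.
  have f0 : {in setT, forall x : measurableTypeR R, 0 <= (EFin : R -> \bar R)^\- x * (normal_pdf 0 s x)%:E}%E.
    by move=> x _; rewrite mule_ge0// lee_fin normal_pdf_ge0.
  rewrite (ge0_integral_pushforward _ _ measurableT mf f0); last by [].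
  rewrite preimage_setT; apply: eq_integral => x _ /=.
  rewrite normal_pdf_sym; congr (_ * _)%E.
  by rewrite !unlock/= opprK.
rewrite integralE Hopp subee//.
have /integrable_funepos := integrable_normal_id.
by move=> /(_ measurableT) /integrable_fin_num; apply.
Qed.

(** Both conclusions depend on the law of [X] alone, so they are transported from [normal_prob]. *)
Lemma normal_law_mean0 d (Omega : measurableType d) (P : probability Omega R) (X : Omega -> R) :
  measurable_fun setT X ->
  (forall V : set R, measurable V -> P [set w | V (X w)] = normal_prob 0 s V) ->
  P.-integrable setT (EFin \o X) /\ (\int[P]_w (X w)%:E = 0)%E.
Proof.
move=> mX XE.
have mX' : measurable_fun setT (X : Omega -> measurableTypeR R) by exact: mX.
pose X' : {RV P >-> measurableTypeR R} :=
  HB.pack (X : Omega -> measurableTypeR R) (isMeasurableFun.Build _ _ _ (measurableTypeR R) _ mX').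
have nE : forall A : set (measurableTypeR R), measurable A -> A `<=` setT ->
    normal_prob 0 s A = distribution P X' A.
  by move=> A mA _; rewrite -XE.
have iX : P.-integrable setT (EFin \o X).
  apply/integrableP; split; first exact/measurable_EFinP.
  have /integrableP[_] := integrable_normal_id.
  rewrite (eq_measure_integral (distribution P X') nE).
  by rewrite (ge0_integral_distribution X')//; exact: measurableT_comp.
split => //.
have <- := integral_normal_id.
by rewrite (eq_measure_integral (distribution P X') nE) (integral_distribution (X := X')).
Qed.

End normal.

(** * Ito integrals of deterministic integrands have mean zero *)

Section ito_mean.
Context {R : realType} {dO : measure_display} {Omega : measurableType dO}.
Variable P : probability Omega R.

Definition centered (X : Omega -> R) : Prop :=
  P.-integrable setT (EFin \o X) /\ \int[P]_w X w = 0.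

Lemma centered0 : centered (cst 0).
Proof.
split; last by rewrite Rintegral_cst// mul0r.
exact: finite_measure_integrable_cst.
Qed.

Lemma centeredD X Y : centered X -> centered Y -> centered (fun w => X w + Y w).
Proof.
move=> [iX X0] [iY Y0]; split; first exact: (integrableD measurableT iX iY).
by rewrite RintegralD// X0 Y0 addr0.
Qed.

Lemma centeredZ c X : centered X -> centered (fun w => c * X w).
Proof.
move=> [iX X0]; split; first exact: (integrableZl measurableT c iX).
by rewrite RintegralZl// X0 mulr0.
Qed.

Lemma centered_sum (I : eqType) (s : seq I) (F : I -> Omega -> R) :
  (forall i, i \in s -> centered (F i)) -> centered (fun w => \sum_(i <- s) F i w).
Proof.
elim: s => [|i s IH] Fs.
  by under eq_fun do rewrite big_nil; exact: centered0.
under eq_fun do rewrite big_cons; apply: centeredD.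
  by apply: Fs; rewrite mem_head.
by apply: IH => j js; apply: Fs; rewrite in_cons js orbT.
Qed.

Context {k : nat} (T : R) (W : R -> Omega -> 'cV[R]_k).
Hypothesis hW : brownian_motion P T W.

Lemma centered_increment s t j : 0 <= s -> s <= t -> t <= T ->
  centered (fun w => W t w j 0 - W s w j 0).
Proof.
case: hW => mW _ _ WN _ s0; rewrite le_eqVlt => /predU1P[<- sT|st tT].
  rewrite (_ : (fun w => _) = cst 0); first exact: centered0.
  by apply/funext => w; rewrite subrr.
have mX : measurable_fun setT (fun w => W t w j 0 - W s w j 0).
  apply: measurable_funB; apply: mW; first by rewrite tT (le_trans s0 (ltW st)).
  by rewrite s0 (le_trans (ltW st)).
have sq : 0 < Num.sqrt (t - s) by rewrite sqrtr_gt0 subr_gt0.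
have [iX X0] := normal_law_mean0 sq mX (WN j s t s0 st tT).
by split => //; rewrite /Rintegral X0.
Qed.

Lemma centered_step_integral n t (h : seq (R * R * 'M[R]_(n, k))) i : t <= T ->
  all (fun c => [&& 0 <= c.1.1, c.1.1 <= c.1.2 & c.1.2 <= t]) h ->
  centered (fun w => step_integral W h w i 0).
Proof.
move=> tT /allP hh.
rewrite (_ : (fun w => _) = (fun w => \sum_(c <- h) \sum_(j < k)
   c.2 i j * (W c.1.2 w j 0 - W c.1.1 w j 0))); last first.
  apply/funext => w; rewrite /step_integral summxE; apply: eq_bigr => c _.
  by rewrite mxE; apply: eq_bigr => j _; rewrite !mxE.
apply: centered_sum => c /hh/and3P[c0 c1 c2]; apply: centered_sum => j _.
by apply: centeredZ; apply: centered_increment => //; exact: le_trans tT.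
Qed.

(** Since [P] has mass 1, it is enough to integrate the pointwise bound |X| <= X^2 / (2 e) + e / 2,
    in which both terms contribute at most e / 2. *)
Lemma Rintegral_le_sqr (X : Omega -> R) (e : R) :
  measurable_fun setT X -> (\int[P]_w (X w ^+ 2)%:E < (e ^+ 2)%:E)%E -> 0 < e ->
  P.-integrable setT (EFin \o X) /\ `|\int[P]_w X w| <= e.
Proof.
move=> mX X2 e0.
have iX2 : P.-integrable setT (fun w => (X w ^+ 2)%:E).
  apply/integrableP; split; first by apply/measurable_EFinP; exact: measurable_funX.
  under eq_integral do rewrite gee0_abs ?lee_fin ?sqr_ge0//.
  by rewrite (lt_trans X2)// ltry.
have ib : P.-integrable setT (fun w => ((2 * e)^-1 * X w ^+ 2 + e / 2)%:E).
  apply: integrableDR => //; first exact: integrableZR.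
  exact: finite_measure_integrable_cst.
have bd w : `|X w| <= (2 * e)^-1 * X w ^+ 2 + e / 2.
  rewrite -(@ler_pM2l _ (2 * e)) ?mulr_gt0// mulrDr mulrA divff ?mul1r ?mulf_neq0 ?gt_eqF//.
  rewrite (_ : 2 * e * (e / 2) = e ^+ 2); last by field.
  by have := sqr_ge0 (`|X w| - e); rewrite sqrrB real_normK ?num_real//; lra.
have iX : P.-integrable setT (EFin \o X).
  apply: le_integrable ib => //; first exact/measurable_EFinP.
  by move=> w _; rewrite /= lee_fin (le_trans (bd w))// ler_norm.
split => //; apply: le_trans (le_normr_Rintegral _ iX) _ => //.
apply: le_trans (le_Rintegral _ (integrable_norm iX) ib (fun w _ => bd w)) _ => //.
rewrite RintegralD//; [|exact: (integrableZl measurableT (2 * e)^-1 iX2)|exact: finite_measure_integrable_cst].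
have Ec : \int[P]_w (e / 2) = e / 2.
  rewrite Rintegral_cst// (_ : fine _ = 1) ?mulr1//.
  by have := @probability_setT _ _ _ P; move=> /(congr1 fine).
rewrite (RintegralZl _ measurableT iX2) Ec.
have : \int[P]_w (X w ^+ 2) <= e ^+ 2.
  rewrite -lee_fin /Rintegral fineK; first exact: ltW.
  exact: integrable_fin_num.
move=> /(ler_wpM2l (_ : 0 <= (2 * e)^-1)) H.
have e2 : e = (2 * e)^-1 * e ^+ 2 + e / 2 by field; rewrite gt_eqF.
by rewrite [leRHS]e2 lerD2r H// invr_ge0 mulr_ge0// ltW.
Qed.

(** Step integrals are combinations of centered increments, and convergence in L_2 carries the mean
    to the limit. One index [q] per tolerance is enough; the one for tolerance 1 also yields the
    integrability of [N]. *)
Lemma ito_integral_centered n t (g : R -> 'M[R]_(n, k)) N i : t <= T ->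
  ito_integral P W t g N -> centered (fun w => N w i 0).
Proof.
move=> tT [mN [h [hh _ hN]]].
have cI q i' := centered_step_integral i' tT (hh q).
have mI q i' : measurable_fun setT (fun w => step_integral W (h q) w i' 0).
  by have [/integrableP[/measurable_EFinP]] := cI q i'.
have mD q i' : measurable_fun setT (fun w => N w i' 0 - step_integral W (h q) w i' 0).
  by apply: measurable_funB; [exact: mN|exact: mI].
have key e : 0 < e -> exists q,
    P.-integrable setT (fun w => (N w i 0 - step_integral W (h q) w i 0)%:E) /\
    `|\int[P]_w (N w i 0 - step_integral W (h q) w i 0)| <= e.
  move=> e0.
  have e20 : (0 < (e ^+ 2)%:E)%E by rewrite lte_fin exprn_gt0.
  have /= [q _ /(_ q (leqnn q)) Hq] := hN _ (open_ereal_lt' e20).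
  exists q; apply: Rintegral_le_sqr => //.
  apply: le_lt_trans Hq; apply: ge0_le_integral => //.
  - by move=> w _; rewrite lee_fin sqr_ge0.
  - by apply/measurable_EFinP; apply: measurable_funX.
  - apply/measurable_EFinP; rewrite /sqnorm.
    apply: measurable_sum => i'; apply: measurable_sum => j.
    apply: measurable_funX; rewrite (ord1 j).
    by under eq_fun do rewrite !mxE; exact: mD.
  - move=> w _; rewrite lee_fin /sqnorm (bigD1 i)//= big_ord1 !mxE lerDl.
    by apply: sumr_ge0 => i' _; apply: sumr_ge0 => j _; rewrite sqr_ge0.
have iN : P.-integrable setT (fun w => (N w i 0)%:E).
  have [q [iD _]] := key 1 ltr01; have [iI _] := cI q i.
  apply: eq_integrable (integrableD measurableT iD iI) => // w _ /=.
  by rewrite -EFinD subrK.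
split => //; apply/eqP; rewrite -normr_le0; apply/ler_addgt0Pl => e e0; rewrite addr0.
have [q [iD]] := key e e0; have [iI I0] := cI q i.
by rewrite RintegralB// I0 subr0.
Qed.

End ito_mean.

(** * Fubini's theorem for real-valued integrals and the equation of the mean *)

Section mx_measurable_functions.
Context {R : realType}.
Local Notation mu := (@lebesgue_measure R).
Local Notation RT := (measurableTypeR R).

Definition mx_measurable d (X : measurableType d) n m (D : set X) (F : X -> 'M[R]_(n, m)) : Prop :=
  forall i j, measurable_fun D (fun s => F s i j).

Lemma mx_measurableD d (X : measurableType d) n m (D : set X) (F G : X -> 'M[R]_(n, m)) :
  mx_measurable D F -> mx_measurable D G -> mx_measurable D (fun s => F s + G s).
Proof.
move=> mF mG i j.
rewrite (_ : (fun s => _) = (fun s => F s i j + G s i j)); last by apply/funext => s; rewrite mxE.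
exact: measurable_funD.
Qed.

Lemma mx_measurable_mul d (X : measurableType d) n m l (D : set X)
    (F : X -> 'M[R]_(n, m)) (G : X -> 'M[R]_(m, l)) :
  mx_measurable D F -> mx_measurable D G -> mx_measurable D (fun s => F s *m G s).
Proof.
move=> mF mG i j.
rewrite (_ : (fun s => _) = (fun s => \sum_k F s i k * G s k j)); last by apply/funext => s; rewrite mxE.
by apply: measurable_sum => k; exact: measurable_funM.
Qed.

Lemma integrable_swap d1 d2 (T1 : measurableType d1) (T2 : measurableType d2)
    (m1 : {sigma_finite_measure set T1 -> \bar R})
    (m2 : {sigma_finite_measure set T2 -> \bar R}) (f : T1 * T2 -> \bar R) :
  (m1 \x m2)%E.-integrable setT f ->
  (m2 \x m1)%E.-integrable setT (fun z => f (z.2, z.1)).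
Proof.
move=> fi; have mf := measurable_int _ fi.
have ms : measurable_fun setT (fun z : T2 * T1 => (z.2, z.1)) by exact: measurable_swap.
apply/integrable12ltyP; first exact: (measurableT_comp mf ms).
exact: (integrable21ltyP _ _ mf).1.
Qed.

(** This exchanges a coefficient for its everywhere bounded version inside an integral equation. *)
Lemma ae_eq_mx_integral n m l (D : set RT) (a a' : R -> 'M[R]_(n, m))
    (z : R -> 'M[R]_(m, l)) (c : R -> 'M[R]_(n, l)) : measurable D ->
  mx_measurable D a -> mx_measurable D a' -> mx_measurable D z -> mx_measurable D c ->
  {ae mu, forall s : RT, D s -> a s = a' s} ->
  mx_integral D (fun s => a s *m z s + c s) = mx_integral D (fun s => a' s *m z s + c s).
Proof.
move=> mD ma ma' mz mc aE; apply/matrixP => i j; rewrite !mxE; congr fine.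
apply: ae_eq_integral => //.
- by apply/measurable_EFinP; apply: mx_measurableD => //; exact: mx_measurable_mul.
- by apply/measurable_EFinP; apply: mx_measurableD => //; exact: mx_measurable_mul.
by apply: filterS aE => s H /= /H ->.
Qed.

End mx_measurable_functions.

Lemma lebesgue_itv_lty {R : realType} (t : R) :
  (lebesgue_measure (`[0%R, t]%classic : set (measurableTypeR R)) < +oo)%E.
Proof. by rewrite lebesgue_measure_itv/=; case: ifPn => // _; rewrite -EFinB ltry. Qed.

(** [fine] sends an infinite inner integral to 0, so the real inner integral agrees with the
    extended one only almost everywhere; but it is dominated by it everywhere, which gives the
    integrability. *)
Lemma Fubini_fine {R : realType} d1 d2 (T1 : measurableType d1) (T2 : measurableType d2)
    (m1 : {sigma_finite_measure set T1 -> \bar R})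
    (m2 : {sigma_finite_measure set T2 -> \bar R}) (X : T1 * T2 -> R) :
  (m1 \x m2)%E.-integrable setT (EFin \o X) ->
  [/\ {ae m1, forall s, m2.-integrable setT (fun w => (X (s, w))%:E)},
     {ae m1, forall s, ((\int[m2]_w X (s, w))%:E = \int[m2]_w (X (s, w))%:E)%E} &
     m1.-integrable setT (fun s => (\int[m2]_w X (s, w))%:E)].
Proof.
move=> iX; have mX := measurable_int _ iX.
have a1 := ae_integrable1 iX.
have a2 : {ae m1, forall s, ((\int[m2]_w X (s, w))%:E = \int[m2]_w (X (s, w))%:E)%E}.
  by apply: filterS a1 => s si; rewrite /Rintegral fineK//; exact: integrable_fin_num.
split => //.
have iF := integrable_fubini_F iX.
apply: le_integrable iF => //.
  apply/measurable_EFinP; apply: measurable_Rintegral_param.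
  exact/measurable_EFinP.
move=> s _; rewrite /Rintegral /fubini_F/=.
have H (x : \bar R) : ((`|fine x|%R)%:E <= `|x|)%E by case: x => [r||] /=; rewrite ?lexx ?normr0 ?leey.
exact: H.
Qed.

Lemma Fubini_Rintegral {R : realType} d1 d2 (T1 : measurableType d1) (T2 : measurableType d2)
    (m1 : {sigma_finite_measure set T1 -> \bar R})
    (m2 : {sigma_finite_measure set T2 -> \bar R}) (X : T1 * T2 -> R) :
  (m1 \x m2)%E.-integrable setT (EFin \o X) ->
  \int[m1]_s \int[m2]_w X (s, w) = \int[m2]_w \int[m1]_s X (s, w).
Proof.
move=> iX; have iX' := integrable_swap iX.
have [_ e1 i1] := Fubini_fine iX.
have [_ e2 i2] := @Fubini_fine _ _ _ _ _ m2 m1 (fun z => X (z.2, z.1)) iX'.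
rewrite /Rintegral; congr fine.
transitivity (\int[m1]_s \int[m2]_w (X (s, w))%:E)%E.
  apply: ae_eq_integral => //; first exact: measurable_int i1.
    exact: (measurable_fubini_F iX).
  by apply: filterS e1 => s ->.
rewrite (Fubini iX).
apply/esym/ae_eq_integral => //; first exact: measurable_int i2.
  exact: (measurable_fubini_F iX').
by apply: filterS e2 => s ->.
Qed.

Section mean_equation.
Context {R : realType} {dO : measure_display} {Omega : measurableType dO}.
Variable P : probability Omega R.
Local Notation mu := (@lebesgue_measure R).
Local Notation RT := (measurableTypeR R).

Lemma itv_setT_lty (S : R) : ((mu \x P)%E (`[0%R, S] `*` setT) < +oo)%E.
Proof.
rewrite product_measure1E// lte_mul_pinfty//.
  by rewrite ge0_fin_numE//; exact: lebesgue_itv_lty.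
by rewrite (le_lt_trans (probability_le1 P measurableT))// ltry.
Qed.

(** The strip has finite measure, and |Z| <= Z^2 + 1 on it. *)
Lemma Lp2_integrable (S : R) (Z : RT * Omega -> R) :
  Lp_on (mu \x P)%E 2%:E (`[0, S] `*` setT) Z ->
  (mu \x P)%E.-integrable setT (EFin \o (Z \_ (`[0, S] `*` setT))).
Proof.
set D := `[0, S] `*` setT => -[mZ NZ].
have mD : measurable (D : set (RT * Omega)) by apply: measurableX.
have mZr : measurable_fun setT (Z \_ D).
  by apply/(measurable_restrictT _ mD).
have DS : ((mu \x P)%E D < +oo)%E by exact: itv_setT_lty.
have i2 : (mu \x P)%E.-integrable setT (EFin \o (fun z => (Z \_ D) z ^+ 2)).
  by apply: Lfun2_integrable_sqr; rewrite inE/=; apply/andP; split; rewrite inE.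
have i1 : (mu \x P)%E.-integrable setT (EFin \o \1_D).
  apply/integrableP; split; first exact/measurable_EFinP/measurable_indic.
  under eq_integral do rewrite gee0_abs ?lee_fin//.
  by rewrite integral_indic// setIT.
have ib := integrableDR measurableT i2 i1.
apply: le_integrable ib => //; first exact/measurable_EFinP.
move=> z _; rewrite /= lee_fin (le_trans _ (ler_norm _))//.
rewrite /patch indicE; case: ifPn => _ /=; last by rewrite normr0 expr0n/= addr0.
have := sqr_ge0 (`|Z z| - 1); have := sqr_ge0 (Z z).
by rewrite sqrrB real_normK ?num_real//; lra.
Qed.

Lemma mx_integrable_bounded n m l (t : R) (M : R) (a : R -> 'M[R]_(n, m)) (z : R -> 'M[R]_(m, l)) :
  mx_measurable (setT : set RT) a -> (forall s i j, `|a s i j| <= M) ->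
  mx_integrable `[0, t] z -> mx_integrable `[0, t] (fun s => a s *m z s).
Proof.
move=> ma aM iz i k.
rewrite (_ : (fun s => _) = (fun s => (\sum_j a s i j * z s j k)%:E)); last first.
  by apply/funext => s; rewrite mxE.
apply: integrable_sumR => // j.
apply: le_integrable (integrableZR M _ (iz j k)) => //.
  apply/measurable_EFinP; apply: measurable_funM; first exact: measurable_funTS (ma i j).
  by apply/measurable_EFinP; exact: measurable_int (iz j k).
move=> s _; rewrite /= lee_fin normrM [leRHS]normrM ler_wpM2r//.
by rewrite (le_trans (aM s i j))// ler_norm.
Qed.

Lemma natural_filtration_measurable k (T t : R) (W : R -> Omega -> 'cV[R]_k) :
  t <= T -> brownian_motion P T W -> natural_filtration W t `<=` measurable.
Proof.
move=> tT [mW _ _ _ _]; apply: smallest_sub; first exact: sigma_algebra_measurable.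
move=> E [s [i [V [/andP[s0 st] mV ->]]]].
rewrite -[X in measurable X]setTI; apply: (mW s i _ measurableT V mV).
by rewrite s0 (le_trans st).
Qed.

(** The expectation of the integral equation is taken: Fubini moves it inside the time integral, and
    the Ito term is centered. The bounded [a'] in place of [a] makes the drift integrable on the
    product of time and [Omega]. *)
Lemma sde_mean n m k (T S : R) (W : R -> Omega -> 'cV[R]_k)
    (a a' : R -> 'M[R]_n) (b : R -> 'M[R]_(n, m)) (g : R -> 'M[R]_(n, k))
    (u : R -> 'cV[R]_m) (x0 : 'cV[R]_n) (Z : R -> Omega -> 'cV[R]_n) (M : R) :
  S <= T -> brownian_motion P T W -> sde_solution P W S a b g u x0 Z ->
  mx_measurable (`[0, S]%classic : set RT) a ->
  mx_measurable (setT : set RT) a' -> (forall s i j, `|a' s i j| <= M) ->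
  {ae mu, forall s : RT, 0 <= s <= S -> a s = a' s} ->
  mx_integrable `[0, S] (fun s => b s *m u s) ->
  let z t := \col_i (\int[P]_w Z t w i 0) in
  [/\ forall t, 0 <= t <= S -> forall i, P.-integrable setT (fun w => (Z t w i 0)%:E),
     mx_integrable `[0, S] (fun s => a' s *m z s + b s *m u s) &
     forall t, 0 <= t <= S ->
       z t = x0 + mx_integral `[0, t] (fun s => a' s *m z s + b s *m u s)].
Proof.
move=> ST hW [Zad ZL2 _ ZE] ma ma' aM aE ibu z.
pose f s := b s *m u s.
(* Extended by zero to all times, so that Fubini applies on the full product. *)
pose Zr j := (fun p : RT * Omega => Z p.1 p.2 j 0) \_ (`[0, S] `*` setT).
have iZr j : (mu \x P)%E.-integrable setT (EFin \o Zr j) by exact: Lp2_integrable.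
have ZrE j s w : 0 <= s <= S -> Zr j (s, w) = Z s w j 0.
  by move=> sS; rewrite /Zr /patch ifT// inE/=; split => //; rewrite in_itv.
have zrE j s : 0 <= s <= S -> \int[P]_w Zr j (s, w) = z s j 0.
  by move=> sS; rewrite mxE; apply: eq_Rintegral => w _; rewrite ZrE.
have iz : mx_integrable `[0, S] z.
  move=> j l; rewrite (ord1 l).
  have [_ _ H] := Fubini_fine (iZr j).
  have mS : measurable (`[0, S]%classic : set RT) by [].
  have H' := integrableS measurableT mS (@subsetT _ _) H.
  apply: eq_integrable H' => // s.
  by rewrite inE/= in_itv/= => sS; rewrite zrE.
have iaz : mx_integrable `[0, S] (fun s => a' s *m z s).
  exact: mx_integrable_bounded ma' aM iz.
have iazf := mx_integrableD (measurable_itv _ : measurable (`[0, S]%classic : set RT)) iaz ibu.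
have main t i : 0 <= t <= S ->
  P.-integrable setT (fun w => (Z t w i 0)%:E) /\
  z t i 0 = (x0 + mx_integral `[0, t] (fun s => a' s *m z s + b s *m u s)) i 0.
  move=> /andP[t0 tS].
  have tS' : 0 <= t <= S by rewrite t0.
  have mt : measurable (`[0, t]%classic : set RT) by [].
  (* Row [i] of [a'], cut off to [[0, t]]: the part of the drift that contains the state is the sum
     over [j] of the integrals of [q j s * Zr j (s, w)] over the whole line. *)
  pose q j (s : RT) := \1_(`[0, t]%classic) s * a' s i j.
  have mq j : measurable_fun setT (q j).
    by apply: measurable_funM; [exact: measurable_indic|exact: ma'].
  have qM j s : `|q j s| <= M.
    rewrite normrM indicE; case: (_ \in _); rewrite ?normr1 ?mul1r// normr0 mul0r.
    by rewrite (le_trans _ (aM s i j)).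
  pose X j (p : RT * Omega) := q j p.1 * Zr j p.
  have iX j : (mu \x P)%E.-integrable setT (EFin \o X j).
    apply: le_integrable (integrableZR M _ (iZr j)) => //.
      apply/measurable_EFinP; apply: measurable_funM.
        exact: (measurableT_comp (mq j) measurable_fst).
      by apply/measurable_EFinP; exact: measurable_int (iZr j).
    move=> p _; rewrite /= lee_fin /X normrM [leRHS]normrM ler_wpM2r//.
    by rewrite (le_trans (qM j p.1))// ler_norm.
  have [a2 _ iI] : [/\ {ae P, forall w, forall j, mu.-integrable setT (fun s => (X j (s, w))%:E)},
     True & forall j, P.-integrable setT (fun w => (\int[mu]_s X j (s, w))%:E)].
    split => //.
      suff H j : {ae P, forall w, mu.-integrable setT (fun s => (X j (s, w))%:E)}.
        have := @filter_forall _ _ (fun j w => mu.-integrable setT (fun s => (X j (s, w))%:E)) (almost_everywhere P) _ H.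
        exact.
      by have [+ _ _] := @Fubini_fine R _ _ _ _ P mu (fun p => X j (p.2, p.1)) (integrable_swap (iX j)).
    by move=> j; have [_ _] := @Fubini_fine R _ _ _ _ P mu (fun p => X j (p.2, p.1)) (integrable_swap (iX j)).
  have EX j : \int[P]_w \int[mu]_s X j (s, w) = \int[mu]_(s in `[0, t]) (a' s i j * z s j 0).
    rewrite -(Fubini_Rintegral (iX j)) [RHS]Rintegral_mkcond; congr fine.
    have [b1 _ _] := Fubini_fine (iZr j).
    apply: ae_eq_integral => //.
    - by have [_ _ /measurable_int] := Fubini_fine (iX j).
    - apply/measurable_EFinP/(measurable_restrictT _ mt).
      apply: measurable_funM; first exact: measurable_funTS (ma' i j).
      apply/measurable_EFinP; apply: measurable_int (integrable_itvS tS _).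
      exact: iz.
    - apply: filterS b1 => s Hs _; congr EFin.
      rewrite /X/= RintegralZl// /q indicE /patch; case: ifPn; last by rewrite !mul0r.
      rewrite inE/= in_itv/= mul1r => /andP[s0 st].
      by rewrite zrE// s0 (le_trans st).
  have [N [hN ZtE]] := ZE t tS'.
  have [iN N0] := ito_integral_centered hW i (le_trans tS ST) hN.
  (* The right-hand side of the equation at time [t]. Square integrability in (s, w) says nothing
     about one given time, so the integrability of [Z t] is deduced from that of [V], to which it is
     almost surely equal. *)
  pose V w := \sum_j (\int[mu]_s X j (s, w)) + (x0 i 0 + \int[mu]_(s in `[0, t]) f s i 0 + N w i 0).
  have ibut := mx_integrableS tS ibu.
  have ZV : {ae P, forall w, Z t w i 0 = V w}.
    near=> w.
    have -> : Z t w = x0 + mx_integral `[0, t] (fun s => a s *m Z s w + b s *m u s) + N w.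
      by near: w.
    have iXw : forall j, mu.-integrable setT (fun s => (X j (s, w))%:E) by near: w.
    pose Zw s : 'cV[R]_n := \col_j Zr j (s, w).
    have mZw : mx_measurable (`[0, t]%classic : set RT) Zw.
      move=> j l; rewrite (_ : (fun s => _) = (fun s => Zr j (s, w))).
        apply: measurable_funTS.
        have /measurable_EFinP mZj := measurable_int _ (iZr j).
        exact: (measurableT_comp mZj (pair2_measurable w)).
      by apply/funext => s; rewrite mxE.
    have -> : mx_integral `[0, t] (fun s => a s *m Z s w + b s *m u s) =
      mx_integral `[0, t] (fun s => a' s *m Zw s + b s *m u s).
      rewrite -(@ae_eq_mx_integral _ _ _ _ _ a a')//; last 4 first.
      - move=> j l; apply: measurable_funS (ma j l) => //.
        by apply: subset_itvl; rewrite bnd_simp.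
      - by move=> j l; exact: measurable_funTS (ma' j l).
      - by move=> j l; apply/measurable_EFinP; exact: measurable_int (ibut j l).
      - apply: filterS aE => s H /=; rewrite in_itv/= => /andP[s0 st]; apply: H.
        by rewrite s0 (le_trans st).
      apply: eq_mx_integral => s; rewrite inE/= in_itv/= => /andP[s0 st].
      congr (_ *m _ + _); apply/matrixP => j l; rewrite mxE ZrE ?ord1//.
      by rewrite s0 (le_trans st).
    rewrite /V !mxE.
    have -> : \int[mu]_(s in `[0, t]) (a' s *m Zw s + b s *m u s) i 0 =
       \sum_j (\int[mu]_s X j (s, w)) + \int[mu]_(s in `[0, t]) f s i 0.
      have XE j : \int[mu]_s X j (s, w) = \int[mu]_(s in `[0, t]) (a' s i j * Zw s j 0).
        rewrite [RHS]Rintegral_mkcond; apply: eq_Rintegral => s _.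
        rewrite /X /q /patch/= indicE mxE; case: (_ \in _); last by rewrite !mul0r.
        by rewrite mul1r.
      have iXt j : mu.-integrable (`[0, t]%classic : set RT) (fun s => (a' s i j * Zw s j 0)%:E).
        have H' := integrableS measurableT mt (@subsetT _ _) (iXw j).
        apply: eq_integrable H' => // s.
        rewrite inE/= => st; rewrite /X /q/= indicE mxE mem_set// mul1r//.
      under eq_bigr do rewrite XE.
      rewrite -Rintegral_sum// -RintegralD//; last 2 first.
      - exact: integrable_sumR.
      - exact: ibut.
      by apply: eq_Rintegral => s _; rewrite [LHS]mxE [(a' s *m _) i 0]mxE.
    by rewrite -!addrA [RHS]addrCA; congr (_ + _).
  have iV : P.-integrable setT (fun w => (V w)%:E).
    apply: integrableDR => //; first exact: integrable_sumR.
    apply: integrableDR => //; exact: finite_measure_integrable_cst.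
  have mZt : measurable_fun setT (fun w => Z t w i 0).
    move=> _ B mB; rewrite setTI.
    apply: (natural_filtration_measurable (le_trans tS ST) hW).
    exact: Zad.
  have iZt : P.-integrable setT (fun w => (Z t w i 0)%:E).
    have /integrableP[mV iVoo] := iV.
    apply/integrableP; split; first exact/measurable_EFinP.
    suff -> : (\int[P]_w `|(Z t w i 0)%:E| = \int[P]_w `|(V w)%:E|)%E by [].
    apply: ae_eq_integral => //.
    - by apply: measurableT_comp => //; exact/measurable_EFinP.
    - by apply: measurableT_comp.
    - by apply: filterS ZV => w ->.
  split => //.
  rewrite mxE; transitivity (\int[P]_w V w).
    congr fine; apply: ae_eq_integral => //; first exact/measurable_EFinP.
      exact: measurable_int iV.
    by apply: filterS ZV => w ->.
  have c1 : P.-integrable setT (fun w : Omega => (x0 i 0 + \int[mu]_(s in `[0, t]) f s i 0)%:E).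
    exact: finite_measure_integrable_cst.
  have c0 : \int[P]_w (x0 i 0 + \int[mu]_(s in `[0, t]) f s i 0) = x0 i 0 + \int[mu]_(s in `[0, t]) f s i 0.
    have := Rintegral_cst P measurableT (x0 i 0 + \int[mu]_(s in `[0, t]) f s i 0).
    by move=> ->; rewrite (_ : fine _ = 1) ?mulr1//; have := @probability_setT _ _ _ P; move=> /(congr1 fine).
  rewrite /V RintegralD//; last 2 first.
  - exact: integrable_sumR.
  - exact: integrableDR.
  rewrite (Rintegral_sum _ measurableT iI) (RintegralD measurableT c1 iN) N0 addr0 c0.
  rewrite !mxE addrCA; congr (_ + _).
  under eq_bigr do rewrite EX.
  have iaz' j : mu.-integrable (`[0, t]%classic : set RT) (fun s => (a' s i j * z s j 0)%:E).
    apply: le_integrable (integrableZR M _ (integrable_itvS tS (iz j 0))) => //.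
      apply/measurable_EFinP; apply: measurable_funM; first exact: measurable_funTS (ma' i j).
      by apply/measurable_EFinP; exact: measurable_int (integrable_itvS tS (iz j 0)).
    move=> s _; rewrite /= lee_fin normrM [leRHS]normrM ler_wpM2r//.
    by rewrite (le_trans (aM s i j))// ler_norm.
  rewrite -Rintegral_sum// -RintegralD//; last 2 first.
  - exact: integrable_sumR.
  - exact: ibut.
  by apply: eq_Rintegral => s _; rewrite [RHS]mxE [(a' s *m _) i 0]mxE.
split.
- by move=> t tS i; have [] := main t i tS.
- exact: iazf.
- move=> t tS; apply/matrixP => i j; rewrite (ord1 j).
  by have [] := main t i tS.
Unshelve. all: end_near.
Qed.

End mean_equation.

(** * Square-integrable functions *)

Section compact_tuple.
Context {R : realType} {d : nat}.
Local Notation RT := (measurableTypeR R).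
Local Notation Rd := (d.-tuple RT).

Let box (q : d.-tuple rat) (e : R) : set Rd :=
  \bigcap_(i in [set: 'I_d]) [set b : Rd | `|tnth b i - ratr (tnth q i)| < e].

Let measurable_box q e : measurable (box q e).
Proof.
apply: fin_bigcap_measurable; first exact: finite_finset.
move=> i _.
have mi : measurable_fun setT (fun b : Rd => `|tnth b i - ratr (tnth q i)| < e).
  apply: measurable_fun_ltr => //; apply: measurableT_comp => //.
  by apply: measurable_funB => //; exact: measurable_tnth.
by rewrite -[X in measurable X]setTI; exact: (mi measurableT [set true]).
Qed.

(** The topology lives on row vectors and the sigma-algebra on tuples is generated by the
    coordinates. The bridge between them is countable: the complement of [K] is the union of those
    boxes with rational centre and radius [r.+1%:R^-1] that miss [K]. *)
Lemma compact_tuple_measurable (K : set Rd) : compact_tuple K -> measurable K.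
Proof.
rewrite /compact_tuple; set f := fun b : Rd => _ => cK.
have clK : closed (f @` K : set 'rV[R]_d) by apply: compact_closed.
pose J := [set qr : d.-tuple rat * nat | box qr.1 qr.2.+1%:R^-1 `&` K = set0].
rewrite -[K]setCK; apply: measurableC.
have -> : ~` K = \bigcup_(qr in J) box qr.1 qr.2.+1%:R^-1.
  apply/seteqP; split => [b nKb|b [qr /= Jqr bqr] Kb]; last first.
    by have : (box qr.1 qr.2.+1%:R^-1 `&` K) b by []; rewrite Jqr.
  have : (~` (f @` K)) (f b).
    move=> [b' Kb' fbb']; apply: nKb; suff -> : b = b' by [].
    apply: eq_from_tnth => i; have := congr1 (fun M : 'rV[R]_d => M 0 i) fbb'.
    by rewrite /f !mxE.
  move=> nKfb.
  have /nbhs_ballP[e /= e0 eK] := open_nbhs_nbhs (conj (closed_openC clK) nKfb).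
  (* The radius of the box is taken below [e / 2], because two points of a box can differ in a
     coordinate by nearly twice its radius. *)
  have e20 : 0 < e / 2 by rewrite divr_gt0.
  have [r _ /(_ r (leqnn r)) /= re] := near_infty_natSinv_lt (PosNum e20).
  have qex i : exists q : rat, `|tnth b i - ratr q| < r.+1%:R^-1.
    have /rat_in_itvoo[q] : tnth b i - r.+1%:R^-1 < tnth b i + r.+1%:R^-1.
      by rewrite ltrBlDr -addrA ltrDl -mulr2n mulrn_wgt0// invr_gt0.
    rewrite in_itv/= => /andP[q1 q2]; by exists q; rewrite ltr_distlC q1.
  pose q := [tuple sval (cid (qex i)) | i < d].
  exists (q, r); last first.
    by move=> i _ /=; rewrite tnth_mktuple; exact: (svalP (cid (qex i))).
  rewrite /J/= -subset0 => b' [bb' Kb'].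
  apply: (eK (f b')); last by exists b'.
  split=> // i j; rewrite /f !mxE -ball_normE /ball_/=.
  have := bb' j I; have := svalP (cid (qex j)); rewrite /= tnth_mktuple => h1 h2.
  rewrite (le_lt_trans (ler_distD (ratr (sval (cid (qex j)))) _ _))//.
  rewrite [ltRHS]splitr ltrD//; first exact: lt_trans re.
  by rewrite distrC; exact: lt_trans re.
rewrite bigcup_mkcond; apply: countable_bigcupT_measurable => //.
by move=> qr; case: ifPn => _.
Qed.

End compact_tuple.

Section sqint.
Context d (X : measurableType d) (R : realType) (nu : {measure set X -> \bar R}).
Implicit Types (D : set X) (f g : X -> R).

(** The working form of membership in L_2: it trades the norm in [Lp_on] for integrability of the
    square, so that the lemmas on integrals apply directly. *)
Definition sqint D f : Prop :=
  measurable_fun D f /\ nu.-integrable D (fun x => (f x ^+ 2)%:E).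

Lemma Lp_on2P D f : measurable D -> Lp_on nu 2%:E D f <-> sqint D f.
Proof.
move=> mD; split.
  move=> [mf Nf]; split => //.
  have i2 : nu.-integrable setT (EFin \o (fun z => (f \_ D) z ^+ 2)).
    apply: Lfun2_integrable_sqr; rewrite inE/=; apply/andP; split; rewrite inE//=.
    exact/(measurable_restrictT _ mD).
  apply: eq_integrable (integrableS measurableT mD (@subsetT _ _) i2) => // x xD.
  by rewrite /= patchT.
move=> [mf i2]; split => //.
rewrite unlock /=; apply: poweR_lty.
suff -> : (\int[nu]_x `|((f \_ D) x)%:E| `^ 2 = \int[nu]_(x in D) `|(f x ^+ 2)%:E|)%E.
  by have /integrableP[_] := i2.
rewrite [RHS]integral_mkcond; apply: eq_integral => x _.
rewrite /patch; case: ifPn => _ /=; last by rewrite normr0 powR0//.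
by rewrite powR_mulrn// normrX.
Qed.

Lemma sqint_integrableM D f g : measurable D -> sqint D f -> sqint D g ->
  nu.-integrable D (fun x => (f x * g x)%:E).
Proof.
move=> mD [mf i2f] [mg i2g].
apply: le_integrable (integrableDR mD i2f i2g) => //.
  by apply/measurable_EFinP; exact: measurable_funM.
move=> x _; rewrite /= lee_fin (le_trans _ (ler_norm _))// normrM.
have := sqr_ge0 (`|f x| - `|g x|); rewrite sqrrB !real_normK ?num_real//.
have := mulr_ge0 (normr_ge0 (f x)) (normr_ge0 (g x)); lra.
Qed.

Lemma sqintZb D f g (M : R) : measurable D -> measurable_fun D g ->
  (forall x, D x -> `|g x| <= M) -> sqint D f -> sqint D (fun x => g x * f x).
Proof.
move=> mD mg gM [mf i2]; split; first exact: measurable_funM.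
apply: le_integrable (integrableZR (M ^+ 2) mD i2) => //.
  by apply/measurable_EFinP; apply: measurable_funX; exact: measurable_funM.
move=> x Dx; rewrite /= lee_fin exprMn normrM [leRHS]normrM ler_wpM2r//.
rewrite !normrX lerXn2r ?nnegrE//.
by rewrite (le_trans (gM x Dx))// ler_norm.
Qed.

Lemma sqintZ D f (c : R) : measurable D -> sqint D f -> sqint D (fun x => c * f x).
Proof. by move=> mD; apply: (@sqintZb _ _ _ `|c|). Qed.

Lemma sqintD D f g : measurable D -> sqint D f -> sqint D g -> sqint D (fun x => f x + g x).
Proof.
move=> mD [mf i2f] [mg i2g]; split; first exact: measurable_funD.
apply: le_integrable (integrableZR 2 mD (integrableDR mD i2f i2g)) => //.
  by apply/measurable_EFinP; apply: measurable_funX; exact: measurable_funD.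
move=> x _; rewrite /= lee_fin ger0_norm ?sqr_ge0// (le_trans _ (ler_norm _))//.
have := sqr_ge0 (f x - g x); rewrite sqrrB sqrrD; lra.
Qed.

Lemma sqintB D f g : measurable D -> sqint D f -> sqint D g -> sqint D (fun x => f x - g x).
Proof.
move=> mD Sf Sg; have := sqintD mD Sf (sqintZ (-1) mD Sg).
by under [X in sqint _ X -> _]eq_fun do rewrite mulN1r.
Qed.

Lemma sqint0 D : measurable D -> sqint D (fun=> 0).
Proof.
move=> mD; split; first exact: measurable_cst.
by rewrite expr0n/=; exact: integrable0.
Qed.

Lemma sqint_sum (I : Type) (s : seq I) D (F : I -> X -> R) : measurable D ->
  (forall i, sqint D (F i)) -> sqint D (fun x => \sum_(i <- s) F i x).
Proof.
move=> mD SF; elim: s => [|i s IH].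
  by under eq_fun do rewrite big_nil; exact: sqint0.
by under eq_fun do rewrite big_cons; exact: sqintD.
Qed.

Lemma sqintS D E f : measurable D -> measurable E -> E `<=` D -> sqint D f -> sqint E f.
Proof.
move=> mD mE ED [mf i2]; split; first exact: measurable_funS mf.
exact: integrableS i2.
Qed.

Lemma eq_sqint D f g : measurable D -> {in D, f =1 g} -> sqint D f -> sqint D g.
Proof.
move=> mD fg [mf i2]; split; first exact: eq_measurable_fun mf.
by apply: eq_integrable i2 => // x xD; rewrite fg.
Qed.

(** The integral of (t f - g)^2 is a quadratic in [t] that is never negative; its value at [b / a]
    is the inequality. *)
Lemma Cauchy_Schwarz D f g : measurable D -> sqint D f -> sqint D g ->
  (\int[nu]_(x in D) (f x * g x)) ^+ 2 <=
  \int[nu]_(x in D) (f x ^+ 2) * \int[nu]_(x in D) (g x ^+ 2).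
Proof.
move=> mD Sf Sg; have [mf i2f] := Sf; have [mg i2g] := Sg.
have ifg := sqint_integrableM mD Sf Sg.
set a := \int[nu]_(x in D) (f x ^+ 2); set c := \int[nu]_(x in D) (g x ^+ 2).
set b := \int[nu]_(x in D) (f x * g x).
have a0 : 0 <= a by apply: Rintegral_ge0 => x _; exact: sqr_ge0.
have c0 : 0 <= c by apply: Rintegral_ge0 => x _; exact: sqr_ge0.
have H t : 0 <= t ^+ 2 * a - 2 * t * b + c.
  have -> : t ^+ 2 * a - 2 * t * b + c = \int[nu]_(x in D) ((t * f x - g x) ^+ 2).
    rewrite -(RintegralZl _ mD i2f) -(RintegralZl _ mD ifg).
    rewrite -RintegralB//; [|exact: integrableZR|exact: integrableZR].
    rewrite -RintegralD//; last by apply: integrableBR => //; exact: integrableZR.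
    by apply: eq_Rintegral => x _; ring.
  by apply: Rintegral_ge0 => x _; exact: sqr_ge0.
move: a0; rewrite le_eqVlt => /predU1P[a0|a0].
  rewrite -a0 mul0r; have [->|b0] := eqVneq b 0; first by rewrite expr0n.
  (* With [a = 0] the quadratic is affine, and this [t] would give it the value -1. *)
  have := H ((c + 1) / (2 * b)); rewrite -a0 mulr0 add0r.
  have -> : 2 * ((c + 1) / (2 * b)) * b = c + 1 by field.
  by rewrite opprD addrAC addNr add0r oppr_ge0 ler10.
have := H (b / a); have -> : (b / a) ^+ 2 * a - 2 * (b / a) * b + c = c - b ^+ 2 / a.
  by field; rewrite gt_eqF.
by rewrite subr_ge0 ler_pdivrMr// mulrC.
Qed.

End sqint.

(** Tonelli for the indicator of a measurable null set containing the exceptions: the measures of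
    its sections integrate to zero, so almost all of them vanish. *)
Lemma ae_ysection {R : realType} d1 d2 (T1 : measurableType d1) (T2 : measurableType d2)
    (m1 : {sigma_finite_measure set T1 -> \bar R})
    (m2 : {sigma_finite_measure set T2 -> \bar R}) (Q : T1 * T2 -> Prop) :
  {ae (m1 \x m2)%E, forall p, Q p} -> {ae m2, forall b, {ae m1, forall s, Q (s, b)}}.
Proof.
move=> [N [mN N0 QN]].
have mi : measurable_fun setT (fun p : T1 * T2 => (\1_N p)%:E : \bar R).
  by apply/measurable_EFinP; exact: measurable_indic.
have e0 : (\int[m2]_b `|(m1 \o ysection N) b| = 0 :> \bar R)%E.
  transitivity (\int[m1 \x m2]_p (\1_N p)%:E)%E; last by rewrite integral_indic// setIT.
  rewrite fubini_tonelli2//.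
  apply: eq_integral => b _; rewrite gee0_abs//= /fubini_G.
  transitivity (\int[m1]_s (\1_(ysection N b) s)%:E)%E.
    by rewrite integral_indic ?setIT//; exact: measurable_ysection.
  by apply: eq_integral => s _; rewrite !indicE mem_ysection.
have Hae := (ae_eq_integral_abs m2 measurableT (measurable_fun_ysection m1 mN)).1 e0.
apply: filterS Hae => b /(_ I) /= H.
exists (ysection N b); split => //; first exact: measurable_ysection.
by move=> s /= nQ; rewrite /ysection/= inE; apply: QN.
Qed.

(** * Variation of constants *)

Lemma eq_primitive_of {R : realType} n m (T : R) (p p' q' : R -> 'M[R]_(n, m)) :
  {in `[0, T]%classic, p' =1 q'} -> primitive_of T p p' -> primitive_of T p q'.
Proof.
move=> pq [ip pE]; split; first exact: eq_mx_integrable ip.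
move=> t /andP[t0 tT]; rewrite pE ?t0//; congr (_ + _); apply: eq_mx_integral => s.
rewrite inE/= in_itv/= => /andP[s0 st]; apply: pq.
by rewrite inE/= in_itv/= s0 (le_trans st).
Qed.

Lemma primitive_ofS {R : realType} n m (s T : R) (p p' : R -> 'M[R]_(n, m)) : s <= T ->
  primitive_of T p p' -> primitive_of s p p'.
Proof.
move=> sT [ip pE]; split; first exact: mx_integrableS ip.
by move=> t /andP[t0 ts]; rewrite pE// t0 (le_trans ts).
Qed.

Section flow_existence.
Context {d : measure_display} {X : measurableType d} {R : realType}.
Local Notation RT := (measurableTypeR R).
Context {n : nat} (a : R -> X -> 'M[R]_n) (M T : R).
Hypothesis ma : jmeasurable a.
Hypothesis aM : forall s x i j, `|a s x i j| <= M.

(** [psi] is the transpose of the solution of the adjoint equation, whose coefficient is minus the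
    transpose of [a]; so [psi *m Psi] has derivative zero. Obtained as a solution and not by
    inverting a matrix, it comes with the same measurability and the same bound as [Psi]. *)
Lemma flow_exists : exists (Psi psi : R -> X -> 'M[R]_n) (C : R),
  [/\ jmeasurable Psi /\ jmeasurable psi,
      forall s x i j, 0 <= s <= T -> `|Psi s x i j| <= C /\ `|psi s x i j| <= C,
      forall x, primitive_of T (Psi ^~ x) (fun s => a s x *m Psi s x),
      forall x, primitive_of T (psi ^~ x) (fun s => - (psi s x *m a s x)) &
      forall x, psi 0 x = 1%:M /\ forall t, 0 <= t <= T -> psi t x *m Psi t x = 1%:M].
Proof.
have [Psi [mPsi PsiB iPsi PsiE]] := linear_ode_solution ma aM.
pose b s x := - (a s x)^T.
have mb : jmeasurable b.
  move=> i j; rewrite (_ : (fun z => _) = (fun z : RT * X => - a z.1 z.2 j i)).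
    by apply: measurable_funN; exact: ma.
  by apply/funext => z; rewrite !mxE.
have bM s x i j : `|b s x i j| <= M by rewrite !mxE normrN.
have [psi' [mpsi psiB ipsi psiE]] := linear_ode_solution mb bM.
pose psi s x := (psi' s x)^T.
have bE s x : b s x *m psi' s x = - (psi s x *m a s x)^T.
  by rewrite /b /psi trmx_mul trmxK mulNmx.
have P1 x : primitive_of T (Psi ^~ x) (fun s => a s x *m Psi s x).
  split; first exact: iPsi.
  by move=> t _; rewrite PsiE [Psi 0 x]PsiE mx_integral0 addr0.
have P2 x : primitive_of T (psi ^~ x) (fun s => - (psi s x *m a s x)).
  split.
    move=> i j; apply: eq_integrable (ipsi T x j i) => // s _.
    by rewrite bE !mxE.
  move=> t _; rewrite /psi psiE [psi' 0 x]psiE mx_integral0 addr0 linearD/= trmx1.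
  congr (_ + _); apply/matrixP => i j; rewrite !mxE.
  apply: eq_Rintegral => s _; rewrite -/(psi s x).
  by rewrite bE !mxE.
exists Psi, psi, (2 * expR (2 * (n%:R * M + 1) * `|T|)); split => //.
- split => // i j; rewrite (_ : (fun z => _) = (fun z : RT * X => psi' z.1 z.2 j i)).
    exact: mpsi.
  by apply/funext => z; rewrite !mxE.
- move=> s x i j /andP[s0 sT].
  have M0 : 0 <= n%:R * M by rewrite mulr_ge0// (le_trans _ (aM 0 x i j)).
  have H : 2 * expR (2 * (n%:R * M + 1) * `|s|) <= 2 * expR (2 * (n%:R * M + 1) * `|T|) :> R.
    rewrite ler_wpM2l// ler_expR ler_wpM2l ?mulr_ge0 ?addr_ge0//.
    by rewrite !ger0_norm// (le_trans s0).
  split; first exact: le_trans (PsiB s x i j) H.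
  by rewrite mxE; exact: le_trans (psiB s x j i) H.
- move=> x; have psi0 : psi 0 x = 1%:M by rewrite /psi psiE mx_integral0 addr0 trmx1.
  split => // t tT.
  have [_ ->//] := primitive_of_mul (P2 x) (P1 x).
  rewrite psi0 [Psi 0 x]PsiE mx_integral0 addr0 mulmx1 -[RHS]addr0; congr (_ + _).
  apply/matrixP => i j; rewrite !mxE.
  rewrite (@eq_Rintegral _ _ _ _ _ (cst 0)) ?Rintegral_cst ?mul0r// => s _.
  by rewrite mulNmx mulmxA addNr mxE.
Qed.

End flow_existence.

Section flow_theory.
Context {R : realType} {n : nat}.
Local Notation RT := (measurableTypeR R).
Local Notation mu := (@lebesgue_measure R).
Variables (T : R) (a Psi psi : R -> 'M[R]_n).
Hypothesis hPsi : primitive_of T Psi (fun s => a s *m Psi s).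
Hypothesis hpsi : primitive_of T psi (fun s => - (psi s *m a s)).
Hypothesis psi0 : psi 0 = 1%:M.
Hypothesis psiPsi : forall t, 0 <= t <= T -> psi t *m Psi t = 1%:M.

Lemma variation_of_constants m (z f : R -> 'M[R]_(n, m)) :
  primitive_of T z (fun s => a s *m z s + f s) ->
  forall t, 0 <= t <= T -> psi t *m z t = z 0 + mx_integral `[0, t] (fun s => psi s *m f s).
Proof.
move=> hz t tT; have [_ ->//] := primitive_of_mul hpsi hz.
rewrite psi0 mul1mx; congr (_ + _); apply: eq_mx_integral => s _.
by rewrite mulNmx mulmxDr !mulmxA addKr.
Qed.

(** The converse, for initial state zero. The product rule leaves [Psi s *m psi s] in front of [f],
    which is the identity because a left inverse of a square matrix is also a right inverse. *)
Lemma variation_of_constants_solution m (f : R -> 'M[R]_(n, m)) :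
  mx_integrable `[0, T] (fun s => psi s *m f s) ->
  let z t := Psi t *m mx_integral `[0, t] (fun s => psi s *m f s) in
  primitive_of T z (fun s => a s *m z s + f s).
Proof.
move=> ipf z.
have hF : primitive_of T (fun t => mx_integral `[0, t] (fun s => psi s *m f s)) (fun s => psi s *m f s).
  by split => // t tT; rewrite mx_integral0 add0r.
apply: eq_primitive_of (primitive_of_mul hPsi hF) => s.
rewrite inE/= in_itv/= => sT; rewrite /z !mulmxA; congr (_ + _).
by rewrite (mulmx1C (psiPsi sT)) mul1mx.
Qed.

(* Here psi' = - psi a, so r |-> psi(r) phi(r, s) is constant. *)
Lemma adjoint_transition (M : R) (a0 : R -> 'M[R]_n) phi :
  mx_measurable (setT : set RT) a -> (forall s i j, `|a s i j| <= M) ->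
  mx_measurable (`[0, T]%classic : set RT) a0 ->
  {ae mu, forall s : RT, 0 <= s <= T -> a0 s = a s} ->
  transition_matrix T a0 phi ->
  forall s, 0 <= s <= T -> phi 0 s = psi s.
Proof.
move=> ma aM ma0 aE hphi s sT; have /andP[s0 s_T] := sT.
have [cphi phiE] := hphi s sT.
have ip : mx_integrable `[0, s] (fun r => phi r s).
  move=> i j; apply: continuous_compact_integrable; first exact: segment_compact.
  apply: continuous_subspaceW (cphi i j).
  by apply: subset_itvl; rewrite bnd_simp.
have iap := mx_integrable_bounded ma aM ip.
have aphiE (D : set RT) : measurable D -> D `<=` `[0, s]%classic ->
    mx_integral D (fun r => a0 r *m phi r s) = mx_integral D (fun r => a r *m phi r s).
  move=> mD Ds.
  have addr0E (c : R -> 'M[R]_n) : mx_integral D (fun r => c r *m phi r s) =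
      mx_integral D (fun r => c r *m phi r s + 0).
    by apply: eq_mx_integral => r _; rewrite addr0.
  have DT : D `<=` `[0, T]%classic.
    apply: subset_trans Ds _; apply: subset_itvl; rewrite bnd_simp//.
  rewrite !addr0E; apply: ae_eq_mx_integral => //.
  - by move=> i j; exact: measurable_funS (ma0 i j).
  - by move=> i j; exact: measurable_funTS (ma i j).
  - move=> i j; apply: (measurable_funS _ Ds) => //.
    by apply/measurable_EFinP; exact: measurable_int (ip i j).
  - apply: filterS aE => r H Dr; apply: H.
    by have := DT _ Dr; rewrite /= in_itv.
have s1 : phi s s = 1%:M.
  by rewrite phiE// lexx; apply/matrixP => i j; rewrite !mxE set_itv1 Rintegral_set1 addr0.
(* Before time [s] the transition matrix is given by an integral running backward from [s];
   comparing the equations at [t] and at 0 makes it a primitive that starts at 0. *)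
have hp : primitive_of s (phi ^~ s) (fun r => a r *m phi r s).
  split => // t /andP[t0 ts].
  have [->|tn0] := eqVneq t 0; first by rewrite mx_integral0 addr0.
  have tgt0 : 0 < t by rewrite lt_neqAle eq_sym tn0.
  have sgt0 : 0 < s by exact: lt_le_trans ts.
  suff H : phi t s = 1%:M - mx_integral `]t, s] (fun r => a r *m phi r s).
    rewrite H (phiE 0) ?lexx ?(le_trans s0)// leNgt sgt0/=.
    have ts2 : 0 <= t <= s by rewrite t0.
    rewrite aphiE// (mx_integral_itvS ts2 iap) opprD addrA.
    by rewrite [RHS]addrAC subrK.
  move: ts; rewrite le_eqVlt => /predU1P[->|ts].
    by rewrite s1; apply/matrixP => i j; rewrite !mxE set_itvoc0 Rintegral_set0 subr0.
  have tT : 0 <= t <= T by rewrite t0 (le_trans (ltW ts)).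
  have tsub : `[t, s] `<=` `[0, s]%classic by apply: subset_itvr; rewrite bnd_simp.
  have mts : measurable (`[t, s]%classic : set RT) by [].
  rewrite (phiE t tT) leNgt ts (aphiE _ mts tsub).
  congr (_ - _); apply/matrixP => i j; rewrite !mxE Rintegral_itv_obnd_cbnd//.
  apply: integrableS (iap i j) => //.
  by apply: subset_itv; rewrite bnd_simp.
have [_ H] := primitive_of_mul (primitive_ofS s_T hpsi) hp.
have := H s; rewrite s0 lexx => /(_ isT).
rewrite s1 mulmx1 psi0 mul1mx => ->; rewrite -[LHS]addr0; congr (_ + _).
apply/matrixP => i j; rewrite !mxE.
rewrite (@eq_Rintegral _ _ _ _ _ (cst 0)) ?Rintegral_cst ?mul0r// => r _.
by rewrite mulNmx mulmxA addNr mxE.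
Qed.

End flow_theory.

Section primitive_regularity.
Context {R : realType}.
Local Notation RT := (measurableTypeR R).
Local Notation mu := (@lebesgue_measure R).

Lemma primitive_of_continuous n m (T : R) (p p' : R -> 'M[R]_(n, m)) i j : 0 <= T ->
  primitive_of T p p' -> {within `[0, T], continuous (fun t => p t i j)}.
Proof.
move=> T0 [ip pE].
have cI := parameterized_integral_continuous T0 (ip i j).
pose f (t : R) : R := p 0 i j + \int[mu]_(s in `[0, t]) p' s i j.
have fp : {in `[0, T]%classic, f =1 (fun t => p t i j)}.
  by move=> t; rewrite inE/= in_itv/= => tT; rewrite (pE t tT) !mxE.
have cf : {within `[0, T], continuous f}.
  by move=> x; apply: cvgD; [exact: cvg_cst|exact: cI].
exact: (subspace_eq_continuous fp cf).
Qed.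

Lemma primitive_of_measurable n m (T : R) (p p' : R -> 'M[R]_(n, m)) : 0 <= T ->
  primitive_of T p p' -> mx_measurable (`[0, T]%classic : set RT) p.
Proof.
move=> T0 hp i j; apply: subspace_continuous_measurable_fun => //.
exact: primitive_of_continuous hp.
Qed.

Lemma primitive_of_bounded n m (T : R) (p p' : R -> 'M[R]_(n, m)) i j :
  primitive_of T p p' -> exists C, forall t, 0 <= t <= T -> `|p t i j| <= C.
Proof.
move=> [ip pE]; exists (`|p 0 i j| + \int[mu]_(s in `[0, T]) `|p' s i j|) => t /andP[t0 tT].
rewrite pE ?t0// mxE (le_trans (ler_normD _ _))// lerD2l mxE.
apply: le_trans (le_normr_Rintegral _ _) _ => //; first exact: integrable_itvS tT (ip i j).
have tT' : 0 <= t <= T by rewrite t0.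
rewrite (Rintegral_itvS tT' (integrable_norm (ip i j))) lerDl.
by apply: Rintegral_ge0 => r _; exact: normr_ge0.
Qed.

End primitive_regularity.

Section sde_shift.
Context {R : realType} {dO : measure_display} {Omega : measurableType dO}.
Variable P : probability Omega R.
Local Notation mu := (@lebesgue_measure R).
Local Notation RT := (measurableTypeR R).

(* Since the noise is additive, the difference z of the two solutions is
   deterministic. *)
Lemma sde_shift n m k (S M : R) (W : R -> Omega -> 'cV[R]_k)
    (a a' : R -> 'M[R]_n) (b : R -> 'M[R]_(n, m)) (g : R -> 'M[R]_(n, k))
    (u v : R -> 'cV[R]_m) (x0 : 'cV[R]_n) (Z : R -> Omega -> 'cV[R]_n) (z : R -> 'cV[R]_n) :
  0 <= S ->
  mx_measurable (`[0, S]%classic : set RT) a ->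
  mx_measurable (setT : set RT) a' -> (forall s i j, `|a' s i j| <= M) ->
  {ae mu, forall s : RT, 0 <= s <= S -> a s = a' s} ->
  mx_integrable `[0, S] (fun s => b s *m u s) ->
  mx_integrable `[0, S] (fun s => b s *m v s) ->
  primitive_of S z (fun s => a' s *m z s + b s *m (v s - u s)) -> z 0 = 0 ->
  sde_solution P W S a b g u x0 Z ->
  sde_solution P W S a b g v x0 (fun t w => Z t w + z t).
Proof.
move=> S0 ma ma' aM aE ibu ibv hz z0 [Zad ZL2 Zc ZE].
have mz := primitive_of_measurable S0 hz.
split.
- move=> t i V tS mV.
  (* At a fixed time [z t] is a constant, so the event concerns [Z t] alone, for a translated
     set. *)
  have := Zad t i [set x | V (x + z t i 0)] tS.
  rewrite (_ : [set w | [set x | V (x + z t i 0)] (Z t w i 0)] =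
               [set w | V ((Z t w + z t) i 0)]).
    apply; rewrite -[X in measurable X]setTI.
    have mf : measurable_fun setT (fun x : R => x + z t i 0) by exact: measurable_funD.
    exact: (mf measurableT V mV).
  by apply/seteqP; split => w /=; rewrite mxE.
- move=> i.
  have mD : measurable (`[0, S] `*` setT : set (RT * Omega)) by exact: measurableX.
  apply/Lp_on2P => //.
  have SZ : sqint (mu \x P)%E (`[0, S] `*` setT) (fun p : RT * Omega => Z p.1 p.2 i 0).
    by apply/Lp_on2P => //; exact: ZL2.
  have Sz : sqint (mu \x P)%E (`[0, S] `*` setT) (fun p : RT * Omega => z p.1 i 0).
    have mzp : measurable_fun (`[0, S] `*` setT : set (RT * Omega)) (fun p : RT * Omega => z p.1 i 0).
      pose zr := (fun s : RT => z s i 0) \_ `[0, S].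
      have mS : measurable (`[0, S]%classic : set RT) by [].
      have mzr : measurable_fun setT zr by apply/(measurable_restrictT _ mS); exact: mz.
      have H : measurable_fun (`[0, S] `*` setT : set (RT * Omega)) (zr \o fst).
        exact: measurable_funTS (measurableT_comp mzr measurable_fst).
      apply: eq_measurable_fun H => p; rewrite inE/= => -[pS _].
      by rewrite /zr patchT// inE.
    split => //.
    have [C zC] := primitive_of_bounded i 0 hz.
    apply: measurable_bounded_integrable => //.
    + exact: itv_setT_lty.
    + exact: measurable_funX.
    + exists (C ^+ 2); split; first exact: num_real.
      move=> x Cx p [/= pS _]; rewrite normrX (le_trans _ (ltW Cx))//.
      rewrite lerXn2r ?nnegrE//; last by apply: zC; rewrite in_itv in pS.
      by rewrite (le_trans _ (zC 0 _))// lexx.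
  have := sqintD mD SZ Sz; apply: eq_sqint => // p _.
  by rewrite mxE.
- apply: filterS Zc => w Zc i.
  move=> x; rewrite (_ : (fun t => _) = (fun t => Z t w i 0 + z t i 0)); last first.
    by apply/funext => t; rewrite mxE.
  apply: cvgD; first exact: Zc.
  exact: primitive_of_continuous hz x.
(* The same Ito integral serves both solutions, as [g] does not involve the control. *)
- move=> t tS; have [N [hN ZtE]] := ZE t tS; exists N; split; first exact: hN.
  have /andP[t0 t_S] := tS.
  near=> w.
  have -> : Z t w = x0 + mx_integral `[0, t] (fun s => a s *m Z s w + b s *m u s) + N w.
    by near: w.
  have Zcw : forall i, {within `[0, S], continuous (fun t => Z t w i 0)} by near: w.
  (* Continuity of the path gives integrability in time, which allows the drift of [Z + z] to be
     split. *)
  have iZ : mx_integrable `[0, t] (Z ^~ w).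
    move=> i j; rewrite (ord1 j); apply: integrable_itvS t_S _.
    apply: continuous_compact_integrable; first exact: segment_compact.
    exact: Zcw.
  have [iz' zE] := hz.
  have mt : measurable (`[0, t]%classic : set RT) by [].
  have tsub : `[0, t] `<=` `[0, S]%classic by apply: subset_itvl; rewrite bnd_simp.
  have ma_t : mx_measurable (`[0, t]%classic : set RT) a.
    by move=> i j; exact: measurable_funS (ma i j).
  have ma't : mx_measurable (`[0, t]%classic : set RT) a'.
    by move=> i j; exact: measurable_funTS (ma' i j).
  have mZ : mx_measurable (`[0, t]%classic : set RT) (Z ^~ w).
    by move=> i j; apply/measurable_EFinP; exact: measurable_int (iZ i j).
  have mz_t : mx_measurable (`[0, t]%classic : set RT) z.
    by move=> i j; exact: measurable_funS (mz i j).
  have ibut := mx_integrableS t_S ibu; have ibvt := mx_integrableS t_S ibv.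
  have mb c : mx_integrable `[0, t] c -> mx_measurable (`[0, t]%classic : set RT) (c : R -> 'cV[R]_n).
    by move=> ic i j; apply/measurable_EFinP; exact: measurable_int (ic i j).
  have aE_t : {ae mu, forall s : RT, (`[0, t]%classic : set RT) s -> a s = a' s}.
    apply: filterS aE => s H /=; rewrite in_itv/= => /andP[s0 st]; apply: H.
    by rewrite s0 (le_trans st).
  rewrite (ae_eq_mx_integral mt ma_t ma't mZ (mb _ ibut) aE_t).
  rewrite [in RHS](ae_eq_mx_integral mt ma_t ma't (mx_measurableD mZ mz_t) (mb _ ibvt) aE_t).
  rewrite (zE t tS) z0 add0r.
  have addE (x I J L y : 'cV[R]_n) : I + L = J -> x + I + y + L = x + J + y.
    by move=> <-; rewrite [LHS]addrAC !addrA.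
  apply: addE; rewrite -mx_integralD//.
  - apply: eq_mx_integral => s _; rewrite mulmxBr [in RHS]mulmxDr.
    by rewrite addrACA [b s *m u s + _]addrC subrK.
  - by apply: mx_integrableD => //; exact: mx_integrable_bounded iZ.
  - exact: mx_integrableS t_S iz'.
Unshelve. all: by end_near.
Qed.

End sde_shift.

(** * Responses to controls *)

Section essential_bound.
Context d (X : measurableType d) (R : realType) (nu : {measure set X -> \bar R}).

(** The norm at exponent +oo is an essential supremum when the space has positive measure. Otherwise
    the whole space is null and can itself be taken as the exceptional set. *)
Lemma Lp_on_y_bounded (D : set X) (f : X -> R) :
  Lp_on nu +oo%E D f -> exists M, {ae nu, forall x, `|(f \_ D) x| <= M}.
Proof.
move=> [_]; rewrite unlock; case: ifPn => [_|nu0] Hy.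
  have [M HM] := @ess_supr_bounded _ _ _ nu (fun x => `|(f \_ D) x|) Hy.
  by exists M.
exists 0; exists setT; split => //.
by apply/eqP; rewrite eq_le measure_ge0 andbT leNgt.
Qed.

Lemma Lp_mx_y_bounded n m (D : set X) (F : X -> 'M[R]_(n, m)) :
  Lp_mx nu +oo%E D F ->
  exists M, 0 <= M /\ {ae nu, forall x, D x -> forall i j, `|F x i j| <= M}.
Proof.
move=> hF.
have H i j := Lp_on_y_bounded (hF i j).
pose B i j := sval (cid (H i j)).
exists (\sum_i \sum_j `|B i j|); split.
  by apply: sumr_ge0 => i _; apply: sumr_ge0.
have HB : {ae nu, forall x, forall i j, `|((fun x => F x i j) \_ D) x| <= B i j}.
  have H1 i : {ae nu, forall x, forall j, `|((fun x => F x i j) \_ D) x| <= B i j}.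
    apply: (@filter_forall _ _ (fun j x => `|((fun x => F x i j) \_ D) x| <= B i j) (almost_everywhere nu)) => j.
    exact: svalP (cid (H i j)).
  exact: (@filter_forall _ _ (fun i x => forall j, `|((fun x => F x i j) \_ D) x| <= B i j) (almost_everywhere nu)).
apply: filterS HB => x Hx Dx i j.
have := Hx i j; rewrite patchT ?inE// => /le_trans; apply.
apply: le_trans (ler_norm _) _.
rewrite (bigD1 i)//= (bigD1 j)//= -addrA lerDl addr_ge0//.
  by apply: sumr_ge0.
by apply: sumr_ge0 => i' _; apply: sumr_ge0.
Qed.

End essential_bound.

Section coefficients.
Context d (X : measurableType d) (R : realType) (nu : {sigma_finite_measure set X -> \bar R}).
Local Notation mu := (@lebesgue_measure R).
Local Notation RT := (measurableTypeR R).
Variables (T : R) (K : set X).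
Hypothesis mK : measurable K.
Local Notation D := (`[0, T] `*` K).

Let mD : measurable (D : set (RT * X)).
Proof. exact: measurableX. Qed.

(** The extension by zero turns measurability on the rectangle into joint measurability on the whole
    product, where sections and Fubini are available. *)
Definition cutoff n m (F : R -> X -> 'M[R]_(n, m)) (s : R) (b : X) : 'M[R]_(n, m) :=
  if (s, b) \in D then F s b else 0.

Lemma cutoffE n m (F : R -> X -> 'M[R]_(n, m)) s b : 0 <= s <= T -> K b -> cutoff F s b = F s b.
Proof. by move=> sT Kb; rewrite /cutoff ifT// inE/= in_itv. Qed.

Lemma jmeasurable_cutoff n m (F : R -> X -> 'M[R]_(n, m)) :
  mx_measurable (D : set (RT * X)) (fun p => F p.1 p.2) -> jmeasurable (cutoff F).
Proof.
move=> mF i j.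
have := (measurable_restrictT _ mD).1 (mF i j).
rewrite (_ : _ \_ D = (fun z => cutoff F z.1 z.2 i j))//.
by apply/funext => -[s b]; rewrite /patch /cutoff/=; case: ifPn => _; rewrite ?mxE.
Qed.

Lemma section_measurable n m (F : R -> X -> 'M[R]_(n, m)) b :
  mx_measurable (D : set (RT * X)) (fun p => F p.1 p.2) -> K b ->
  mx_measurable (`[0, T]%classic : set RT) (F ^~ b).
Proof.
move=> mF Kb i j.
have H := jmeasurable_slice b i j (`[0, T]%classic : set RT) (jmeasurable_cutoff mF).
apply: eq_measurable_fun H => s; rewrite inE/= in_itv/= => sT.
by rewrite cutoffE.
Qed.

(* The bound on A and the identity A = A' only hold almost everywhere; A' makes
   the fundamental matrices below exist, measurably, for every b. *)
Lemma truncation n (A : R -> X -> 'M[R]_n) :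
  Lp_mx (mu \x nu)%E +oo%E (`[0, T] `*` K) (fun p => A p.1 p.2) ->
  exists (A' : R -> X -> 'M[R]_n) (M : R), [/\ jmeasurable A',
    forall s b i j, `|A' s b i j| <= M &
    {ae nu, forall b, K b -> {ae mu, forall s : RT, 0 <= s <= T -> A s b = A' s b}}].
Proof.
move=> hA; have [M [M0 AM]] := Lp_mx_y_bounded hA.
have mA : mx_measurable (D : set (RT * X)) (fun p => A p.1 p.2) by move=> i j; have [] := hA i j.
(* Entries above the essential bound are set to 0; within the rectangle this changes [A] only on a
   null set. *)
pose A' s b : 'M[R]_n := \matrix_(i, j) if `|cutoff A s b i j| <= M then cutoff A s b i j else 0.
exists A', M; split.
- move=> i j; rewrite (_ : (fun z => _) = (fun z : RT * X =>
    if `|cutoff A z.1 z.2 i j| <= M then cutoff A z.1 z.2 i j else 0)); last first.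
    by apply/funext => z; rewrite mxE.
  apply: measurable_fun_ifT.
  - apply: measurable_fun_ler => //; apply: measurableT_comp => //.
    exact: (jmeasurable_cutoff mA).
  - exact: (jmeasurable_cutoff mA).
  - exact: measurable_cst.
- by move=> s b i j; rewrite mxE; case: ifPn => //; rewrite normr0.
- have := @ae_ysection R _ _ RT X mu nu
    (fun p => D p -> forall i j, `|A p.1 p.2 i j| <= M) AM.
  apply: filterS => b Hb Kb; apply: filterS Hb => s Hs sT.
  apply/matrixP => i j; rewrite mxE cutoffE// ifT//.
  by apply: Hs => //; split => //=; rewrite in_itv.
Qed.

End coefficients.

Section sqnorm_theory.
Context {R : realType}.

Lemma sqnorm_ge0 n m (M : 'M[R]_(n, m)) : 0 <= sqnorm M.
Proof. by apply: sumr_ge0 => i _; apply: sumr_ge0 => j _; exact: sqr_ge0. Qed.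

Lemma sqnorm_entry n m (M : 'M[R]_(n, m)) i j : M i j ^+ 2 <= sqnorm M.
Proof.
rewrite /sqnorm (bigD1 i)//= (bigD1 j)//= -addrA lerDl addr_ge0//.
  by apply: sumr_ge0 => k _; exact: sqr_ge0.
by apply: sumr_ge0 => k _; apply: sumr_ge0 => l _; exact: sqr_ge0.
Qed.

Definition mx_sqint d (X : measurableType d) (nu : {measure set X -> \bar R}) n m (D : set X)
    (F : X -> 'M[R]_(n, m)) : Prop := forall i j, sqint nu D (fun x => F x i j).

Lemma mx_sqint_sqnorm d (X : measurableType d) (nu : {measure set X -> \bar R}) n m (D : set X)
    (F : X -> 'M[R]_(n, m)) : measurable D -> mx_sqint nu D F ->
  nu.-integrable D (fun x => (sqnorm (F x))%:E).
Proof.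
move=> mD SF; apply: integrable_sumR => // i; apply: integrable_sumR => // j.
by have [] := SF i j.
Qed.

Lemma mx_sqintS d (X : measurableType d) (nu : {measure set X -> \bar R}) n m (D E : set X)
    (F : X -> 'M[R]_(n, m)) : measurable D -> measurable E -> E `<=` D ->
  mx_sqint nu D F -> mx_sqint nu E F.
Proof. by move=> mD mE ED SF i j; exact: sqintS (SF i j). Qed.

Lemma mx_sqintD d (X : measurableType d) (nu : {measure set X -> \bar R}) n m (D : set X)
    (F G : X -> 'M[R]_(n, m)) : measurable D -> mx_sqint nu D F -> mx_sqint nu D G ->
  mx_sqint nu D (fun x => F x + G x).
Proof.
move=> mD SF SG i j; have := sqintD mD (SF i j) (SG i j).
by apply: eq_sqint => // x _; rewrite mxE.
Qed.

Lemma mx_sqintZ d (X : measurableType d) (nu : {measure set X -> \bar R}) n m (D : set X) (c : R)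
    (F : X -> 'M[R]_(n, m)) : measurable D -> mx_sqint nu D F ->
  mx_sqint nu D (fun x => c *: F x).
Proof.
move=> mD SF i j; have := sqintZ c mD (SF i j).
by apply: eq_sqint => // x _; rewrite mxE.
Qed.

Lemma mx_sqintB d (X : measurableType d) (nu : {measure set X -> \bar R}) n m (D : set X)
    (F G : X -> 'M[R]_(n, m)) : measurable D -> mx_sqint nu D F -> mx_sqint nu D G ->
  mx_sqint nu D (fun x => F x - G x).
Proof.
move=> mD SF SG i j; have := sqintB mD (SF i j) (SG i j).
by apply: eq_sqint => // x _; rewrite !mxE.
Qed.

Lemma mx_sqintMb d (X : measurableType d) (nu : {measure set X -> \bar R}) n m l (D : set X) (C : R)
    (P : X -> 'M[R]_(n, m)) (F : X -> 'M[R]_(m, l)) : measurable D ->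
  mx_measurable D P -> (forall x i j, D x -> `|P x i j| <= C) ->
  mx_sqint nu D F -> mx_sqint nu D (fun x => P x *m F x).
Proof.
move=> mD mP PC SF i j.
have H : sqint nu D (fun x => \sum_k P x i k * F x k j).
  apply: sqint_sum => // k; apply: (@sqintZb _ _ _ _ _ _ (fun x => P x i k) C) => //.
  by move=> x Dx; exact: PC.
by apply: eq_sqint H => // x _; rewrite mxE.
Qed.

Local Notation mu := (@lebesgue_measure R).
Local Notation RT := (measurableTypeR R).

(** Cauchy-Schwarz for each product of an entry of [B] and an entry of [c]. An entry of the integral
    is a sum of n m such terms weighted by at most [C], and the outer factor [n%:R] counts the
    entries. *)
Lemma integral_bilinear_bound n m (E : set RT) (C : R) (p : R -> 'M[R]_n)
    (B : R -> 'M[R]_(n, m)) (c : R -> 'cV[R]_m) :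
  measurable E -> mx_measurable E p -> (forall s i j, E s -> `|p s i j| <= C) ->
  mx_sqint mu E B -> mx_sqint mu E c ->
  mx_integrable E (fun s => p s *m B s *m c s) /\
  sqnorm (mx_integral E (fun s => p s *m B s *m c s)) <=
  n%:R * (n%:R * m%:R * C) ^+ 2 *
  (\int[mu]_(s in E) sqnorm (B s)) * (\int[mu]_(s in E) sqnorm (c s)).
Proof.
move=> mE mp pC SB Sc.
set b2 := \int[mu]_(s in E) sqnorm (B s); set c2 := \int[mu]_(s in E) sqnorm (c s).
have b20 : 0 <= b2 by apply: Rintegral_ge0 => s _; exact: sqnorm_ge0.
have c20 : 0 <= c2 by apply: Rintegral_ge0 => s _; exact: sqnorm_ge0.
have SpB := mx_sqintMb mE mp pC SB.
have ie i : mu.-integrable E (fun s => ((p s *m B s *m c s) i 0)%:E).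
  have H : mu.-integrable E (fun s => (\sum_l (p s *m B s) i l * c s l 0)%:E).
    by apply: integrable_sumR => // l; exact: sqint_integrableM.
  by apply: eq_integrable H => // s _; rewrite [in RHS]mxE.
have habs j l : sqint mu E (fun s => `|B s j l|) /\ sqint mu E (fun s => `|c s l 0|).
  have [mB iB] := SB j l; have [mc ic] := Sc l 0.
  split; split; try exact: measurableT_comp.
    by apply: eq_integrable iB => // s _; rewrite real_normK ?num_real.
  by apply: eq_integrable ic => // s _; rewrite real_normK ?num_real.
have iBc j l : mu.-integrable E (fun s => (`|B s j l| * `|c s l 0|)%:E).
  by have [h1 h2] := habs j l; exact: sqint_integrableM.
have CS j l : \int[mu]_(s in E) (`|B s j l| * `|c s l 0|) <= Num.sqrt (b2 * c2).
  have [h1 h2] := habs j l.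
  rewrite -[leLHS]ger0_norm; last by apply: Rintegral_ge0 => s _; rewrite mulr_ge0.
  rewrite -sqrtr_sqr ler_wsqrtr// (le_trans (Cauchy_Schwarz mE h1 h2))//.
  have [_ i1] := h1; have [_ i2] := h2.
  apply: ler_pM; try by apply: Rintegral_ge0 => s _; exact: sqr_ge0.
  - apply: le_Rintegral => //; first exact: mx_sqint_sqnorm.
    by move=> s _; rewrite real_normK ?num_real//; exact: sqnorm_entry.
  - apply: le_Rintegral => //; first exact: mx_sqint_sqnorm.
    by move=> s _; rewrite real_normK ?num_real//; exact: sqnorm_entry.
split; first by move=> i j; rewrite (ord1 j); exact: ie.
(* The sign of [C] is known only through a point of [E], so the empty set is treated apart. *)
have [E0|/set0P[s0 Es0]] := eqVneq E set0.
  rewrite [leLHS](_ : _ = 0); first by do 2 apply: mulr_ge0 => //; apply: mulr_ge0 => //; exact: sqr_ge0.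
  apply: big1 => i _; apply: big1 => j _.
  by rewrite mxE E0 Rintegral_set0 expr0n.
have be i : `|\int[mu]_(s in E) (p s *m B s *m c s) i 0| <= n%:R * m%:R * C * Num.sqrt (b2 * c2).
  have C0 : 0 <= C by exact: le_trans (pC s0 i i Es0).
  have iS : mu.-integrable E (fun s => (\sum_j \sum_l (C * (`|B s j l| * `|c s l 0|)))%:E).
    apply: integrable_sumR => // j; apply: integrable_sumR => // l.
    exact: (integrableZR C mE (iBc j l)).
  apply: le_trans (le_normr_Rintegral mE (ie i)) _.
  apply: (@le_trans _ _ (\int[mu]_(s in E) (\sum_j \sum_l (C * (`|B s j l| * `|c s l 0|))))).
    apply: le_Rintegral => //; first exact: integrable_norm (ie i).
    move=> s Es; rewrite mxE (le_trans (ler_norm_sum _ _ _))// exchange_big/=.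
    apply: ler_sum => l _; rewrite normrM mxE.
    under eq_bigr do rewrite mulrA.
    rewrite -mulr_suml ler_wpM2r// (le_trans (ler_norm_sum _ _ _))//.
    by apply: ler_sum => j _; rewrite normrM ler_wpM2r// pC.
  rewrite Rintegral_sum//; last first.
    by move=> j; apply: integrable_sumR => // l; exact: (integrableZR C mE (iBc j l)).
  apply: (@le_trans _ _ (\sum_(j < n) \sum_(l < m) C * Num.sqrt (b2 * c2))).
    apply: ler_sum => j _; rewrite Rintegral_sum//; last first.
      by move=> l; exact: (integrableZR C mE (iBc j l)).
    apply: ler_sum => l _; rewrite (RintegralZl _ mE (iBc j l)).
    by rewrite ler_wpM2l.
  by rewrite sumr_const card_ord sumr_const card_ord -[leLHS]mulr_natl -[X in _ * X]mulr_natl !mulrA.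
rewrite /sqnorm; under eq_bigr do rewrite big_ord1 mxE.
apply: (@le_trans _ _ (\sum_(i < n) (n%:R * m%:R * C * Num.sqrt (b2 * c2)) ^+ 2)).
  apply: ler_sum => i _; rewrite -[leLHS]ger0_norm ?sqr_ge0// normrX.
  by rewrite lerXn2r ?nnegrE//; exact: le_trans (be i).
rewrite sumr_const card_ord -[leLHS]mulr_natl exprMn sqr_sqrtr ?mulr_ge0//.
by rewrite !mulrA.
Qed.

End sqnorm_theory.

(** * Responses to controls as functions of the parameter *)

Section parametric_integral.
Context d (X : measurableType d) (R : realType) (nu : {sigma_finite_measure set X -> \bar R}).
Local Notation mu := (@lebesgue_measure R).
Local Notation RT := (measurableTypeR R).

Lemma measurable_Rintegral_slice (E : set RT) (F : RT * X -> R) : measurable E ->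
  measurable_fun setT F -> measurable_fun setT (fun b => \int[mu]_(s in E) F (s, b)).
Proof.
move=> mE mF.
pose G (z : X * RT) : R := F (z.2, z.1) * \1_E z.2.
rewrite (_ : (fun b => _) = (fun b => \int[mu]_s G (b, s))).
  apply: measurable_Rintegral_param; apply: measurable_funM.
    have ms : measurable_fun setT (fun z : X * RT => (z.2, z.1)) by exact: measurable_swap.
    exact: (measurableT_comp mF ms).
  have mi : measurable_fun setT (\1_E : RT -> R) by exact: measurable_indic.
  exact: (measurableT_comp mi measurable_snd).
apply/funext => b; rewrite [LHS]Rintegral_mkcond; apply: eq_Rintegral => s _.
by rewrite /patch /G indicE/=; case: (_ \in _); rewrite ?mulr1 ?mulr0.
Qed.

Context {n m : nat} (B : R -> X -> 'M[R]_(n, m)).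
Hypothesis mB : jmeasurable B.
Hypothesis iB : forall i j, (mu \x nu)%E.-integrable setT (fun z : RT * X => (B z.1 z.2 i j ^+ 2)%:E).

(** [energy] and [power] are the two partial integrals of the squared norm of [B]. Fubini links
    them: a bound for each [b] in terms of [energy] becomes, after integration over [b], one in
    terms of time alone. *)
Definition energy (E : set R) (b : X) : R := \int[mu]_(s in E) sqnorm (B s b).
Definition power (s : R) : R := \int[nu]_b sqnorm (B s b).

Let iBs : (mu \x nu)%E.-integrable setT (EFin \o (fun z : RT * X => sqnorm (B z.1 z.2))).
Proof. by apply: integrable_sumR => // i; apply: integrable_sumR => // j; exact: iB. Qed.

Lemma power_integrable : mu.-integrable setT (EFin \o power).
Proof. by have [_ _] := Fubini_fine iBs. Qed.

Lemma energy_integral (E : set RT) : measurable E ->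
  nu.-integrable setT (EFin \o energy E) /\
  \int[nu]_b energy E b = \int[mu]_(s in E) power s.
Proof.
move=> mE.
pose G (z : RT * X) := \1_E z.1 * sqnorm (B z.1 z.2).
have iG : (mu \x nu)%E.-integrable setT (EFin \o G).
  have /measurable_EFinP mBs := measurable_int _ iBs.
  apply: le_integrable iBs => //.
    apply/measurable_EFinP; apply: measurable_funM => //.
    have mi : measurable_fun setT (\1_E : RT -> R) by exact: measurable_indic.
    exact: (measurableT_comp mi measurable_fst).
  move=> z _; rewrite /= lee_fin normrM ler_piMl// indicE.
  by case: (_ \in _); rewrite ?normr1 ?normr0.
have eE b : energy E b = \int[mu]_s G (s, b).
  rewrite /energy [LHS]Rintegral_mkcond; apply: eq_Rintegral => s _.
  by rewrite /patch /G indicE/=; case: (_ \in _); rewrite ?mul1r ?mul0r.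
split.
  have [_ _ H] := @Fubini_fine _ _ _ _ _ nu mu (fun z => G (z.2, z.1)) (integrable_swap iG).
  by apply: eq_integrable H => // b _; rewrite /= eE.
transitivity (\int[nu]_b \int[mu]_s G (s, b)).
  by apply: eq_Rintegral => b _; rewrite eE.
rewrite -(Fubini_Rintegral iG) [RHS]Rintegral_mkcond; apply: eq_Rintegral => s _.
rewrite /patch /G/= indicE; case: (_ \in _).
  by apply: eq_Rintegral => b _; rewrite mul1r.
by rewrite (@eq_Rintegral _ _ _ _ _ (cst 0)) ?Rintegral_cst ?mul0r// => b _; rewrite mul0r.
Qed.

Lemma ae_section_sqint : {ae nu, forall b, mx_sqint mu (setT : set RT) (B ^~ b)}.
Proof.
have H i j : {ae nu, forall b, sqint mu (setT : set RT) (fun s => B s b i j)}.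
  have := @ae_integrable2 _ _ _ _ _ mu nu _ (iB i j).
  apply: filterS => b ib; split => //.
  exact: (jmeasurable_slice b i j (setT : set RT) mB).
have H1 i : {ae nu, forall b, forall j, sqint mu (setT : set RT) (fun s => B s b i j)}.
  exact: (@filter_forall _ _ (fun j b => sqint mu (setT : set RT) (fun s => B s b i j)) (almost_everywhere nu)).
exact: (@filter_forall _ _ (fun i b => forall j, sqint mu (setT : set RT) (fun s => B s b i j)) (almost_everywhere nu)).
Qed.

Context (p : R -> X -> 'M[R]_n) (C T : R).
Hypothesis mp : jmeasurable p.
Hypothesis pC : forall s b i j, 0 <= s <= T -> `|p s b i j| <= C.

(** With the inverse flow for [p], this is the effect of applying [c] during [E], pulled back to
    time 0: the mean at time [t] is the flow applied to the initial state plus the response on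
    [[0, t]]. *)
Definition response (E : set R) (c : R -> 'cV[R]_m) (b : X) : 'cV[R]_n :=
  mx_integral E (fun s => p s b *m B s b *m c s).

(** The sections of [B] are square integrable only for almost every [b], yet the real integral is
    defined and measurable in [b] throughout. *)
Lemma response_measurable (E : set RT) c : measurable E ->
  mx_measurable (setT : set RT) c -> mx_measurable setT (response E c).
Proof.
move=> mE mc i j.
rewrite (_ : (fun b => _) = (fun b => \int[mu]_(s in E) (p s b *m B s b *m c s) i j)).
  apply: (measurable_Rintegral_slice mE (F := fun z => (p z.1 z.2 *m B z.1 z.2 *m c z.1) i j)).
  apply: (jmeasurable_mulmx (F := fun s b => p s b *m B s b) (G := fun s _ => c s)).
    exact: jmeasurable_mulmx.
  by move=> k l; exact: (measurableT_comp (mc k l) measurable_fst).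
by apply/funext => b; rewrite mxE.
Qed.

Definition response_cst : R := n%:R * (n%:R * m%:R * C) ^+ 2.

Lemma response_cst_ge0 : 0 <= response_cst.
Proof. by rewrite mulr_ge0// sqr_ge0. Qed.

Lemma response_bound (E : set RT) c b : measurable E -> E `<=` `[0, T]%classic ->
  mx_sqint mu (setT : set RT) (B ^~ b) -> mx_sqint mu (setT : set RT) c ->
  mx_integrable E (fun s => p s b *m B s b *m c s) /\
  sqnorm (response E c b) <= response_cst * energy E b * \int[mu]_(s in E) sqnorm (c s).
Proof.
move=> mE ET SB Sc; apply: integral_bilinear_bound => //.
- by move=> i j; exact: (jmeasurable_slice b i j E mp).
- by move=> s i j /ET; rewrite /= in_itv/= => sT; exact: pC.
- exact: mx_sqintS SB.
- exact: mx_sqintS Sc.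
Qed.

(** The bound at fixed [b] holds almost everywhere and is integrated over [b]. On a short interval
    both integrals over [E] are small, so the response is of second order in the mean square. *)
Lemma response_sqint (K : set X) (E : set RT) c : measurable K -> measurable E ->
  E `<=` `[0, T]%classic -> mx_sqint mu (setT : set RT) c ->
  mx_sqint nu K (response E c) /\
  \int[nu]_(b in K) sqnorm (response E c b) <=
  response_cst * (\int[mu]_(s in E) power s) * \int[mu]_(s in E) sqnorm (c s).
Proof.
move=> mK mE ET Sc.
have mc : mx_measurable (setT : set RT) c by move=> i j; have [] := Sc i j.
have mr := response_measurable mE mc.
set q := \int[mu]_(s in E) sqnorm (c s).
have q0 : 0 <= q by apply: Rintegral_ge0 => s _; exact: sqnorm_ge0.
have [ie eE] := energy_integral mE.
have ieq : nu.-integrable setT (fun b => (response_cst * q * energy E b)%:E).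
  exact: (integrableZR (response_cst * q) measurableT ie).
have e0 b : 0 <= energy E b by apply: Rintegral_ge0 => s _; exact: sqnorm_ge0.
have aeb : {ae nu, forall b, sqnorm (response E c b) <= response_cst * q * energy E b}.
  apply: filterS ae_section_sqint => b SB.
  have [_] := response_bound mE ET SB Sc.
  by rewrite -mulrA [_ * q]mulrC mulrA.
have msq : measurable_fun setT (fun b => sqnorm (response E c b)).
  apply: measurable_sum => i; apply: measurable_sum => j.
  by apply: measurable_funX; exact: mr.
have isq : nu.-integrable setT (fun b => (sqnorm (response E c b))%:E).
  apply/integrableP; split; first exact/measurable_EFinP.
  have /integrableP[_] := ieq; apply: le_lt_trans.
  apply: ae_ge0_le_integral => //.
  - by apply: measurableT_comp => //; exact/measurable_EFinP.
  - by apply: measurableT_comp => //; exact: measurable_int ieq.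
  - apply: filterS aeb => b H _; rewrite /= lee_fin !ger0_norm ?sqnorm_ge0//.
    by rewrite mulr_ge0// mulr_ge0// response_cst_ge0.
split.
  move=> i j; split; first exact: measurable_funTS (mr i j).
  apply: le_integrable (integrableS measurableT mK (@subsetT _ _) isq) => //.
    by apply/measurable_EFinP; apply: measurable_funX; exact: measurable_funTS (mr i j).
  move=> b _; rewrite /= lee_fin !ger0_norm ?sqr_ge0 ?sqnorm_ge0//.
  exact: sqnorm_entry.
apply: (@le_trans _ _ (\int[nu]_b sqnorm (response E c b))).
  rewrite Rintegral_mkcond; apply: le_Rintegral => //.
  - rewrite -restrict_EFin; apply/(integrable_mkcond _ mK).
    exact: integrableS isq.
  - by move=> b _; rewrite /patch; case: ifPn => // _; exact: sqnorm_ge0.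
apply: (@le_trans _ _ (\int[nu]_b (response_cst * q * energy E b))).
  rewrite -lee_fin /Rintegral !fineK; [|exact: integrable_fin_num..].
  apply: ae_ge0_le_integral => //.
  - by move=> b _; rewrite lee_fin sqnorm_ge0.
  - exact/measurable_EFinP.
  - by move=> b _; rewrite lee_fin mulr_ge0// mulr_ge0// response_cst_ge0.
  - exact: measurable_int ieq.
  - by apply: filterS aeb => b H _; rewrite lee_fin.
by rewrite (RintegralZl _ measurableT ie) eE -mulrA [q * _]mulrC mulrA.
Qed.

End parametric_integral.

(** * Summing an inequality with second-order error over a partition *)

Section partition.
Context {R : realType}.

(* With t - s small, the error term kappa (p t - p s) (q t - q s) is at most
   eta kappa (q t - q s), which sums to eta kappa (q T - q 0). *)
Lemma partition_le (T kappa : R) (L p q : R -> R) : 0 < T -> 0 <= kappa ->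
  (forall s t, 0 <= s <= t -> t <= T ->
     q s <= q t /\ 0 <= L t - L s + kappa * (p t - p s) * (q t - q s)) ->
  (forall eta, 0 < eta -> exists2 del, 0 < del &
     forall s t, 0 <= s <= t -> t <= T -> t - s < del -> p t - p s <= eta) ->
  L 0 <= L T.
Proof.
move=> T0 k0 inc cp.
have q0T : 0 <= q T - q 0.
  by rewrite subr_ge0; have [|//|//] := inc 0 T; rewrite lexx ltW.
apply/ler_addgt0Pr => e e0.
(* The errors sum to at most [kappa * (e / r) * (q T - q 0)]; this [r] brings that below [e], and
   the added 1 makes it a positive divisor. *)
pose r := kappa * (q T - q 0) + 1.
have r0 : 0 < r by rewrite ltr_wpDl// mulr_ge0.
have [del del0 Hdel] := cp (e / r) (divr_gt0 e0 r0).
(* Enough equal steps for each of them to be shorter than [del]. *)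
pose N := (Num.truncn (T / del)).+1.
have N0 : 0 < N%:R :> R by rewrite ltr0n.
have TN : T / N%:R < del.
  by rewrite ltr_pdivrMr// mulrC -ltr_pdivrMr// truncnS_gt.
pose t i := i%:R * (T / N%:R).
have tS i : t i.+1 - t i = T / N%:R by rewrite /t -addn1 natrD mulrDl mul1r addrAC subrr add0r.
have h0 : 0 < T / N%:R by exact: divr_gt0.
have tN : t N = T by rewrite /t mulrC divfK// gt_eqF.
have key i : (i <= N)%N -> L 0 <= L (t i) + kappa * (e / r) * (q (t i) - q 0).
  elim: i => [_|i IH iN]; first by rewrite /t mul0r subrr mulr0 addr0.
  have ti0 : 0 <= t i by rewrite mulr_ge0// ltW.
  have tiS : t i <= t i.+1 by rewrite -subr_ge0 tS ltW.
  have tST : t i.+1 <= T by rewrite -[leRHS]tN ler_wpM2r ?ler_nat// ltW.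
  have st : 0 <= t i <= t i.+1 by rewrite ti0.
  have [qi Li] := inc _ _ st tST.
  have pi : p (t i.+1) - p (t i) <= e / r by apply: Hdel => //; rewrite tS.
  have := IH (ltnW iN).
  have : kappa * (p (t i.+1) - p (t i)) * (q (t i.+1) - q (t i)) <=
      kappa * (e / r) * (q (t i.+1) - q (t i)).
    by rewrite ler_wpM2r ?subr_ge0// ler_wpM2l.
  move: Li; set x := kappa * (p _ - _) * _; set y := kappa * (e / r).
  rewrite !mulrBr; set y1 := y * q (t i.+1); set y2 := y * q (t i); set y3 := y * q 0.
  set L1 := L (t i.+1); set L2 := L (t i); set L3 := L 0; lra.
have := key N (leqnn _); rewrite tN => /le_trans; apply.
rewrite lerD2l mulrAC mulrCA ger_pMr// ler_pdivrMr// mul1r /r.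
by rewrite lerDl.
Qed.

End partition.

(** * The inner product of L_2(K) *)

Section inner_product.
Context {R : realType}.

Definition dot n (x y : 'cV[R]_n) : R := (x^T *m y) 0 0.

Lemma dotE n (x y : 'cV[R]_n) : dot x y = \sum_i x i 0 * y i 0.
Proof. by rewrite /dot mxE; apply: eq_bigr => i _; rewrite mxE. Qed.

Lemma sqnormE n (x : 'cV[R]_n) : sqnorm x = \sum_i x i 0 ^+ 2.
Proof. by apply: eq_bigr => i _; rewrite big_ord1. Qed.

Lemma dotxx n (x : 'cV[R]_n) : dot x x = sqnorm x.
Proof. by rewrite dotE sqnormE; apply: eq_bigr => i _; rewrite expr2. Qed.

Lemma dotDr n (x y z : 'cV[R]_n) : dot x (y + z) = dot x y + dot x z.
Proof. by rewrite /dot mulmxDr mxE. Qed.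

Lemma dotZr n a (x y : 'cV[R]_n) : dot x (a *: y) = a * dot x y.
Proof. by rewrite /dot -scalemxAr mxE. Qed.

Lemma dot_mulmxr n (x y : 'cV[R]_n) (Q : 'M[R]_n) : dot x (Q *m y) = dot (Q^T *m x) y.
Proof. by rewrite /dot trmx_mul trmxK mulmxA. Qed.

Lemma sqnormD n (x y : 'cV[R]_n) : sqnorm (x + y) = sqnorm x + 2 * dot x y + sqnorm y.
Proof.
rewrite !sqnormE dotE mulr_sumr -!big_split/=; apply: eq_bigr => i _.
by rewrite mxE; ring.
Qed.

Lemma sqnormN n (x : 'cV[R]_n) : sqnorm (- x) = sqnorm x.
Proof. by rewrite !sqnormE; apply: eq_bigr => i _; rewrite mxE sqrrN. Qed.

Lemma dot_le n (x y : 'cV[R]_n) : 2 * dot x y <= sqnorm x + sqnorm y.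
Proof.
have := sqnorm_ge0 (x - y); rewrite sqnormD sqnormN -scaleN1r dotZr.
set a := dot x y; set b := sqnorm x; set c := sqnorm y; lra.
Qed.

Lemma sqnormD_le n (x y : 'cV[R]_n) : sqnorm (x + y) <= 2 * (sqnorm x + sqnorm y).
Proof.
rewrite sqnormD; have := dot_le x y.
set a := dot x y; set b := sqnorm x; set c := sqnorm y; lra.
Qed.

Lemma sqnorm_eq0 n (x : 'cV[R]_n) : sqnorm x = 0 -> x = 0.
Proof.
move=> x0; apply/matrixP => i j; rewrite mxE; apply/eqP.
by rewrite -sqrf_eq0 eq_le sqr_ge0 andbT -x0 sqnorm_entry.
Qed.

(** A coordinate of [x] is at most its Euclidean norm, so each of the [n] entries of the product is
    at most [n%:R * C] times that norm. *)
Lemma sqnorm_mulmx n (Q : 'M[R]_n) (x : 'cV[R]_n) C : (forall i j, `|Q i j| <= C) ->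
  sqnorm (Q *m x) <= n%:R * (n%:R * C) ^+ 2 * sqnorm x.
Proof.
move=> QC; rewrite sqnormE.
apply: (@le_trans _ _ (\sum_(i < n) (n%:R * C) ^+ 2 * sqnorm x)); last first.
  by rewrite sumr_const card_ord -[leLHS]mulr_natl mulrA.
apply: ler_sum => i _.
have C0 : 0 <= C by exact: le_trans (QC i i).
rewrite -(sqr_sqrtr (sqnorm_ge0 x)) -exprMn -[leLHS]ger0_norm ?sqr_ge0// normrX.
rewrite lerXn2r ?nnegrE ?mulr_ge0 ?sqrtr_ge0//.
rewrite mxE (le_trans (ler_norm_sum _ _ _))//.
apply: (@le_trans _ _ (\sum_(j < n) C * Num.sqrt (sqnorm x))); last first.
  by rewrite sumr_const card_ord -[leLHS]mulr_natl mulrA.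
apply: ler_sum => j _; rewrite normrM; apply: ler_pM => //.
by rewrite -sqrtr_sqr ler_wsqrtr// sqnorm_entry.
Qed.

Context d (X : measurableType d) (nu : {measure set X -> \bar R}) (K : set X).
Hypothesis mK : measurable K.
Context {n : nat}.
Implicit Types p q r : X -> 'cV[R]_n.

Lemma dot_integrable p q : mx_sqint nu K p -> mx_sqint nu K q ->
  nu.-integrable K (fun b => (dot (p b) (q b))%:E).
Proof.
move=> Sp Sq.
have H : nu.-integrable K (fun b => (\sum_i p b i 0 * q b i 0)%:E).
  by apply: integrable_sumR => // i; exact: sqint_integrableM.
by apply: eq_integrable H => // b _; rewrite dotE.
Qed.

Definition inner p q : R := \int[nu]_(b in K) dot (p b) (q b).

Lemma innerDr p q r : mx_sqint nu K p -> mx_sqint nu K q -> mx_sqint nu K r ->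
  inner p (fun b => q b + r b) = inner p q + inner p r.
Proof.
move=> Sp Sq Sr.
rewrite -(RintegralD mK (dot_integrable Sp Sq) (dot_integrable Sp Sr)).
by apply: eq_Rintegral => b _; rewrite dotDr.
Qed.

Lemma innerZr p q (a : R) : mx_sqint nu K p -> mx_sqint nu K q ->
  inner p (fun b => a *: q b) = a * inner p q.
Proof.
move=> Sp Sq; rewrite -(RintegralZl a mK (dot_integrable Sp Sq)).
by apply: eq_Rintegral => b _; rewrite dotZr.
Qed.

Lemma ae_eq_Rintegral (f g : X -> R) : measurable_fun K f -> measurable_fun K g ->
  {ae nu, forall b, K b -> f b = g b} ->
  \int[nu]_(b in K) f b = \int[nu]_(b in K) g b.
Proof.
move=> mf mg fg; rewrite /Rintegral; congr fine; apply: ae_eq_integral => //.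
- exact/measurable_EFinP.
- exact/measurable_EFinP.
- by apply: filterS fg => b H Kb; rewrite H.
Qed.

Lemma ae_eq_inner p q r : mx_sqint nu K p -> mx_sqint nu K q -> mx_sqint nu K r ->
  {ae nu, forall b, K b -> q b = r b} -> inner p q = inner p r.
Proof.
move=> Sp Sq Sr qr; apply: ae_eq_Rintegral.
- by apply/measurable_EFinP; exact: measurable_int (dot_integrable Sp Sq).
- by apply/measurable_EFinP; exact: measurable_int (dot_integrable Sp Sr).
- by apply: filterS qr => b H Kb; rewrite H.
Qed.

Lemma inner_sqnormD p q : mx_sqint nu K p -> mx_sqint nu K q ->
  \int[nu]_(b in K) sqnorm (p b + q b) =
  \int[nu]_(b in K) sqnorm (p b) + 2 * inner p q + \int[nu]_(b in K) sqnorm (q b).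
Proof.
move=> Sp Sq.
have ip := mx_sqint_sqnorm mK Sp; have iq := mx_sqint_sqnorm mK Sq.
have ipq := dot_integrable Sp Sq.
have i2 := integrableZR 2 mK ipq.
rewrite -(RintegralZl 2 mK ipq) -(RintegralD mK ip i2).
rewrite -(RintegralD mK (integrableDR mK ip i2) iq).
by apply: eq_Rintegral => b _; rewrite sqnormD.
Qed.

Lemma inner_le p q : mx_sqint nu K p -> mx_sqint nu K q ->
  2 * inner p q <= \int[nu]_(b in K) sqnorm (p b) + \int[nu]_(b in K) sqnorm (q b).
Proof.
move=> Sp Sq.
have ip := mx_sqint_sqnorm mK Sp; have iq := mx_sqint_sqnorm mK Sq.
have ipq := dot_integrable Sp Sq.
rewrite -(RintegralZl 2 mK ipq) -(RintegralD mK ip iq).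
apply: le_Rintegral => //; first exact: (integrableZR 2 mK ipq).
  exact: integrableDR.
by move=> b _; exact: dot_le.
Qed.

End inner_product.

(** * The minimizing control *)

Section steering.
Context {R : realType} {d n m k : nat} {dO : measure_display} {Omega : measurableType dO}.
Variable P : probability Omega R.
Local Notation mu := (@lebesgue_measure R).
Local Notation RT := (measurableTypeR R).
Local Notation Rd := (d.-tuple RT).
Local Notation nu := (@lebesgue_tuple R d).
Variables (T : R) (K : set Rd).
Hypotheses (hT : 0 < T) (mK : measurable K).
Variables (A : R -> Rd -> 'M[R]_n) (B : R -> Rd -> 'M[R]_(n, m)) (G : R -> Rd -> 'M[R]_(n, k)).
Variables (W : R -> Omega -> 'cV[R]_k).
Hypothesis hW : brownian_motion P T W.
Hypothesis mA : mx_measurable (`[0, T] `*` K : set (RT * Rd)) (fun p => A p.1 p.2).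
Hypothesis hB : Lp_mx (mu \x nu)%E 2%:E (`[0, T] `*` K) (fun p => B p.1 p.2).
Variables (A' : R -> Rd -> 'M[R]_n) (M : R).
Hypothesis mA' : jmeasurable A'.
Hypothesis A'M : forall s b i j, `|A' s b i j| <= M.
Hypothesis AA' : {ae nu, forall b, K b -> {ae mu, forall s : RT, 0 <= s <= T -> A s b = A' s b}}.
Variables (Psi psi : R -> Rd -> 'M[R]_n) (C : R).
Hypotheses (mPsi : jmeasurable Psi) (mpsi : jmeasurable psi).
Hypothesis flowC : forall s b i j, 0 <= s <= T -> `|Psi s b i j| <= C /\ `|psi s b i j| <= C.
Hypothesis hPsi : forall b, primitive_of T (Psi ^~ b) (fun s => A' s b *m Psi s b).
Hypothesis hpsi : forall b, primitive_of T (psi ^~ b) (fun s => - (psi s b *m A' s b)).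
Hypothesis psiPsi : forall b, psi 0 b = 1%:M /\ forall t, 0 <= t <= T -> psi t b *m Psi t b = 1%:M.

Local Notation B' := (cutoff T K B).

Lemma mB : mx_measurable (`[0, T] `*` K : set (RT * Rd)) (fun p => B p.1 p.2).
Proof. by move=> i j; have [] := hB i j. Qed.

Lemma jmeasurable_B' : jmeasurable B'.
Proof. exact: jmeasurable_cutoff mB. Qed.

Lemma sqint_B' i j : (mu \x nu)%E.-integrable setT (fun z : RT * Rd => (B' z.1 z.2 i j ^+ 2)%:E).
Proof.
have mD : measurable (`[0, T] `*` K : set (RT * Rd)) by exact: measurableX.
have [_ i2] := (Lp_on2P _ _ mD).1 (hB i j).
have := (integrable_mkcond _ mD).1 i2; apply: eq_integrable => // -[s b] _.
rewrite /patch /cutoff/=; case: ifPn => _ //.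
by rewrite mxE expr0n.
Qed.

(** The parameters at which the arguments for a fixed [b] can be carried out. *)
Definition regular (b : Rd) : Prop :=
  K b -> {ae mu, forall s : RT, 0 <= s <= T -> A s b = A' s b} /\
         mx_sqint mu (setT : set RT) (B' ^~ b).

Lemma ae_regular : {ae nu, forall b, regular b}.
Proof.
near=> b => Kb; split; first by move: Kb; near: b.
near: b.
exact: (ae_section_sqint jmeasurable_B' sqint_B').
Unshelve. all: by end_near. Qed.

Lemma HT_sqint S (v : R -> 'cV[R]_m) : HT S v -> mx_sqint mu (`[0, S]%classic : set RT) v.
Proof.
move=> hv i j; have mS : measurable (`[0, S]%classic : set RT) by [].
exact: (Lp_on2P _ _ mS).1 (hv i j).
Qed.

Lemma HK_sqint l (p : Rd -> 'cV[R]_l) : HK K p <-> mx_sqint nu K p.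
Proof.
by split=> hp i j; [apply/(Lp_on2P _ _ mK)|apply/(Lp_on2P nu _ mK)]; exact: hp.
Qed.

Lemma forcing_integrable S (v : R -> 'cV[R]_m) b : S <= T -> regular b -> K b ->
  mx_sqint mu (`[0, S]%classic : set RT) v ->
  mx_integrable `[0, S] (fun s => B s b *m v s).
Proof.
move=> ST reg Kb Sv; have [_ SB] := reg Kb.
have mS : measurable (`[0, S]%classic : set RT) by [].
have SB' := mx_sqintS measurableT mS (@subsetT _ _) SB.
have H : mx_integrable `[0, S] (fun s => B' s b *m v s).
  move=> i j; have H : mu.-integrable (`[0, S]%classic : set RT) (fun s => (\sum_l B' s b i l * v s l j)%:E).
    by apply: integrable_sumR => // l; exact: sqint_integrableM.
  by apply: eq_integrable H => // s _; rewrite mxE.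
apply: eq_mx_integrable H => // s; rewrite inE/= in_itv/= => /andP[s0 sS].
by rewrite cutoffE// s0 (le_trans sS).
Qed.

(** [sde_mean] gives a linear equation for the mean, and multiplication by [psi] integrates it. The
    exceptional set of parameters does not depend on [t]. *)
Lemma mean_state S (v : R -> 'cV[R]_m) X0 (Y : R -> Rd -> Omega -> 'cV[R]_n) : 0 < S <= T -> HT S v ->
  ensemble_solution P W K A B G S v X0 Y ->
  {ae nu, forall b, K b -> forall t, 0 <= t <= S ->
    (forall i, P.-integrable setT (fun w => (Y t b w i 0)%:E)) /\
    psi t b *m mean P Y t b = X0 b + mx_integral `[0, t] (fun s => psi s b *m B' s b *m v s)}.
Proof.
move=> /andP[S0 ST] hv [hsol _]; have Sv := HT_sqint hv.
near=> b => Kb t tS.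
have reg : regular b by near: b; exact: ae_regular.
have hs : sde_solution P W S (A ^~ b) (B ^~ b) (G ^~ b) v (X0 b) (Y ^~ b).
  by move: Kb; near: b.
have [aE _] := reg Kb.
have mAb : mx_measurable (`[0, S]%classic : set RT) (A ^~ b).
  move=> i j; apply: measurable_funS (section_measurable mK mA Kb i j) => //.
  by apply: subset_itvl; rewrite bnd_simp.
have mA'b : mx_measurable (setT : set RT) (A' ^~ b).
  by move=> i j; exact: (jmeasurable_slice b i j (setT : set RT) mA').
have aES : {ae mu, forall s : RT, 0 <= s <= S -> A s b = A' s b}.
  apply: filterS aE => s H /andP[s0 sS]; apply: H.
  by rewrite s0 (le_trans sS).
have [iY iz zE] := sde_mean ST hW hs mAb mA'b (fun s => A'M s b) aES
  (forcing_integrable ST reg Kb Sv).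
split; first by move=> i; exact: iY.
have meanE r : mean P Y r b = \col_i (\int[P]_w Y r b w i 0).
  by apply/matrixP => i j; rewrite !mxE unlock.
have z0 : mean P Y 0 b = X0 b.
  by rewrite meanE zE ?lexx ?ltW// mx_integral0 addr0.
have hz : primitive_of S (fun r => mean P Y r b) (fun s => A' s b *m mean P Y s b + B s b *m v s).
  split.
    by apply: eq_mx_integrable iz => // s _; rewrite meanE.
  move=> r rS; rewrite z0 meanE (zE r rS); congr (_ + _); apply: eq_mx_integral => s _.
  by rewrite meanE.
have [psi0 _] := psiPsi b.
rewrite (variation_of_constants (primitive_ofS ST (hpsi b)) psi0 hz tS) z0; congr (_ + _).
apply: eq_mx_integral => s; rewrite inE/= in_itv/= => /andP[s0 st].
have /andP[_ t_S] := tS.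
by rewrite cutoffE ?mulmxA// s0 (le_trans st)// (le_trans t_S).
Unshelve. all: by end_near. Qed.

(** Zero outside the horizon, so that square integrability is meant on the whole line and controls
    with different horizons can be compared. *)
Definition extend0 (S : R) (v : R -> 'cV[R]_m) (s : R) : 'cV[R]_m :=
  if 0 <= s <= S then v s else 0.

Lemma extend0_sqint S (v : R -> 'cV[R]_m) : HT S v -> mx_sqint mu (setT : set RT) (extend0 S v).
Proof.
move=> /HT_sqint Sv i j; have [mv iv] := Sv i j.
have mS : measurable (`[0, S]%classic : set RT) by [].
split.
  have := (measurable_restrictT _ mS).1 mv; apply: eq_measurable_fun => s _.
  rewrite /patch in_setb /extend0 in_itv/=; case: ifPn => //.
  by rewrite mxE.
have := (integrable_mkcond _ mS).1 iv; apply: eq_integrable => // s _.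
rewrite /patch in_setb /extend0 in_itv/=; case: ifPn => //.
by rewrite mxE expr0n.
Qed.

Local Notation rho := (response B' psi).

(** This supplies the solutions with which minimality compares: the deterministic response to
    [v - u] is added to [X], and the noise stays the same. *)
Lemma competitor (u v : R -> 'cV[R]_m) X0 (X : R -> Rd -> Omega -> 'cV[R]_n) :
  HT T u -> HT T v -> ensemble_solution P W K A B G T u X0 X ->
  exists Y, ensemble_solution P W K A B G T v X0 Y /\
   {ae nu, forall b, K b -> mean P Y T b = mean P X T b +
      Psi T b *m rho `[0, T] (fun s => extend0 T v s - extend0 T u s) b}.
Proof.
move=> hu hv hX; have [hsol hHK] := hX.
pose c s := extend0 T v s - extend0 T u s.
have Sc : mx_sqint mu (setT : set RT) c.
  by apply: mx_sqintB => //; exact: extend0_sqint.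
have TT : 0 < T <= T by rewrite hT lexx.
pose good b := [/\ regular b, K b -> sde_solution P W T (A ^~ b) (B ^~ b) (G ^~ b) u (X0 b) (X ^~ b) &
  K b -> forall t, 0 <= t <= T -> forall i, P.-integrable setT (fun w => (X t b w i 0)%:E)].
(* A measurable null set is extracted because the new process is defined by cases on it. *)
have [N [mN N0 goodN]] : {ae nu, forall b, good b}.
  near=> b; split.
  - by near: b; exact: ae_regular.
  - by near: b.
  - near: b; apply: filterS (mean_state TT hu hX) => b H Kb t tT.
    by have [] := H Kb t tT.
have goodE b : ~ N b -> good b by move=> nN; apply: contrapT => ng; apply: nN; exact: goodN.
(* A solution in the sense of ensemble_solution has a mean which is measurable on
   all of K, whence the zero value on the measurable null set N. *)
pose zeta t b : 'cV[R]_n := if b \in N then 0 else Psi t b *m rho `[0, t] c b.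
pose Y t b w := X t b w + zeta t b.
have zetaE t b : ~ N b -> zeta t b = Psi t b *m rho `[0, t] c b.
  by move=> nN; rewrite /zeta memNset.
have psiC s b i j : 0 <= s <= T -> `|psi s b i j| <= C.
  by move=> sT; have [] := flowC b i j sT.
have aenN : {ae nu, forall b, ~ N b}.
  by exists N; split => // b /= /contrapT.
have Szeta t : 0 <= t <= T -> mx_sqint nu K (zeta t).
  move=> tT; have mt : measurable (`[0, t]%classic : set RT) by [].
  have tsub : `[0, t] `<=` `[0, T]%classic.
    by case/andP: tT => _ tT; apply: subset_itvl; rewrite bnd_simp.
  have [Sr _] := response_sqint jmeasurable_B' sqint_B' mpsi psiC mK mt tsub Sc.
  pose Q b : 'M[R]_n := if b \in N then 0 else Psi t b.
  have mQ : mx_measurable K Q.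
    move=> i j; apply: measurable_funTS.
    rewrite (_ : (fun b => _) = (fun b => Psi t b i j) \_ (~` N)); last first.
      apply/funext => b; rewrite /Q /patch in_setC; case: ifPn => //=.
      by rewrite mxE.
    apply/(measurable_restrictT _ (measurableC mN)); apply: measurable_funTS.
    exact: (measurableT_comp (mPsi i j) (pair1_measurable t)).
  have QC b i j : K b -> `|Q b i j| <= C.
    move=> _; rewrite /Q; case: ifPn => _; last by have [] := flowC b i j tT.
    rewrite mxE normr0; have [+ _] := flowC b i j tT.
    exact: le_trans.
  have := mx_sqintMb mK mQ QC Sr.
  move=> H i j; apply: eq_sqint (H i j) => // b _.
  by rewrite /Q /zeta; case: ifPn => // _; rewrite mul0mx.
(* On [N] nothing is added, so the formula holds there although no integrability of [X] is known;
   off [N] it is linearity of the expectation. *)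
have meanY t b : K b -> 0 <= t <= T -> mean P Y t b = mean P X t b + zeta t b.
  move=> Kb tT; have [Nb|nN] := pselect (N b).
    rewrite /mean /Y /zeta mem_set// addr0.
    by apply/matrixP => i j; rewrite !mxE; congr (fine ('E_P[_])%E); apply/funext => w; rewrite addr0.
  have [_ _ iX] := goodE b nN.
  apply/matrixP => i j; rewrite (ord1 j) !mxE unlock.
  have -> : (fun w => (Y t b w i 0)%:E) = (fun w => (X t b w i 0 + zeta t b i 0)%:E).
    by apply/funext => w; rewrite mxE.
  have ci : P.-integrable setT (fun w : Omega => (zeta t b i 0)%:E) by exact: finite_measure_integrable_cst.
  have := RintegralD measurableT (iX Kb t tT i) ci; rewrite /Rintegral => ->; congr (_ + _).
  have := Rintegral_cst P measurableT (zeta t b i 0); rewrite /Rintegral => ->.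
  by rewrite (_ : fine _ = 1) ?mulr1//; have := @probability_setT _ _ _ P; move=> /(congr1 fine).
exists Y; split; last first.
  apply: filterS aenN => b nN Kb.
  by rewrite meanY ?lexx ?ltW// zetaE.
split; last first.
  move=> t tT; apply/HK_sqint => i j.
  have Sm := (HK_sqint _).1 (hHK t tT).
  apply: eq_sqint (mx_sqintD mK Sm (Szeta t tT) i j) => // b.
  by rewrite inE => Kb; rewrite meanY.
apply: filterS aenN => b nN Kb.
have [reg hs _] := goodE b nN.
have [aE SB] := reg Kb.
have mA'b : mx_measurable (setT : set RT) (A' ^~ b).
  by move=> i j; exact: (jmeasurable_slice b i j (setT : set RT) mA').
have iu := forcing_integrable (lexx T) reg Kb (HT_sqint hu).
have iv := forcing_integrable (lexx T) reg Kb (HT_sqint hv).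
have [psi0 psiPsib] := psiPsi b.
have mT : measurable (`[0, T]%classic : set RT) by [].
have cE s : s \in `[0, T]%classic -> B' s b *m c s = B s b *m (v s - u s).
  rewrite inE/= in_itv/= => sT.
  by rewrite cutoffE// /c /extend0 sT.
have [ir _] := response_bound mpsi psiC mT (@subset_refl _ _) SB Sc.
have ipf : mx_integrable `[0, T] (fun s => psi s b *m (B s b *m (v s - u s))).
  by apply: eq_mx_integrable ir => // s sT; rewrite -cE// mulmxA.
have hz := variation_of_constants_solution (hPsi b) psiPsib ipf.
apply: (sde_shift (ltW hT) (section_measurable mK mA Kb) mA'b (fun s => A'M s b) aE iu iv _ _ (hs Kb)).
- have zE t : 0 <= t <= T -> zeta t b =
     Psi t b *m mx_integral `[0, t] (fun s => psi s b *m (B s b *m (v s - u s))).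
    move=> /andP[t0 tT]; rewrite zetaE//; congr (_ *m _); apply: eq_mx_integral => s.
    rewrite inE/= in_itv/= => /andP[s0 st].
    by rewrite -cE ?mulmxA// inE/= in_itv/= s0 (le_trans st).
  have [iz0 zE0] := hz; split.
    apply: eq_mx_integrable iz0 => // s; rewrite inE/= in_itv/= => sT.
    by rewrite zE.
  have T0 : (0 : R) <= 0 <= T by rewrite lexx ltW.
  move=> t tT; rewrite (zE t tT) (zE0 t tT) (zE 0 T0); congr (_ + _).
  apply: eq_mx_integral => s; rewrite inE/= in_itv/= => /andP[s0 st].
  by rewrite zE// s0 (le_trans st)//; case/andP: tT.
- by rewrite zetaE// /response mx_integral0 mulmx0.
Unshelve. all: by end_near. Qed.

Lemma sqnorm_integral_ge0 (p : Rd -> 'cV[R]_n) : 0 <= \int[nu]_(b in K) sqnorm (p b).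
Proof. by apply: Rintegral_ge0 => b _; exact: sqnorm_ge0. Qed.

Lemma normKE (p : Rd -> 'cV[R]_n) : mx_sqint nu K p ->
  normK K p = (Num.sqrt (\int[nu]_(b in K) sqnorm (p b)))%:E.
Proof.
move=> Sp; rewrite /normK -powR12_sqrt; last exact: sqnorm_integral_ge0.
rewrite -poweR_EFin; congr (_ `^ _)%E; rewrite /Rintegral fineK//.
exact: integrable_fin_num (mx_sqint_sqnorm mK Sp).
Qed.

Lemma normK_le (p q : Rd -> 'cV[R]_n) : mx_sqint nu K p -> mx_sqint nu K q ->
  (normK K p <= normK K q)%E ->
  \int[nu]_(b in K) sqnorm (p b) <= \int[nu]_(b in K) sqnorm (q b).
Proof. by move=> Sp Sq; rewrite !normKE// lee_fin ler_sqrt// sqnorm_integral_ge0. Qed.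

Lemma normK_lt1 (p : Rd -> 'cV[R]_n) : mx_sqint nu K p -> (normK K p < 1%:E)%E ->
  \int[nu]_(b in K) sqnorm (p b) <= 1.
Proof.
move=> Sp; rewrite normKE// lte_fin -[X in _ < X]sqrtr1 ltr_sqrt//.
exact: ltW.
Qed.

Lemma flow_sqint (F : R -> Rd -> 'M[R]_n) t (p : Rd -> 'cV[R]_n) : jmeasurable F ->
  (forall b i j, `|F t b i j| <= C) -> mx_sqint nu K p ->
  mx_sqint nu K (fun b => F t b *m p b) /\
  \int[nu]_(b in K) sqnorm (F t b *m p b) <=
  n%:R * (n%:R * C) ^+ 2 * \int[nu]_(b in K) sqnorm (p b).
Proof.
move=> mF FC Sp.
have mFt : mx_measurable K (F t).
  move=> i j; apply: measurable_funTS.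
  exact: (measurableT_comp (mF i j) (pair1_measurable t)).
have SF := mx_sqintMb mK mFt (fun b i j _ => FC b i j) Sp.
split => //; have ip := mx_sqint_sqnorm mK Sp.
rewrite -(RintegralZl _ mK ip); apply: le_Rintegral => //.
- exact: mx_sqint_sqnorm.
- exact: (integrableZR _ mK ip).
- by move=> b _; exact: sqnorm_mulmx.
Qed.

Let psiC s b i j : 0 <= s <= T -> `|psi s b i j| <= C.
Proof. by move=> sT; have [] := flowC b i j sT. Qed.

Let subT s t : 0 <= s -> t <= T -> `]s, t] `<=` `[0, T]%classic.
Proof.
move=> s0 tT r; rewrite /= !in_itv/= => /andP[sr rt].
by rewrite (le_trans s0 (ltW sr)) (le_trans rt).
Qed.

Let subT0 t : t <= T -> `[0, t] `<=` `[0, T]%classic.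
Proof. by move=> tT; apply: subset_itvl; rewrite bnd_simp. Qed.

(** Additivity over intervals rests on integrability, which the sections of [B'] provide for almost
    every [b]. *)
Lemma response_itvS c s t : 0 <= s <= t -> t <= T -> mx_sqint mu (setT : set RT) c ->
  {ae nu, forall b, rho `[0, t] c b = rho `[0, s] c b + rho `]s, t] c b}.
Proof.
move=> st tT Sc; apply: filterS (ae_section_sqint jmeasurable_B' sqint_B') => b SB.
have mt : measurable (`[0, t]%classic : set RT) by [].
have [ir _] := response_bound mpsi psiC mt (subT0 tT) SB Sc.
exact: mx_integral_itvS.
Qed.

Lemma responseB c c' t : t <= T -> mx_sqint mu (setT : set RT) c ->
  mx_sqint mu (setT : set RT) c' ->
  {ae nu, forall b, rho `[0, t] (fun s => c s - c' s) b = rho `[0, t] c b - rho `[0, t] c' b}.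
Proof.
move=> tT Sc Sc'; apply: filterS (ae_section_sqint jmeasurable_B' sqint_B') => b SB.
have mt : measurable (`[0, t]%classic : set RT) by [].
have [ir _] := response_bound mpsi psiC mt (subT0 tT) SB Sc.
have [ir' _] := response_bound mpsi psiC mt (subT0 tT) SB Sc'.
rewrite /response -mx_integralN// -mx_integralD//; last exact: mx_integrableN.
by apply: eq_mx_integral => s _; rewrite mulmxBr.
Qed.

(** This serves for patched controls: where they agree with [u] the difference is zero, and the
    domain of integration shrinks to the times of the switch. *)
Lemma eq_response (E F : set R) c c' b : measurable (E : set RT) -> measurable (F : set RT) ->
  E `<=` F -> (forall s, s \in E -> c s = c' s) -> (forall s, s \in F -> s \notin E -> c s = 0) ->
  rho F c b = rho E c' b.
Proof.
move=> mE mF EF cE cF; apply/matrixP => i j; rewrite !mxE.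
rewrite Rintegral_mkcond [RHS]Rintegral_mkcond; apply: eq_Rintegral => s _; rewrite /patch.
have [sE|sE] := boolP (s \in E); last first.
  by case: ifPn => // sF; rewrite cF// mulmx0 mxE.
by rewrite ifT ?cE// inE; apply: EF; rewrite inE in sE.
Qed.

(** * Optimality conditions and the vanishing of the error *)

Section minimizer.
(* For an arbitrary U the controls admit no convex variations; replacing u by w on
   a short interval only is always possible, and is linear to first order. *)
Variables (U : set 'cV[R]_m) (u : R -> 'cV[R]_m) (X0 XF : Rd -> 'cV[R]_n).
Variable X : R -> Rd -> Omega -> 'cV[R]_n.
Hypotheses (hXF : HK K XF) (cu : control U T u).
Hypothesis hX : ensemble_solution P W K A B G T u X0 X.
Hypothesis minX : forall v Y, control U T v -> ensemble_solution P W K A B G T v X0 Y ->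
  (mean_error P K XF T X <= mean_error P K XF T Y)%E.

Let err b : 'cV[R]_n := mean P X T b - XF b.
(** Half the gradient of the squared error with respect to responses pulled back to time 0; the
    transpose comes from moving [Psi T b] to the other side of the inner product. *)
Let adj b : 'cV[R]_n := (Psi T b)^T *m err b.

Let err_sqint : mx_sqint nu K err.
Proof.
apply: mx_sqintB => //; apply/HK_sqint => //.
by have [_] := hX; apply; rewrite lexx ltW.
Qed.

Definition excess (w : R -> 'cV[R]_m) (r : R) : 'cV[R]_m := extend0 T w r - extend0 T u r.

Let TT : 0 <= T <= T. Proof. by rewrite lexx ltW. Qed.

Let adj_sqint : mx_sqint nu K adj.
Proof.
pose F t b := (Psi t b)^T.
have mF : jmeasurable F.
  move=> i j; rewrite (_ : (fun z => _) = (fun z : RT * Rd => Psi z.1 z.2 j i)).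
    exact: mPsi.
  by apply/funext => z; rewrite mxE.
have FC b i j : `|F T b i j| <= C by rewrite mxE; have [] := flowC b j i TT.
by have [] := flow_sqint mF FC err_sqint.
Qed.

(** The constant of [flow_sqint] times that of [response_sqint]: together they bound the quadratic
    term of the expanded error. *)
Let kappa : R := n%:R * (n%:R * C) ^+ 2 * @response_cst R n m C.

Let kappa_ge0 : 0 <= kappa.
Proof. by rewrite mulr_ge0// ?response_cst_ge0// mulr_ge0// sqr_ge0. Qed.

Lemma HT_patch E S v w : measurable (E : set RT) -> HT S v -> HT S w ->
  HT S (fun s => if s \in E then w s else v s : 'cV[R]_m).
Proof.
move=> mE hv hw i j; have mS : measurable (`[0, S]%classic : set RT) by [].
have Sv := HT_sqint hv i j; have Sw := HT_sqint hw i j.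
apply/(Lp_on2P _ _ mS).
have H F : measurable (F : set RT) -> forall f : RT -> R, sqint mu (`[0, S]%classic : set RT) f ->
   sqint mu (`[0, S]%classic : set RT) (fun s => \1_F s * f s).
  move=> mF f; have mi : measurable_fun setT (\1_F : RT -> R) by exact: measurable_indic.
  apply: (@sqintZb _ _ _ mu _ f (\1_F : RT -> R) 1) => //.
  by move=> s _; rewrite indicE; case: (_ \in _); rewrite ?normr1 ?normr0.
have := sqintD mS (H E mE _ Sw) (H (~` E) (measurableC mE) _ Sv).
apply: eq_sqint => // s _; rewrite !indicE in_setC.
by case: (s \in E); rewrite /= ?mul1r ?mul0r ?addr0 ?add0r.
Qed.

(** [U] constrains a control pointwise, so following [w] on []s, t]] and [u] elsewhere stays
    admissible. The error becomes [err] plus [Psi T b] times the response of that interval, and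
    minimality is read off the expanded square. Half-open intervals will tile the horizon. *)
Lemma variation w s t : control U T w -> 0 <= s <= t -> t <= T ->
  0 <= 2 * inner nu K adj (rho `]s, t] (excess w)) + kappa *
       (\int[mu]_(r in `]s, t]) power nu B' r) * \int[mu]_(r in `]s, t]) sqnorm (excess w r).
Proof.
move=> cw /andP[s0 st] tT; pose c := excess w.
have [hw Uw] := cw; have [hu Uu] := cu.
have mE : measurable (`]s, t]%classic : set RT) by [].
pose E : set R := `]s, t]%classic.
pose v r := if r \in E then w r else u r.
have cv : control U T v.
  split; first exact: HT_patch.
  by move=> r rT; rewrite /v; case: ifPn => _; [exact: Uw|exact: Uu].
have [hv _] := cv.
have [Y [hY mY]] := competitor hu hv hX.
have Sc : mx_sqint mu (setT : set RT) c by apply: mx_sqintB => //; exact: extend0_sqint.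
have [Sr br] := response_sqint jmeasurable_B' sqint_B' mpsi psiC mK mE (subT s0 tT) Sc.
have PsiC b i j : `|Psi T b i j| <= C by have [] := flowC b i j TT.
have [SPr bPr] := flow_sqint mPsi PsiC Sr.
have SY : mx_sqint nu K (fun b => mean P Y T b - XF b).
  apply: mx_sqintB => //; apply/HK_sqint => //.
  by have [_] := hY; apply.
have := normK_le err_sqint SY (minX cv hY).
have -> : \int[nu]_(b in K) sqnorm (mean P Y T b - XF b) =
    \int[nu]_(b in K) sqnorm (err b + Psi T b *m rho E c b).
  apply: ae_eq_Rintegral => //.
  - by apply/measurable_EFinP; exact: measurable_int (mx_sqint_sqnorm mK SY).
  - by apply/measurable_EFinP; apply: measurable_int (mx_sqint_sqnorm mK (mx_sqintD mK err_sqint SPr)).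
  apply: filterS mY => b H Kb; rewrite H// /err addrAC; congr (sqnorm (_ + _ *m _)).
  apply: eq_response => //.
  - exact: subT.
  - by move=> r rE; rewrite /c /excess /extend0 /v rE.
  - by move=> r _ rE; rewrite /excess /extend0 /v (negbTE rE) subrr.
rewrite inner_sqnormD//.
have -> : inner nu K err (fun b => Psi T b *m rho E c b) = inner nu K adj (rho E c).
  by apply: eq_Rintegral => b _; rewrite dot_mulmxr.
have c20 : 0 <= n%:R * (n%:R * C) ^+ 2 by rewrite mulr_ge0// sqr_ge0.
have := le_trans bPr (ler_wpM2l c20 br).
rewrite [X in _ <= X]mulrA [X in _ <= X * _]mulrA -/kappa.
set x := \int[nu]_(b in K) sqnorm _; set y := \int[nu]_(b in K) sqnorm _.
set z := kappa * _ * _; set q := inner _ _ _ _; lra.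
Qed.

(** An application of [partition_le]: [L] accumulates the first-order term, [p] the power of [B']
    and [q] the squared norm of the change of control. Absolute continuity of the integral makes the
    increments of [p] uniformly small. *)
Lemma variational_inequality w : control U T w ->
  0 <= inner nu K adj (rho `[0, T] (excess w)).
Proof.
move=> cw; pose c := excess w.
have [hw _] := cw; have [hu _] := cu.
have Sc : mx_sqint mu (setT : set RT) c by apply: mx_sqintB => //; exact: extend0_sqint.
have ic := mx_sqint_sqnorm measurableT Sc.
have ip := power_integrable sqint_B'.
pose L t := 2 * inner nu K adj (rho `[0, t] c).
pose p t := \int[mu]_(r in `[0, t]) power nu B' r.
pose q t := \int[mu]_(r in `[0, t]) sqnorm (c r).
have itvS (f : R -> R) s t : mu.-integrable setT (EFin \o f) -> 0 <= s <= t ->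
    \int[mu]_(r in `[0, t]) f r - \int[mu]_(r in `[0, s]) f r = \int[mu]_(r in `]s, t]) f r.
  move=> jf st; have jt : mu.-integrable (`[0, t]%classic : set RT) (EFin \o f).
    exact: integrableS jf.
  by rewrite (Rintegral_itvS st jt) addrAC subrr add0r.
have Srho E : measurable (E : set RT) -> E `<=` `[0, T]%classic -> mx_sqint nu K (rho E c).
  by move=> mE ET; have [] := response_sqint jmeasurable_B' sqint_B' mpsi psiC mK mE ET Sc.
have : L 0 <= L T.
  apply: (@partition_le _ T kappa L p q) => //.
    move=> s t st tT; have /andP[s0 s_t] := st.
    rewrite /p /q !itvS//; split.
      by rewrite -subr_ge0 itvS//; apply: Rintegral_ge0 => r _; exact: sqnorm_ge0.
    rewrite /L (_ : inner nu K adj (rho `[0, t] c) =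
       inner nu K adj (rho `[0, s] c) + inner nu K adj (rho `]s, t] c)); last first.
      rewrite -innerDr//; [|apply: Srho => //; apply: subT0; exact: le_trans tT|
         by apply: Srho => //; exact: subT].
      apply: ae_eq_inner => //; [by apply: Srho => //; exact: subT0| |].
        apply: mx_sqintD => //; apply: Srho => //; last exact: subT.
        by apply: subT0; exact: le_trans tT.
      by apply: filterS (response_itvS st tT Sc) => b ->.
    rewrite mulrDr [X in X + _](_ : _ = 2 * inner nu K adj (rho `]s, t] c)).
      exact: variation.
    by rewrite addrAC subrr add0r.
  move=> eta eta0.
  have [del [del0 H]] := integral_normr_continuous ip eta0.
  exists del => // s t st tT std; rewrite /p itvS//.
  have mE : measurable (`]s, t]%classic : set RT) by [].
  have HE := H `]s, t]%classic mE.
  have iE : mu.-integrable (`]s, t]%classic : set RT) (EFin \o power nu B').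
    exact: integrableS ip.
  apply: le_trans (ler_norm _) _; apply: le_trans (le_normr_Rintegral mE iE) _.
  have mst : (@lebesgue_measure R `]s, t]%classic < del%:E)%E.
    by rewrite lebesgue_measure_itv/= lte_fin; case: ifPn => _; rewrite lte_fin.
  exact/ltW/HE.
rewrite /L; have -> : inner nu K adj (rho `[0, 0] c) = 0.
  rewrite (_ : rho `[0, 0] c = (fun b => 0 *: adj b)).
    by rewrite innerZr// mul0r.
  by apply/funext => b; rewrite scale0r /response mx_integral0.
by rewrite mulr0 pmulr_rge0.
Qed.

Lemma Rintegral_itv_le (f : R -> R) s t : mu.-integrable setT (EFin \o f) ->
  (forall r, 0 <= f r) -> 0 <= s <= t ->
  \int[mu]_(r in `[0, s]) f r <= \int[mu]_(r in `[0, t]) f r.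
Proof.
move=> jf f0 st; have jt : mu.-integrable (`[0, t]%classic : set RT) (EFin \o f).
  exact: integrableS jf.
by rewrite (Rintegral_itvS st jt) lerDl; apply: Rintegral_ge0.
Qed.

Let PsiC b i j : `|Psi T b i j| <= C.
Proof. by have [] := flowC b i j TT. Qed.

(** The bound for the remainder [z] of the next lemma. The factor 2 comes from splitting the square
    of a difference; the first summand is the flow bound for a mean of norm at most 1 at time [S],
    the second the response bound for [u], enlarged from [[0, S]] to [[0, T]] so as not to depend on
    [S]. *)
Let cost : R := 2 * (n%:R * (n%:R * C) ^+ 2 + @response_cst R n m C *
  (\int[mu]_(r in `[0, T]) power nu B' r) * \int[mu]_(r in `[0, T]) sqnorm (extend0 T u r)).

(* Steer N adj close to 0 at some time S and then switch back to u: this control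
   has rho `[0, T] (excess v) = z - N adj with z bounded independently of N. *)
Lemma adj_bound (N : nat) : ensemble_controllable P W K A B G T U -> (0 < N)%N ->
  N%:R * \int[nu]_(b in K) sqnorm (adj b) <= cost.
Proof.
move=> hctrl N0; have [hu Uu] := cu.
have SNadj : mx_sqint nu K (fun b => N%:R *: adj b) by exact: mx_sqintZ.
have S0 : mx_sqint nu K (fun=> 0 : 'cV[R]_n).
  by move=> i j; apply: eq_sqint (sqint0 nu mK) => // b _; rewrite mxE.
have [S [w [Xc [/andP[S_gt0 ST] [hw Uw] _ hXc]]]] :=
  hctrl 1 _ _ ltr01 ((HK_sqint _).2 SNadj) ((HK_sqint _).2 S0).
rewrite /mean_error => Xc1.
have SS : 0 <= S <= S by rewrite lexx ltW.
have mS : measurable (`[0, S]%classic : set RT) by [].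
have mT : measurable (`[0, T]%classic : set RT) by [].
have mT' : measurable (`[0, T]%classic : set R) by [].
pose E : set R := `[0, S]%classic.
pose v r := if r \in E then extend0 S w r else u r.
have Sw := extend0_sqint hw; have Su := extend0_sqint hu.
have cv : control U T v.
  split.
    apply: HT_patch => // i j; apply/(Lp_on2P _ _ mT).
    exact: (mx_sqintS measurableT mT (@subsetT _ _) Sw).
  move=> r rT; rewrite /v; case: ifPn => [|_]; last exact: Uu.
  by rewrite inE /E/= in_itv/= /extend0 => rS; rewrite rS; exact: Uw.
have [hv _] := cv.
have Sv : mx_sqint mu (setT : set RT) (excess v).
  by apply: mx_sqintB => //; exact: extend0_sqint.
have [Sr _] := response_sqint jmeasurable_B' sqint_B' mpsi psiC mK mT (@subset_refl _ _) Sv.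
have [Sru bru] := response_sqint jmeasurable_B' sqint_B' mpsi psiC mK mS (subT0 ST) Su.
have SXc : mx_sqint nu K (mean P Xc S) by apply/HK_sqint; have [_] := hXc; apply.
have pC b i j : `|psi S b i j| <= C by apply: psiC; rewrite (ltW S_gt0).
have [Sm bm] := flow_sqint mpsi pC SXc.
pose z b := psi S b *m mean P Xc S b - rho `[0, S] (extend0 T u) b.
have Sz : mx_sqint nu K z by exact: mx_sqintB.
(* At time [S] the pulled-back mean is [N%:R *: adj b] plus the response to [w]. Subtracting the
   response to [u] leaves that to [excess v], which is zero after [S]. *)
have zE : {ae nu, forall b, K b -> z b = rho `[0, T] (excess v) b + N%:R *: adj b}.
  have STT : 0 < S <= T by rewrite S_gt0.
  near=> b => Kb.
  have -> : rho `[0, T] (excess v) b = rho `[0, S] (fun r => extend0 S w r - extend0 T u r) b.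
    apply: eq_response => //; first exact: subT0.
      move=> r rS; rewrite /excess {1}/extend0 /v rS ifT//.
      by move: rS; rewrite inE/= in_itv/= => /andP[-> /le_trans]; exact.
    by move=> r _ rS; rewrite /excess {1}/extend0 /v (negbTE rS) /extend0 subrr.
  have -> : rho `[0, S] (fun r => extend0 S w r - extend0 T u r) b =
      rho `[0, S] (extend0 S w) b - rho `[0, S] (extend0 T u) b.
    by near: b; exact: responseB.
  have H : psi S b *m mean P Xc S b = N%:R *: adj b +
      mx_integral `[0, S] (fun s => psi s b *m B' s b *m w s).
    have : forall t, 0 <= t <= S -> (forall i, P.-integrable setT (fun w => (Xc t b w i 0)%:E)) /\
      psi t b *m mean P Xc t b = N%:R *: adj b +
        mx_integral `[0, t] (fun s => psi s b *m B' s b *m w s).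
      move: Kb; near: b; exact: (mean_state STT hw hXc).
    by move=> /(_ S SS)[].
  rewrite /z H [RHS]addrC addrA; congr (_ + _ - _).
  apply: eq_mx_integral => s; rewrite inE/= in_itv/= /extend0 => sS.
  by rewrite sS.
have adj_z : inner nu K adj z =
    inner nu K adj (rho `[0, T] (excess v)) + N%:R * \int[nu]_(b in K) sqnorm (adj b).
  rewrite (ae_eq_inner mK adj_sqint Sz (mx_sqintD mK Sr SNadj) zE).
  rewrite innerDr// innerZr//; congr (_ + _ * _).
  by apply: eq_Rintegral => b _; rewrite dotxx.
have az : 2 * inner nu K adj z <=
    \int[nu]_(b in K) sqnorm (adj b) + \int[nu]_(b in K) sqnorm (z b).
  exact: inner_le.
have vi := variational_inequality cv.
have Xc_le1 : \int[nu]_(b in K) sqnorm (mean P Xc S b) <= 1.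
  apply: normK_lt1 => //; move: Xc1; congr (normK _ _ < _)%E.
  by apply/funext => b; rewrite subr0.
have zc : \int[nu]_(b in K) sqnorm (z b) <= cost.
  have im := mx_sqint_sqnorm mK Sm; have ir := mx_sqint_sqnorm mK Sru.
  apply: (@le_trans _ _ (2 * (\int[nu]_(b in K) sqnorm (psi S b *m mean P Xc S b) +
      \int[nu]_(b in K) sqnorm (rho `[0, S] (extend0 T u) b)))).
    rewrite -(RintegralD mK im ir) -(RintegralZl 2 mK (integrableDR mK im ir)).
    apply: le_Rintegral => //; first exact: mx_sqint_sqnorm.
      exact: (integrableZR 2 mK (integrableDR mK im ir)).
    move=> b _; apply: le_trans (sqnormD_le _ _) _.
    by rewrite sqnormN.
  rewrite ler_pM2l//; apply: lerD.
    apply: le_trans bm _; rewrite ler_piMr// mulr_ge0// sqr_ge0//.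
  apply: le_trans bru _.
  have S0T : 0 <= S <= T by rewrite ltW.
  have pw0 r : 0 <= power nu B' r by apply: Rintegral_ge0 => b _; exact: sqnorm_ge0.
  have h1 := Rintegral_itv_le (power_integrable sqint_B') pw0 S0T.
  have h2 := Rintegral_itv_le (mx_sqint_sqnorm measurableT Su) (fun r => sqnorm_ge0 _) S0T.
  have rc0 := @response_cst_ge0 R n m C.
  apply: ler_pM => //.
  - by rewrite mulr_ge0//; apply: Rintegral_ge0.
  - by apply: Rintegral_ge0 => r _; exact: sqnorm_ge0.
  - exact: ler_wpM2l.
have a0 := sqnorm_integral_ge0 adj.
(* With [a] the integral of [sqnorm (adj b)], the previous facts give 2 N a <= a + cost; since a <=
   N a, the claim follows. *)
have N1 : 1 <= N%:R :> R by rewrite ler1n.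
have := ler_wpM2r a0 N1; rewrite mul1r.
move: adj_z az vi zc.
set a := \int[nu]_(b in K) sqnorm (adj b); set Na := _ * a.
set c1 := inner nu K adj z; set c2 := inner nu K adj _; set c3 := \int[nu]_(b in K) _.
set c4 := cost; lra.
Unshelve. all: by end_near. Qed.

(** If the integral of [sqnorm (adj b)] were positive, an integer above its quotient into [cost]
    would contradict [adj_bound]. Hence [adj] vanishes almost everywhere on [K], and [err] with it
    because [Psi T b] is invertible. *)
Lemma mean_reaches_target : ensemble_controllable P W K A B G T U ->
  {ae nu, forall b, K b -> mean P X T b = XF b}.
Proof.
move=> hctrl; set a := \int[nu]_(b in K) sqnorm (adj b).
have a0 : a = 0.
  apply/eqP; rewrite eq_le sqnorm_integral_ge0 andbT leNgt; apply/negP => a_gt0.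
  have := adj_bound hctrl (ltn0Sn (Num.truncn (cost / a))); apply/negP.
  by rewrite -ltNge -ltr_pdivrMr// truncnS_gt.
have isq := mx_sqint_sqnorm mK adj_sqint.
have : (\int[nu]_(b in K) `|(sqnorm (adj b))%:E| = 0)%E.
  under eq_integral do rewrite abse_EFin ger0_norm ?sqnorm_ge0//.
  rewrite -(@fineK _ (\int[nu]_(b in K) _)%E); first by rewrite -/(Rintegral _ _ _) -/a a0.
  exact: integrable_fin_num isq.
move/(ae_eq_integral_abs nu mK (measurable_int _ isq)).
apply: filterS => b H Kb; have := H Kb => -[/sqnorm_eq0 adj0].
have [_ psiT] := psiPsi b.
have PsipsiT : Psi T b *m psi T b = 1%:M by apply: mulmx1C; exact: psiT.
apply/eqP; rewrite -subr_eq0 -/(err b); apply/eqP.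
by rewrite -[err b]mul1mx -trmx1 -PsipsiT trmx_mul -mulmxA -/(adj b) adj0 mulmx0.
Qed.

(** This is [mean_state] at time [T], with the mean replaced by the target it reaches. *)
Lemma steering_equation : ensemble_controllable P W K A B G T U ->
  {ae nu, forall b, K b ->
    mx_integral `[0, T] (fun s => psi s b *m B' s b *m u s) = psi T b *m XF b - X0 b}.
Proof.
move=> hctrl; have [hu _] := cu.
have STT : 0 < T <= T by rewrite hT lexx.
near=> b => Kb.
have <- : mean P X T b = XF b by move: Kb; near: b; exact: mean_reaches_target.
have : forall t, 0 <= t <= T -> (forall i, P.-integrable setT (fun w => (X t b w i 0)%:E)) /\
    psi t b *m mean P X t b = X0 b + mx_integral `[0, t] (fun s => psi s b *m B' s b *m u s).
  by move: Kb; near: b; exact: (mean_state STT hu hX).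
by move=> /(_ T TT)[_ ->]; rewrite addrAC subrr add0r.
Unshelve. all: by end_near. Qed.

End minimizer.

End steering.

Theorem proposition4 (R : realType) (d n m k : nat)
    (dO : measure_display) (Omega : measurableType dO) (P : probability Omega R)
    (T : R) (hT : 0 < T)
    (K : set (d.-tuple (measurableTypeR R))) (hK : compact_tuple K)
    (U : set 'cV[R]_m)
    (A : R -> d.-tuple (measurableTypeR R) -> 'M[R]_n)
    (B : R -> d.-tuple (measurableTypeR R) -> 'M[R]_(n, m))
    (G : R -> d.-tuple (measurableTypeR R) -> 'M[R]_(n, k))
    (hA : Lp_mx (lebesgue_measure \x lebesgue_tuple d)%E +oo%E (`[0, T] `*` K)
            (fun p => A p.1 p.2))
    (hB : Lp_mx (lebesgue_measure \x lebesgue_tuple d)%E 2%:E (`[0, T] `*` K)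
            (fun p => B p.1 p.2))
    (hG : Lp_mx (lebesgue_measure \x lebesgue_tuple d)%E 2%:E (`[0, T] `*` K)
            (fun p => G p.1 p.2))
    (W : R -> Omega -> 'cV[R]_k) (hW : brownian_motion P T W)
    (hctrl : ensemble_controllable P W K A B G T U)
    (Phi : R -> R -> d.-tuple (measurableTypeR R) -> 'M[R]_n)
    (hPhi : {ae lebesgue_tuple d, forall b, K b ->
               transition_matrix T (A ^~ b) (fun t s => Phi t s b)})
    (X0 XF : d.-tuple (measurableTypeR R) -> 'cV[R]_n)
    (hX0 : HK K X0) (hXF : HK K XF)
    (u : R -> 'cV[R]_m)
    (hu : minimizes_mean_error P W K A B G T U X0 XF u) :
  {ae lebesgue_tuple d, forall b, K b ->
     mx_integral `[0, T] (fun s => Phi 0 s b *m B s b *m u s) =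
     Phi 0 T b *m XF b - X0 b}.
Proof.
have mK := compact_tuple_measurable hK.
have [A' [M [mA' A'M AA']]] := truncation mK hA.
have [Psi [psi [C [[mPsi mpsi] flowC hPsi' hpsi psiPsi]]]] := flow_exists T mA' A'M.
have mA : mx_measurable (`[0, T] `*` K : set (measurableTypeR R * d.-tuple (measurableTypeR R)))
    (fun p => A p.1 p.2) by move=> i j; have [] := hA i j.
have [cu [X [hX minX]]] := hu.
have := steering_equation hT mK hW mA hB mA' A'M AA' mPsi mpsi flowC hPsi' hpsi psiPsi hXF cu hX minX hctrl.
move=> steer; near=> b => Kb.
(* [psi] was built from the truncation [A']. At a parameter where [A] and [A'] agree for almost
   every time, uniqueness identifies it with the given transition matrix. *)
have psiE : forall s, 0 <= s <= T -> Phi 0 s b = psi s b.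
  have [psi0 _] := psiPsi b.
  apply: (adjoint_transition (hpsi b) psi0 (M := M) (a0 := A ^~ b)
    (phi := fun t s => Phi t s b)).
  - by move=> i j; exact: (jmeasurable_slice b i j (setT : set (measurableTypeR R)) mA').
  - by move=> s' i j; exact: A'M.
  - exact: (section_measurable mK mA Kb).
  - by move: Kb; near: b.
  - by move: Kb; near: b.
rewrite psiE ?lexx ?ltW//.
have <- : mx_integral `[0, T] (fun s => psi s b *m cutoff T K B s b *m u s) =
    psi T b *m XF b - X0 b by move: Kb; near: b.
apply: eq_mx_integral => s; rewrite inE/= in_itv/= => sT.
by rewrite psiE// cutoffE.
Unshelve. all: by end_near. Qed.
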